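(* For $z>0$, \begin{equation*} G_{N+1,1}^{0,N+1} \left(z \Big| \begin{matrix} 1, 1/2, \ldots, 1/2 \\ 0 \end{matrix} \right) = \pi^{\frac{N}{2}} - \sum_{k=0}^{\infty} z^{-1/2-k} \sum_{j=0}^{N-1} H_{kj} \cdot \left[\log z\right]^j \end{equation*} with \begin{equation*} H_{kj} \coloneqq \frac{(-1)^{Nk}}{j!} \, \sum_{n=j}^{N-1} \left(\frac{1}{2}+k\right)^{-(n-j+1)} \sum_{j_1+\ldots+j_N=N-1-n} \ \prod_{t=1}^N \left\{\sum_{\ell_1+\ldots+\ell_{k+1}=j_t} \frac{\Gamma^{(\ell_{k+1})}(1)}{\ell_{k+1}!} \left\{\prod_{i=1}^{k-1} \left(k-i+1\right)^{-(\ell_i+1)}\right\}\right\}, \end{equation*} where $j_i \in \mathbb{N}_0$ and $\ell_i\in \mathbb{N}_0$.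
   Context: $N \in \mathbb{N}$; $\log$ denotes the natural logarithm; $\Gamma^{(\ell)}$ denotes the $\ell$-th derivative of the Gamma function. $G_{p,q}^{m,n}\left(z \Big| \begin{matrix} a_1,\ldots, a_p \\ b_1,\ldots, b_q\end{matrix}\right)$ is the Meijer G-function, defined by the contour integral $\frac{1}{2\pi \mathrm{i}} \int_{\mathcal{L}} \frac{\prod_{j=1}^m \Gamma(b_j+s) \prod_{i=1}^n \Gamma(1-a_i-s)}{\prod_{i=n+1}^p \Gamma(a_i+s) \prod_{j=m+1}^q \Gamma(1-b_j-s)} z^{-s} \, \mathrm{d} s$ over a contour $\mathcal{L}$ separating the poles of the $\Gamma(b_j+s)$ from those of the $\Gamma(1-a_i-s)$. *)

(* Defs.v *)
From Stdlib Require Import Reals List Arith Factorial.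
From Coquelicot Require Import Coquelicot.
Import ListNotations.
Open Scope R_scope.

Definition cexp (w : C) : C :=
  (exp (Re w) * cos (Im w), exp (Re w) * sin (Im w)).

Definition cpowR (t : R) (w : C) : C := cexp (w * RtoC (ln t)).

(** Euler's integral for the complex Gamma function,
    Gamma(w) = \int_0^\infty t^{w-1} e^{-t} dt   (valid for Re w > 0). *)
Definition GammaC (w : C) : C :=
  RInt_gen (V := C_R_CompleteNormedModule)
    (fun t => (cpowR t (w - 1) * RtoC (exp (- t)))%C)
    (at_right 0) (Rbar_locally p_infty).

Definition GammaR (x : R) : R :=
  RInt_gen (fun t => Rpower t (x - 1) * exp (- t))
    (at_right 0) (Rbar_locally p_infty).

Definition Gamma_deriv (l : nat) (x : R) : R := Derive_n GammaR l x.

(** Contour integral (1/(2 pi i)) \int_L f(s) ds along the vertical line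
    L = { c + i y : y from -oo to +oo } (upward orientation, ds = i dy). *)
Definition vline_integral (c : R) (f : C -> C) : C :=
  (/ (RtoC (2 * PI) * Ci) *
   RInt_gen (V := C_R_CompleteNormedModule)
     (fun y => (f (c, y) * Ci)%C)
     (Rbar_locally m_infty) (Rbar_locally p_infty))%C.

Definition Cprod (l : list C) : C := fold_right Cmult (RtoC 1) l.

(** Meijer G-function
    G^{m,n}_{p,q}(z | a_1..a_p ; b_1..b_q)
      = 1/(2 pi i) \int_L  prod_{j<=m} Gamma(b_j+s) prod_{i<=n} Gamma(1-a_i-s)
                      / (prod_{i>n} Gamma(a_i+s) prod_{j>m} Gamma(1-b_j-s)) z^{-s} ds
    where the contour L is the vertical line Re s = c.  The Gamma values are
    computed by Euler's integral, so this agrees with the usual definition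
    whenever every Gamma argument on the line has positive real part and the
    line separates the two families of poles (which is the case in the
    theorem below). *)
Definition MeijerG_line (m n : nat) (a b : list R) (c : R) (z : R) : C :=
  vline_integral c (fun s =>
    (Cprod (map (fun bj => GammaC (RtoC bj + s)) (firstn m b))
     * Cprod (map (fun ai => GammaC (RtoC 1 - RtoC ai - s)) (firstn n a))
     / (Cprod (map (fun ai => GammaC (RtoC ai + s)) (skipn n a))
        * Cprod (map (fun bj => GammaC (RtoC 1 - RtoC bj - s)) (skipn m b)))
     * cpowR z (- s))%C).

Fixpoint compositions (r m : nat) : list (list nat) :=
  match r with
  | O => if Nat.eqb m 0 then [[]] else []
  | S r' => flat_map (fun a => map (cons a) (compositions r' (m - a)))
                     (seq 0 (S m))
  end.

Definition sumR (l : list R) : R := fold_right Rplus 0 l.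
Definition prodR (l : list R) : R := fold_right Rmult 1 l.

(** Inner factor: for fixed k and j_t,
   sum_{l_1+...+l_{k+1} = j_t} Gamma^{(l_{k+1})}(1)/l_{k+1}!
        * prod_{i=1}^{k-1} (k-i+1)^{-(l_i+1)}     (l_i = nth (i-1) ls). *)
Definition inner_factor (k jt : nat) : R :=
  sumR (map (fun ls =>
    Gamma_deriv (nth k ls O) 1 / INR (fact (nth k ls O))
    * prodR (map (fun i => / (INR (k - i + 1)) ^ (nth (i - 1) ls O + 1))
                 (seq 1 (k - 1))))
    (compositions (S k) jt)).

Definition H (N k j : nat) : R :=
  (-1) ^ (N * k) / INR (fact j) *
  sumR (map (fun n =>
     / (1/2 + INR k) ^ (n - j + 1) *
     sumR (map (fun js => prodR (map (fun t => inner_factor k (nth (t - 1) js O))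
                                     (seq 1 N)))
               (compositions N (N - 1 - n))))
    (seq j (N - j))).

Definition series_term (N : nat) (z : R) (k : nat) : R :=
  Rpower z (- (1/2) - INR k) * sumR (map (fun j => H N k j * (ln z) ^ j) (seq 0 N)).

(* Main.v *)
Require Import Defs.
From Stdlib Require Import Reals List.
From Coquelicot Require Import Coquelicot.
From Stdlib Require Import Factorial Lra Lia Psatz FunctionalExtensionality.
Import ListNotations.
Open Scope R_scope.

(** Since Gamma(1-s) = -s Gamma(-s) and Gamma has no zero in the right
    half-plane, the integrand is -(1/s) Gamma(1/2-s)^N z^(-s).  The line of
    integration is moved to the right, across the simple pole 0 (residue
    -pi^(N/2)) and the poles 1/2, 3/2, ... of order N, up to the lines
    Re s = K+1, where the factor 1/((s-1/2)...(s-K-1/2)) produced by the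
    functional equation makes the integral tend to 0.  The residue at 1/2+k is
    read off a product of expansions in v = 1/2+k-s, using
    Gamma(-k+v) = (-1)^k/v Gamma(1+v) prod_(1<=i<=k) 1/(i-v).

    No decay of Gamma along vertical lines is needed beyond
    |Gamma(s)| <= Gamma(Re s): the rational factors make everything O(1/y^2).
    Cauchy's theorem is obtained by differentiating the truncated integral over
    a vertical segment with respect to its abscissa. *)

(** The integrand of the G-function contains the quotient Gamma(-s)/Gamma(1-s), and cancelling it
    requires Gamma(-s) to be nonzero. A zero at w would propagate to every w+n, whereas Gamma(X+iy)
    X^(-iy) stays close to Gamma(X) > 0 for large X.

    On Re s = K+1 the argument of the Gamma factor left by the functional equation has real part 1/2
    for every K, so one bound serves all these lines, while the distances to the poles multiply to
    at least K!. The integral is O(z^(-K)/K!): convergence of the series and its sum come out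
    together, for every z > 0.

    No Laurent series is used. The principal part is peeled off one power at a time: powers of order
    at least 2 have a primitive and contribute nothing in the limit, the simple pole gives
    arctangents, and what remains is bounded. Finite expansions with real coefficients therefore
    suffice; their products are Cauchy products, which become the sums over compositions in H_kj.
    The factor i = 1 of the product, 1/(1-v), has all its coefficients equal to 1, which reconciles
    it with a product that stops at k-1. *)

(** * Complex moduli, continuity and derivatives of complex-valued functions *)

Lemma norm_Cmod (z : C) : @norm _ C_R_NormedModule z = Cmod z.
Proof.
  symmetry; apply Cmod_norm.
Qed.

Lemma C_eq (z w : C) : fst z = fst w -> snd z = snd w -> z = w.
Proof. destruct z, w; simpl; intros; subst; reflexivity. Qed.

Lemma Cmod_pair (x y : R) : Cmod (x, y) = sqrt (x ^ 2 + y ^ 2).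
Proof. reflexivity. Qed.

Lemma Re_le_Cmod (z : C) : Rabs (fst z) <= Cmod z.
Proof. eapply Rle_trans; [apply Rmax_l | apply Rmax_Cmod]. Qed.

Lemma Im_le_Cmod (z : C) : Rabs (snd z) <= Cmod z.
Proof. eapply Rle_trans; [apply Rmax_r | apply Rmax_Cmod]. Qed.

Lemma Cmod_le_abs (a b : R) : Cmod (a, b) <= Rabs a + Rabs b.
Proof.
  replace ((a, b) : C) with (RtoC a + Ci * RtoC b)%C by (apply C_eq; simpl; ring).
  eapply Rle_trans; [apply Cmod_triangle|].
  rewrite Cmod_mult, Cmod_Ci, !Cmod_R; lra.
Qed.

Lemma Cmod_minus_sym (z w : C) : Cmod (z - w) = Cmod (w - z).
Proof. rewrite <- Cmod_opp; f_equal; ring. Qed.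

Lemma Cmod_triangle' (z w : C) : Cmod z <= Cmod (z - w) + Cmod w.
Proof. replace z with ((z - w) + w)%C at 1 by ring; apply Cmod_triangle. Qed.

Lemma Cmod_minus_le (z w : C) : Cmod (z - w) <= Cmod z + Cmod w.
Proof.
  unfold Cminus; rewrite <- (Cmod_opp w); apply Cmod_triangle.
Qed.

Lemma continuous_pair (U : UniformSpace) (f g : U -> R) (x : U) :
  continuous f x -> continuous g x ->
  continuous (U := C_R_NormedModule) (fun t => (f t, g t)) x.
Proof.
  intros Hf Hg P [e He].
  assert (H1 : locally x (fun t => ball (f x) e (f t))) by (apply Hf; exists e; auto).
  assert (H2 : locally x (fun t => ball (g x) e (g t))) by (apply Hg; exists e; auto).
  change (locally x (fun t => P (f t, g t))).
  generalize (filter_and _ _ H1 H2); apply filter_imp.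
  intros t [H3 H4]; apply He; split; assumption.
Qed.

Lemma continuous_Re (U : UniformSpace) (f : U -> C) (x : U) :
  continuous (U := C_R_NormedModule) f x -> continuous (fun t => fst (f t)) x.
Proof.
  intros H1; apply (continuous_comp f (fst : prod_UniformSpace R_UniformSpace R_UniformSpace -> R) x); auto.
  destruct (f x); apply continuous_fst.
Qed.

Lemma continuous_Im (U : UniformSpace) (f : U -> C) (x : U) :
  continuous (U := C_R_NormedModule) f x -> continuous (fun t => snd (f t)) x.
Proof.
  intros H1; apply (continuous_comp f (snd : prod_UniformSpace R_UniformSpace R_UniformSpace -> R) x); auto.
  destruct (f x); apply continuous_snd.
Qed.

Lemma continuous_Cmult (U : UniformSpace) (f g : U -> C) (x : U) :
  continuous (U := C_R_NormedModule) f x -> continuous (U := C_R_NormedModule) g x ->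
  continuous (U := C_R_NormedModule) (fun t => (f t * g t)%C) x.
Proof.
  intros Hf Hg.
  pose proof (continuous_Re _ _ _ Hf). pose proof (continuous_Im _ _ _ Hf).
  pose proof (continuous_Re _ _ _ Hg). pose proof (continuous_Im _ _ _ Hg).
  apply continuous_pair.
  - apply (continuous_minus (V := R_NormedModule)); apply (continuous_mult (K := R_AbsRing)); assumption.
  - apply (continuous_plus (V := R_NormedModule)); apply (continuous_mult (K := R_AbsRing)); assumption.
Qed.

Lemma continuous_RtoC (U : UniformSpace) (f : U -> R) (x : U) :
  continuous f x -> continuous (U := C_R_NormedModule) (fun t => RtoC (f t)) x.
Proof. intros Hf; apply continuous_pair; [exact Hf | apply continuous_const]. Qed.

(** Derivatives under an integral sign are obtained in this form: a Taylor remainder of order 2 is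
    integrated, and the quadratic error that results is turned into differentiability. *)
Lemma is_derive_quad (V : NormedModule R_AbsRing) (f : R -> V) (x : R) (l : V) (M r : R) :
  0 < r ->
  (forall h, Rabs h <= r -> norm (minus (minus (f (x + h)) (f x)) (scal h l)) <= M * h ^ 2) ->
  is_derive f x l.
Proof.
  intros Hr Hq; split; [apply is_linear_scal_l|].
  intros x' Hx'; apply (is_filter_lim_locally_unique x x') in Hx'; subst x'.
  intros eps.
  set (K := Rabs M + 1).
  assert (HK : 0 < K) by (unfold K; pose proof (Rabs_pos M); lra).
  assert (Hd : 0 < Rmin r (eps / K)).
  { apply Rmin_pos; auto; apply Rdiv_lt_0_compat; auto; apply cond_pos. }
  exists (mkposreal _ Hd); intros y Hy.
  change (Rabs (y - x) < Rmin r (eps / K)) in Hy.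
  specialize (Hq (y - x)).
  assert (E : forall u v : R, u + (v - u) = v) by (intros; ring); rewrite E in Hq.
  change (norm (minus y x)) with (Rabs (y - x)).
  change (minus y x) with (y - x).
  eapply Rle_trans; [apply Hq|].
  - apply Rlt_le, Rlt_le_trans with (1 := Hy), Rmin_l.
  - assert (Hy2 : Rabs (y - x) < eps / K) by (apply Rlt_le_trans with (1 := Hy), Rmin_r).
    rewrite <- (pow2_abs (y - x)).
    pose proof (Rabs_pos (y - x)).
    apply Rle_trans with (K * Rabs (y - x) ^ 2).
    + apply Rmult_le_compat_r; [nra|]. unfold K; pose proof (Rle_abs M); lra.
    + assert (K * Rabs (y - x) <= eps).
      { apply Rle_trans with (K * (eps / K)); [apply Rmult_le_compat_l; lra|].
        right; field; lra. }
      nra.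
Qed.

Lemma is_derive_pair (f g : R -> R) (x lf lg : R) :
  is_derive f x lf -> is_derive g x lg ->
  is_derive (V := C_R_NormedModule) (fun t => (f t, g t)) x (lf, lg).
Proof.
  intros Hf Hg.
  split.
  - apply (is_linear_scal_l (K := R_AbsRing) (V := C_R_NormedModule) (lf, lg)).
  - intros x' Hx'. destruct Hf as [_ Hf], Hg as [_ Hg].
    specialize (Hf x' Hx'). specialize (Hg x' Hx').
    intros eps.
    assert (He : 0 < eps / 2) by (pose proof (cond_pos eps); lra).
    generalize (filter_and _ _ (Hf (mkposreal _ He)) (Hg (mkposreal _ He))).
    apply filter_imp; intros y [H1 H2]; simpl in H1, H2.
    rewrite norm_Cmod.
    set (a := minus (minus (f y) (f x')) (scal (minus y x') lf)) in *.
    set (b := minus (minus (g y) (g x')) (scal (minus y x') lg)) in *.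
    match goal with |- Cmod ?z <= _ => change z with ((a, b) : C) end.
    eapply Rle_trans; [apply Cmod_le_abs|].
    pose (m := Rabs (y - x')).
    change (Rabs a <= eps / 2 * m) in H1. change (Rabs b <= eps / 2 * m) in H2.
    change (Rabs a + Rabs b <= eps * m); lra.
Qed.

Lemma is_derive_C (f : R -> C) (x : R) (l : C) :
  is_derive (fun t => fst (f t)) x (fst l) -> is_derive (fun t => snd (f t)) x (snd l) ->
  is_derive (V := C_R_NormedModule) f x l.
Proof.
  intros H1 H2.
  apply (is_derive_ext (V := C_R_NormedModule) (fun t => (fst (f t), snd (f t)))).
  - intros t; destruct (f t); reflexivity.
  - destruct l; apply is_derive_pair; assumption.
Qed.

Lemma is_derive_Re (f : R -> C) (x : R) (l : C) :
  is_derive (V := C_R_NormedModule) f x l -> is_derive (fun t => fst (f t)) x (fst l).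
Proof.
  intros Hf; unfold is_derive.
  apply (filterdiff_ext_lin _ (fun y : R => fst (scal y l : C))); [|intros; reflexivity].
  apply (filterdiff_comp f (fst : C_R_NormedModule -> R_NormedModule) (fun y => scal y l) fst); auto.
  apply filterdiff_linear. apply (is_linear_fst (K := R_AbsRing) (U := R_NormedModule) (V := R_NormedModule)).
Qed.

Lemma is_derive_Im (f : R -> C) (x : R) (l : C) :
  is_derive (V := C_R_NormedModule) f x l -> is_derive (fun t => snd (f t)) x (snd l).
Proof.
  intros Hf; unfold is_derive.
  apply (filterdiff_ext_lin _ (fun y : R => snd (scal y l : C))); [|intros; reflexivity].
  apply (filterdiff_comp f (snd : C_R_NormedModule -> R_NormedModule) (fun y => scal y l) snd); auto.
  apply filterdiff_linear. apply (is_linear_snd (K := R_AbsRing) (U := R_NormedModule) (V := R_NormedModule)).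
Qed.

Lemma is_derive_Cmult (f g : R -> C) (x : R) (lf lg : C) :
  is_derive (V := C_R_NormedModule) f x lf -> is_derive (V := C_R_NormedModule) g x lg ->
  is_derive (V := C_R_NormedModule) (fun t => (f t * g t)%C) x (lf * g x + f x * lg)%C.
Proof.
  intros Hf Hg.
  pose proof (is_derive_Re _ _ _ Hf). pose proof (is_derive_Im _ _ _ Hf).
  pose proof (is_derive_Re _ _ _ Hg). pose proof (is_derive_Im _ _ _ Hg).
  pose proof (fun a b la lb (Ha : is_derive a x la) (Hb : is_derive b x lb) =>
    is_derive_mult a b x la lb Ha Hb Rmult_comm) as M.
  apply is_derive_C; simpl.
  - evar_last.
    { apply (is_derive_minus (V := R_NormedModule)
        (fun t => fst (f t) * fst (g t)) (fun t => snd (f t) * snd (g t)));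
      apply M; eassumption. }
    unfold minus, plus, opp, mult; simpl; unfold plus, mult; simpl; ring.
  - evar_last.
    { apply (is_derive_plus (V := R_NormedModule)
        (fun t => fst (f t) * snd (g t)) (fun t => snd (f t) * fst (g t)));
      apply M; eassumption. }
    unfold minus, plus, opp, mult; simpl; unfold plus, mult; simpl; ring.
Qed.

(** * Improper integrals: fundamental theorem and domination *)

(** [D] is the interval on which the primitive is regular: t > 0 for Euler integrals, the whole line
    for vertical integrals. Its convexity keeps the segment between two endpoints inside, in
    whichever order they come. *)
Lemma is_RInt_gen_FTC (V : CompleteNormedModule R_AbsRing) (Fa Fb : (R -> Prop) -> Prop)
  {FFa : Filter Fa} {FFb : Filter Fb} (D : R -> Prop) (f df : R -> V) (la lb : V) :
  (forall x y t, D x -> D y -> x <= t <= y -> D t) -> Fa D -> Fb D ->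
  (forall t, D t -> is_derive f t (df t)) -> (forall t, D t -> continuous df t) ->
  filterlim f Fa (locally la) -> filterlim f Fb (locally lb) ->
  is_RInt_gen df Fa Fb (minus lb la).
Proof.
  intros HD Ha Hb Hd Hc Hla Hlb P HP.
  assert (Hl : filterlim (fun ab : R * R => minus (f (snd ab)) (f (fst ab))) (filter_prod Fa Fb)
     (locally (minus lb la))).
  { unfold minus.
    apply (filterlim_comp_2 (F := filter_prod Fa Fb) (G := locally lb) (H := locally (opp la))
       (fun ab : R * R => f (snd ab)) (fun ab : R * R => opp (f (fst ab))) plus).
    - apply (filterlim_comp _ _ _ snd f _ Fb); auto; apply filterlim_snd.
    - apply (filterlim_comp _ _ _ (fun ab : R * R => f (fst ab)) opp _ (locally la)).
      + apply (filterlim_comp _ _ _ fst f _ Fa); auto; apply filterlim_fst.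
      + apply (filterlim_opp (V := V)).
    - apply (filterlim_plus (V := V)). }
  specialize (Hl P HP).
  change (filter_prod Fa Fb (fun ab : R * R => P (minus (f (snd ab)) (f (fst ab))))) in Hl.
  assert (HDD : filter_prod Fa Fb (fun ab => D (fst ab) /\ D (snd ab))).
  { exact (Filter_prod _ _ _ D D Ha Hb (fun x y Hx Hy => conj Hx Hy)). }
  unfold filtermapi; generalize (filter_and _ _ Hl HDD); apply filter_imp.
  intros [a b] [H1 [H2 H3]]; simpl in *.
  exists (minus (f b) (f a)); split; [|exact H1].
  apply is_RInt_derive; intros t Ht; [apply Hd | apply Hc];
    destruct (Rle_dec a b) as [Hab|Hab].
  all: first [rewrite Rmin_left, Rmax_right in Ht by lra | rewrite Rmin_right, Rmax_left in Ht by lra]; eauto.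
Qed.

Lemma RInt_abs_le (V : CompleteNormedModule R_AbsRing) (D : R -> Prop) (f : R -> V) (g : R -> R) (a b : R) :
  (forall x y t, D x -> D y -> x <= t <= y -> D t) -> D a -> D b ->
  (forall t, D t -> continuous f t) -> (forall t, D t -> continuous g t) ->
  (forall t, D t -> norm (f t) <= g t) ->
  ex_RInt f a b /\ ex_RInt g a b /\ norm (RInt f a b) <= Rabs (RInt g a b).
Proof.
  intros HD Ha Hb Hf Hg Hfg.
  assert (Hin : forall t, Rmin a b <= t <= Rmax a b -> D t).
  { intros t Ht; destruct (Rle_dec a b) as [Hab|Hab];
    first [rewrite Rmin_left, Rmax_right in Ht by lra | rewrite Rmin_right, Rmax_left in Ht by lra]; eauto. }
  assert (If : ex_RInt f a b) by (apply (ex_RInt_continuous (V := V)); auto).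
  assert (Ig : ex_RInt g a b) by (apply (ex_RInt_continuous (V := R_CompleteNormedModule)); auto).
  split; [exact If | split; [exact Ig|]].
  destruct (Rle_dec a b) as [Hab|Hab].
  - eapply Rle_trans; [|apply Rle_abs].
    apply (norm_RInt_le (V := V) f g a b); auto; try apply (RInt_correct (V := V)); try apply (RInt_correct (V := R_CompleteNormedModule)); auto.
    intros x Hx; apply Hfg, Hin; rewrite Rmin_left, Rmax_right; lra.
  - assert (E1 : norm (RInt f a b) = norm (RInt f b a)).
    { rewrite <- (norm_opp (RInt f b a)); f_equal; symmetry; apply opp_RInt_swap, ex_RInt_swap, If. }
    assert (E2 : Rabs (RInt g a b) = Rabs (RInt g b a)).
    { rewrite <- (Rabs_Ropp (RInt g b a)); f_equal; symmetry.
      apply (opp_RInt_swap (V := R_CompleteNormedModule)), ex_RInt_swap, Ig. }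
    rewrite E1, E2.
    eapply Rle_trans; [|apply Rle_abs].
    apply (norm_RInt_le (V := V) f g b a); try apply (RInt_correct (V := V)); try apply (RInt_correct (V := R_CompleteNormedModule)); try apply ex_RInt_swap; auto; try lra.
    intros x Hx; apply Hfg, Hin; rewrite Rmin_right, Rmax_left; lra.
Qed.

Lemma minus_plus_cancel (G : AbelianGroup) (x y z : G) :
  minus (plus x y) (plus z x) = minus y z.
Proof.
  unfold minus; rewrite (plus_comm x y), opp_plus, <- plus_assoc; f_equal.
  rewrite (plus_comm (opp z) (opp x)), plus_assoc.
  eapply eq_trans; [apply (f_equal (fun u => plus u (opp z))), plus_opp_r | apply plus_zero_l].
Qed.

(** Cauchy's criterion: the integrals of [f] over [a,b] and [a',b'] differ by its integrals over
    [a,a'] and [b,b'], which are dominated by those of [g]. *)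
Lemma ex_RInt_gen_dominated (V : CompleteNormedModule R_AbsRing) (Fa Fb : (R -> Prop) -> Prop)
  {FFa : ProperFilter Fa} {FFb : ProperFilter Fb} (D : R -> Prop) (f : R -> V) (g : R -> R) :
  (forall x y t, D x -> D y -> x <= t <= y -> D t) -> Fa D -> Fb D ->
  (forall t, D t -> continuous f t) -> (forall t, D t -> continuous g t) ->
  (forall t, D t -> norm (f t) <= g t) ->
  ex_RInt_gen g Fa Fb -> ex_RInt_gen f Fa Fb.
Proof.
  intros HD Ha Hb Hf Hg Hfg [lg Hlg].
  assert (HDD : filter_prod Fa Fb (fun ab => D (fst ab) /\ D (snd ab))).
  { exact (Filter_prod _ _ _ D D Ha Hb (fun x y Hx Hy => conj Hx Hy)). }
  assert (Hfl : exists l, filterlim (fun ab : R * R => RInt f (fst ab) (snd ab)) (filter_prod Fa Fb) (locally l)).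
  { apply (filterlim_locally_cauchy (U := V)).
    intros eps.
    assert (He : 0 < eps / 4) by (pose proof (cond_pos eps); lra).
    specialize (Hlg (ball lg (mkposreal _ He)) (locally_ball _ _)).
    unfold filtermapi in Hlg; destruct (filter_and _ _ Hlg HDD) as [Qa Qb HQa HQb HQ]; simpl in HQ.
    exists (fun ab => Qa (fst ab) /\ Qb (snd ab)); split.
    { exact (Filter_prod _ _ _ Qa Qb HQa HQb (fun x y Hx Hy => conj Hx Hy)). }
    assert (HG : forall a b, Qa a -> Qb b -> D a /\ D b /\ Rabs (RInt g a b - lg) < eps / 4).
    { intros a b Qaa Qbb; destruct (HQ a b Qaa Qbb) as [[y [Hy1 Hy2]] [H1 H2]].
      rewrite (is_RInt_unique _ _ _ _ Hy1); repeat split; auto. }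
    intros [a b] [a' b'] [H1 H2] [H3 H4]; simpl in *.
    destruct (HG a b H1 H2) as [Da [Db G1]].
    destruct (HG a' b' H3 H4) as [Da' [Db' G2]].
    (* The mixed pair (a',b) isolates each end piece of [g] as a difference of two integrals, both
       within eps/4 of [lg]; each piece is then below eps/2. *)
    destruct (HG a' b H3 H2) as [_ [_ G3]].
    apply (norm_compat1 (V := V)).
    destruct (RInt_abs_le V D f g a a') as [F1 [K1 N1]]; auto.
    destruct (RInt_abs_le V D f g b b') as [F2 [K2 N2]]; auto.
    destruct (RInt_abs_le V D f g a' b) as [F3 [K3 N3]]; auto.
    rewrite <- (RInt_Chasles (V := V) f a' b b'); auto.
    rewrite <- (RInt_Chasles (V := V) f a a' b); auto.
    assert (E1 : RInt g a b = RInt g a a' + RInt g a' b) by (symmetry; apply (RInt_Chasles (V := R_CompleteNormedModule) g); auto).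
    assert (E2 : RInt g a' b' = RInt g a' b + RInt g b b') by (symmetry; apply (RInt_Chasles (V := R_CompleteNormedModule) g); auto).
    apply Rle_lt_trans with (norm (minus (RInt f b b') (RInt f a a'))).
    { apply Req_le, (f_equal norm), minus_plus_cancel. }
    apply Rle_lt_trans with (norm (RInt f b b') + norm (RInt f a a')).
    { eapply Rle_trans; [apply (norm_triangle (RInt f b b') (opp (RInt f a a')))|].
      apply Rplus_le_compat_l, Req_le, (norm_opp (V := V)). }
    apply Rabs_def2 in G1; apply Rabs_def2 in G2; apply Rabs_def2 in G3.
    assert (Rabs (RInt g a a') < eps / 2) by (apply Rabs_def1; lra).
    assert (Rabs (RInt g b b') < eps / 2) by (apply Rabs_def1; lra).
    lra. }
  destruct Hfl as [l Hl]; exists l.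
  intros P HP; specialize (Hl P HP).
  change (filter_prod Fa Fb (fun ab : R * R => P (RInt f (fst ab) (snd ab)))) in Hl.
  unfold filtermapi; generalize (filter_and _ _ Hl HDD); apply filter_imp.
  intros [a b] [H1 [H2 H3]]; simpl in *.
  exists (RInt f a b); split; [|exact H1].
  apply (RInt_correct (V := V)).
  apply (RInt_abs_le V D f g a b); auto.
Qed.

(** * Remainders of the complex exponential *)

Lemma Cmod_cexp (w : C) : Cmod (cexp w) = exp (fst w).
Proof.
  unfold cexp; rewrite Cmod_pair.
  replace ((exp (Re w) * cos (Im w)) ^ 2 + (exp (Re w) * sin (Im w)) ^ 2)
    with (exp (fst w) ^ 2).
  - apply sqrt_pow2, Rlt_le, exp_pos.
  - pose proof (sin2_cos2 (Im w)) as E; unfold Rsqr in E; unfold Re; nra.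
Qed.

Lemma cexp_plus (z w : C) : cexp (z + w) = (cexp z * cexp w)%C.
Proof.
  unfold cexp, Re, Im; apply C_eq; simpl; rewrite exp_plus, ?cos_plus, ?sin_plus; ring.
Qed.

Lemma cexp_RtoC (x : R) : cexp (RtoC x) = RtoC (exp x).
Proof. unfold cexp; simpl; rewrite cos_0, sin_0; apply C_eq; simpl; ring. Qed.

Lemma Cmod_cpowR (t : R) (w : C) : Cmod (cpowR t w) = Rpower t (fst w).
Proof.
  unfold cpowR; rewrite Cmod_cexp; unfold Rpower; f_equal; simpl; ring.
Qed.

Lemma cpowR_plus (t : R) (z w : C) : cpowR t (z + w) = (cpowR t z * cpowR t w)%C.
Proof. unfold cpowR; rewrite <- cexp_plus; f_equal; ring. Qed.

Lemma cpowR_RtoC (t x : R) : cpowR t (RtoC x) = RtoC (Rpower t x).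
Proof. unfold cpowR; rewrite <- RtoC_mult, cexp_RtoC; reflexivity. Qed.

Lemma cpowR_minus_1 (t : R) (w : C) : 0 < t -> cpowR t (w - 1) = (cpowR t w * RtoC (/ t))%C.
Proof.
  intros Ht; unfold Cminus; rewrite cpowR_plus; f_equal.
  rewrite <- RtoC_opp, cpowR_RtoC, Rpower_Ropp, Rpower_1; auto.
Qed.

Lemma exp_le (x y : R) : x <= y -> exp x <= exp y.
Proof. intros [Hlt|<-]; [left; apply exp_increasing, Hlt | right; reflexivity]. Qed.

Lemma cexp_scal (u a b : R) :
  cexp (RtoC u * (a, b)) = (exp (u * a) * cos (u * b), exp (u * a) * sin (u * b)).
Proof.
  unfold cexp, Re, Im; simpl.
  replace (u * a - 0 * b) with (u * a) by ring.
  replace (u * b + 0 * a) with (u * b) by ring.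
  reflexivity.
Qed.

Lemma cpowR_pair (t a b : R) :
  cpowR t (a, b) = (exp (ln t * a) * cos (ln t * b), exp (ln t * a) * sin (ln t * b)).
Proof. unfold cpowR; rewrite Cmult_comm; apply cexp_scal. Qed.

Lemma is_derive_cexp (v : C) (x : R) :
  is_derive (V := C_R_NormedModule) (fun u : R => cexp (RtoC u * v)) x (v * cexp (RtoC x * v))%C.
Proof.
  destruct v as [a b].
  apply (is_derive_ext (V := C_R_NormedModule)
    (fun u => (exp (u * a) * cos (u * b), exp (u * a) * sin (u * b)))).
  - intros u; symmetry; apply cexp_scal.
  - rewrite cexp_scal; apply is_derive_C; simpl; auto_derive; trivial; ring.
Qed.

Lemma is_derive_cpowR (w : C) (t : R) : 0 < t ->
  is_derive (V := C_R_NormedModule) (fun t => cpowR t w) t (w * cpowR t (w - 1))%C.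
Proof.
  intros Ht; rewrite cpowR_minus_1; auto.
  destruct w as [a b].
  apply (is_derive_ext (V := C_R_NormedModule)
    (fun u => (exp (ln u * a) * cos (ln u * b), exp (ln u * a) * sin (ln u * b)))).
  - intros u; symmetry; apply cpowR_pair.
  - rewrite cpowR_pair; apply is_derive_C; simpl; auto_derive; auto; field; lra.
Qed.

Lemma is_derive_Cpow (v : C) (n : nat) (x : R) :
  is_derive (V := C_R_NormedModule) (fun u : R => ((RtoC u * v) ^ S n)%C) x
    (RtoC (INR (S n)) * v * (RtoC x * v) ^ n)%C.
Proof.
  assert (H1 : is_derive (V := C_R_NormedModule) (fun u : R => (RtoC u * v)%C) x v).
  { apply is_derive_C; simpl; auto_derive; trivial; ring. }
  induction n as [|n IH].
  - apply (is_derive_ext (V := C_R_NormedModule) (fun u : R => (RtoC u * v)%C)).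
    + intros u; simpl; ring.
    + evar_last; [exact H1|]. simpl; ring.
  - evar_last; [exact (is_derive_Cmult _ _ _ _ _ H1 IH)|].
    rewrite (S_INR (S n)), RtoC_plus, (Cpow_S _ n); ring.
Qed.

(** Taylor remainders, here and in [rgam] below, are defined by recursion on
    the order, which avoids finite sums of complex numbers. *)
Fixpoint rexp (n : nat) (v : C) : C :=
  match n with
  | O => cexp v
  | S m => (rexp m v - v ^ m * RtoC (/ INR (fact m)))%C
  end.

Lemma is_derive_rexp (n : nat) (v : C) (x : R) :
  is_derive (V := C_R_NormedModule) (fun u : R => rexp (S n) (RtoC u * v)) x
    (v * rexp n (RtoC x * v))%C.
Proof.
  induction n as [|n IH].
  - apply (is_derive_ext (V := C_R_NormedModule) (fun u : R => plus (cexp (RtoC u * v)) (RtoC (-1)))).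
    + intros u. apply C_eq; simpl; unfold plus; simpl; field.
    + evar_last; [apply (is_derive_plus (V := C_R_NormedModule)); [apply is_derive_cexp | apply is_derive_const]|].
      apply (plus_zero_r (G := C_R_NormedModule)).
  - apply (is_derive_ext (V := C_R_NormedModule)
      (fun u : R => minus (rexp (S n) (RtoC u * v)) (RtoC (/ INR (fact (S n))) * (RtoC u * v) ^ S n)%C)).
    + intros u. change (rexp (S (S n)) (RtoC u * v)) with
        (rexp (S n) (RtoC u * v) - (RtoC u * v) ^ S n * RtoC (/ INR (fact (S n))))%C.
      apply C_eq; unfold minus, plus, opp, scal; simpl; unfold plus, opp, scal, mult; simpl; unfold mult; simpl; ring.
    + evar_last.
      { apply (is_derive_minus (V := C_R_NormedModule)); [exact IH|].
        apply (is_derive_Cmult (fun _ => RtoC (/ INR (fact (S n))))); [|exact (is_derive_Cpow v n x)].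
        apply (is_derive_const (K := R_AbsRing) (V := C_R_NormedModule)). }
      transitivity (v * rexp n (RtoC x * v) - RtoC (/ INR (fact (S n))) * (RtoC (INR (S n)) * v * (RtoC x * v) ^ n))%C.
      { transitivity (v * rexp n (RtoC x * v) - (RtoC 0 * (RtoC x * v) ^ S n +
          RtoC (/ INR (fact (S n))) * (RtoC (INR (S n)) * v * (RtoC x * v) ^ n)))%C; [reflexivity | ring]. }
      replace (RtoC (/ INR (fact (S n)))) with (RtoC (/ INR (fact n)) * RtoC (/ INR (S n)))%C.
      2: { rewrite <- RtoC_mult; f_equal. rewrite fact_simpl, mult_INR; field; split;
           [apply not_0_INR, fact_neq_0 | apply not_0_INR; lia]. }
      change (rexp (S n) (RtoC x * v)) with (rexp n (RtoC x * v) - (RtoC x * v) ^ n * RtoC (/ INR (fact n)))%C.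
      assert (E : (RtoC (/ INR (S n)) * RtoC (INR (S n)) = 1)%C).
      { rewrite <- RtoC_mult; f_equal; apply Rinv_l, not_0_INR; lia. }
      transitivity (v * rexp n (RtoC x * v) - RtoC (/ INR (fact n)) * (RtoC (/ INR (S n)) * RtoC (INR (S n))) * (v * (RtoC x * v) ^ n))%C; [ring|].
      rewrite E; ring.
Qed.

Lemma rexp_0 (n : nat) : rexp (S n) 0 = 0%C.
Proof.
  induction n as [|n IH].
  - simpl. rewrite cexp_RtoC, exp_0, Rinv_1; ring.
  - change (rexp (S (S n)) 0) with (rexp (S n) 0 - 0 ^ S n * RtoC (/ INR (fact (S n))))%C.
    rewrite IH, Cpow_S; ring.
Qed.

Lemma continuous_rexp (n : nat) (v : C) (x : R) :
  continuous (U := C_R_NormedModule) (fun u : R => rexp n (RtoC u * v)) x.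
Proof.
  apply (ex_derive_continuous (V := C_R_NormedModule)).
  destruct n; eexists; [apply is_derive_cexp | apply is_derive_rexp].
Qed.

(** The remainder of order n+1 vanishes at 0, so it is the integral over [0,1] of its derivative v
    [rexp n] (u v) along the ray. Bounding u by 1 loses the factorial but keeps the power of |v|,
    the only part that matters. *)
Lemma Cmod_rexp_le (n : nat) (v : C) : Cmod (rexp n v) <= Cmod v ^ n * exp (Cmod v).
Proof.
  revert v; induction n as [|n IH]; intros v.
  - simpl; rewrite Cmod_cexp, Rmult_1_l.
    apply exp_le. eapply Rle_trans; [apply Rle_abs | apply Re_le_Cmod].
  - assert (I : is_RInt (V := C_R_CompleteNormedModule) (fun u : R => v * rexp n (RtoC u * v))%C 0 1
       (minus (rexp (S n) (RtoC 1 * v)) (rexp (S n) (RtoC 0 * v)))).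
    { apply (is_RInt_derive (V := C_R_CompleteNormedModule) (fun u => rexp (S n) (RtoC u * v)) (fun u => v * rexp n (RtoC u * v))%C);
        intros x _; [exact (is_derive_rexp n v x)|].
      apply continuous_Cmult; [apply (continuous_const (U := R_UniformSpace) (V := C_R_NormedModule)) | apply continuous_rexp]. }
    replace (rexp (S n) v) with (minus (rexp (S n) (RtoC 1 * v)) (rexp (S n) (RtoC 0 * v)) : C).
    2: { rewrite Cmult_0_l, Cmult_1_l, rexp_0. apply (minus_zero_r (G := C_R_NormedModule)). }
    rewrite <- norm_Cmod.
    eapply Rle_trans; [apply (norm_RInt_le_const (V := C_R_NormedModule) (fun u : R => (v * rexp n (RtoC u * v))%C) 0 1 _ (Cmod v ^ S n * exp (Cmod v)))|].
    3: exact I.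
    lra.
    2: lra.
    intros x Hx; rewrite norm_Cmod, Cmod_mult.
    simpl; rewrite Rmult_assoc; apply Rmult_le_compat_l; [apply Cmod_ge_0|].
    eapply Rle_trans; [apply IH|].
    rewrite Cmod_mult, Cmod_R, Rabs_pos_eq by lra.
    pose proof (Cmod_ge_0 v).
    apply Rmult_le_compat.
    + apply pow_le; nra.
    + apply Rlt_le, exp_pos.
    + apply pow_incr; nra.
    + apply exp_le; nra.
Qed.

(** * Gamma integrals and their derivatives *)

Lemma Rpower_pos (x y : R) : 0 < Rpower x y.
Proof. apply exp_pos. Qed.

Lemma Rpower_lim_0 (a : R) : 0 < a -> filterlim (fun t => Rpower t a) (at_right 0) (locally 0).
Proof.
  intros Ha P [e He].
  exists (mkposreal (Rpower e (/ a)) (Rpower_pos _ _)); intros y Hy Hy0.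
  change (Rabs (y - 0) < Rpower e (/ a)) in Hy; rewrite Rminus_0_r, Rabs_pos_eq in Hy by lra.
  apply He; change (Rabs (Rpower y a - 0) < e).
  rewrite Rminus_0_r, Rabs_pos_eq by (apply Rlt_le, Rpower_pos).
  replace (pos e) with (Rpower (Rpower e (/ a)) a).
  - apply Rlt_Rpower_l; auto.
  - rewrite Rpower_mult, Rinv_l, Rpower_1; auto; [apply cond_pos | lra].
Qed.

Lemma Rpower_lim_oo (a : R) : 0 < a -> filterlim (fun t => Rpower t (- a)) (Rbar_locally p_infty) (locally 0).
Proof.
  intros Ha P [e He].
  exists (Rpower (/ e) (/ a)); intros y Hy.
  assert (Hy0 : 0 < y) by (eapply Rlt_trans; [apply Rpower_pos | exact Hy]).
  apply He; change (Rabs (Rpower y (- a) - 0) < e).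
  rewrite Rminus_0_r, Rabs_pos_eq by (apply Rlt_le, Rpower_pos).
  pose proof (cond_pos e) as Pe.
  rewrite Rpower_Ropp, <- (Rinv_inv e).
  apply Rinv_lt_contravar.
  - apply Rmult_lt_0_compat; [apply Rinv_0_lt_compat; auto | apply Rpower_pos].
  - replace (/ e) with (Rpower (Rpower (/ e) (/ a)) a).
    + apply Rlt_Rpower_l; auto; split; auto; apply Rpower_pos.
    + rewrite Rpower_mult, Rinv_l, Rpower_1; auto; [apply Rinv_0_lt_compat; auto | lra].
Qed.

Lemma at_0_pos : at_right 0 (fun t => 0 < t).
Proof. exists (mkposreal 1 Rlt_0_1); auto. Qed.

Lemma at_oo_pos : Rbar_locally p_infty (fun t => 0 < t).
Proof. exists 0; auto. Qed.

Lemma pos_convex (x y t : R) : 0 < x -> 0 < y -> x <= t <= y -> 0 < t.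
Proof. lra. Qed.

Lemma at_0_oo_le : filter_prod (at_right 0) (Rbar_locally p_infty)
  (fun ab : R * R => 0 < fst ab /\ fst ab <= snd ab).
Proof.
  apply (Filter_prod _ _ _ (fun t => 0 < t < 1) (fun t => 1 < t)).
  - exists (mkposreal 1 Rlt_0_1); intros y Hy H0.
    change (Rabs (y - 0) < 1) in Hy; rewrite Rminus_0_r in Hy.
    apply Rabs_def2 in Hy; lra.
  - exists 1; auto.
  - simpl; intros; lra.
Qed.

(** A dominating function with the explicit primitive -1/(a (1+t^a)): it behaves like t^(a-1) at 0
    and like t^(-a-1) at infinity, so both ends are treated at once. *)
Lemma ex_RInt_gen_base (a : R) : 0 < a ->
  ex_RInt_gen (fun t => Rpower t (a - 1) / (1 + Rpower t a) ^ 2) (at_right 0) (Rbar_locally p_infty).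
Proof.
  intros Ha.
  exists (minus (0:R) (- (/ a))).
  assert (Hpos : forall t, 0 < 1 + Rpower t a) by (intros t; pose proof (Rpower_pos t a); lra).
  apply (is_RInt_gen_FTC R_CompleteNormedModule (at_right 0) (Rbar_locally p_infty)
    (fun t => 0 < t) (fun t => - / a * / (1 + Rpower t a))).
  - apply pos_convex.
  - apply at_0_pos.
  - apply at_oo_pos.
  - intros t Ht; unfold Rpower; pose proof (Hpos t) as Hp; unfold Rpower in Hp.
    auto_derive; [repeat split; auto; lra |].
    assert (E : exp ((a - 1) * ln t) = exp (a * ln t) / t).
    { replace ((a - 1) * ln t) with (a * ln t + - ln t) by ring.
      rewrite exp_plus, exp_Ropp, exp_ln by auto; reflexivity. }
    rewrite E; field; repeat split; lra.
  - intros t Ht; apply (ex_derive_continuous (V := R_NormedModule)).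
    unfold Rpower; pose proof (Hpos t) as Hp; unfold Rpower in Hp.
    auto_derive; repeat split; auto; nra.
  - apply (filterlim_comp _ _ _ (fun t => Rpower t a) (fun u => - / a * / (1 + u)) _ (locally 0)).
    + apply Rpower_lim_0; auto.
    + assert (Hc : continuous (fun u => - / a * / (1 + u)) 0).
      { apply (ex_derive_continuous (V := R_NormedModule)); auto_derive; lra. }
      unfold continuous in Hc; replace (- / a * / (1 + 0)) with (- / a) in Hc by (field; lra); exact Hc.
  (* Written in t^(-a), which tends to 0, the limit at infinity becomes continuity at 0. *)
  - apply (filterlim_ext_loc (fun t => - / a * (Rpower t (- a) / (1 + Rpower t (- a))))).
    + exists 0; intros t Ht; rewrite Rpower_Ropp.
      pose proof (Rpower_pos t a); field; repeat split; lra.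
    + apply (filterlim_comp _ _ _ (fun t => Rpower t (- a)) (fun u => - / a * (u / (1 + u))) _ (locally 0)).
      * apply Rpower_lim_oo; auto.
      * assert (Hc : continuous (fun u => - / a * (u / (1 + u))) 0).
        { apply (ex_derive_continuous (V := R_NormedModule)); auto_derive; lra. }
        unfold continuous in Hc; replace (- / a * (0 / (1 + 0))) with 0 in Hc by (field; lra); exact Hc.
Qed.

Lemma pow_le_fact_exp (n : nat) (t : R) : 0 <= t -> t ^ n <= INR (fact n) * exp t.
Proof.
  intros Ht.
  assert (Hf : 0 < INR (fact n)) by (apply lt_0_INR, lt_O_fact).
  assert (t ^ n / INR (fact n) <= exp t).
  { eapply Rle_trans; [|apply (exp_ge_taylor t n Ht)].
    destruct n as [|n]; [simpl; lra|].
    rewrite tech5.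
    assert (0 <= sum_f_R0 (fun k => t ^ k / INR (fact k)) n); [|lra].
    apply cond_pos_sum; intros k; apply Rmult_le_pos; [apply pow_le; auto|].
    apply Rlt_le, Rinv_0_lt_compat, lt_0_INR, lt_O_fact. }
  apply Rmult_le_reg_l with (/ INR (fact n)); [apply Rinv_0_lt_compat; auto|].
  rewrite <- Rmult_assoc, Rinv_l, Rmult_1_l by lra. lra.
Qed.

Lemma Rpower_exp_bound (b : R) : 0 <= b ->
  exists K, forall t, 0 < t -> Rpower t b * exp (- t) <= K.
Proof.
  intros Hb.
  destruct (nfloor_ex b Hb) as [m [_ Hm]].
  exists (1 + INR (fact (S m))); intros t Ht.
  assert (He : exp (- t) <= 1) by (rewrite <- exp_0; apply exp_le; lra).
  pose proof (exp_pos (- t)) as Hp.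
  assert (H1 : Rpower t b <= 1 + t ^ S m).
  { pose proof (pow_lt t (S m) Ht).
    destruct (Rle_dec t 1) as [H1|H1].
    - assert (Rpower t b <= Rpower 1 b) by (apply Rle_Rpower_l; lra).
      unfold Rpower in *; rewrite ln_1, Rmult_0_r, exp_0 in H0; lra.
    - rewrite <- (Rpower_pow (S m) t Ht).
      assert (Rpower t b <= Rpower t (INR (S m))) by (apply Rle_Rpower; [lra | rewrite S_INR; lra]).
      lra. }
  pose proof (pow_le_fact_exp (S m) t (Rlt_le _ _ Ht)) as H2.
  assert (H3 : exp t * exp (- t) = 1) by (rewrite <- exp_plus, Rplus_opp_r; apply exp_0).
  assert (H4 : t ^ S m * exp (- t) <= INR (fact (S m))).
  { replace (INR (fact (S m))) with (INR (fact (S m)) * exp t * exp (- t)) by (rewrite Rmult_assoc, H3; ring).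
    apply Rmult_le_compat_r; lra. }
  apply Rle_trans with ((1 + t ^ S m) * exp (- t)); [apply Rmult_le_compat_r; lra|].
  rewrite Rmult_plus_distr_r; lra.
Qed.

(** * Domination of the Euler kernel, uniformly in vertical strips *)

Definition wgt (x t : R) : R := Rpower t (x - 1) * exp (- t).

Lemma wgt_pos (x t : R) : 0 < wgt x t.
Proof. apply Rmult_lt_0_compat; apply exp_pos. Qed.

Lemma continuous_wgt (x t : R) : 0 < t -> continuous (wgt x) t.
Proof.
  intros Ht; apply (ex_derive_continuous (V := R_NormedModule)).
  unfold wgt, Rpower; auto_derive; auto.
Qed.

(** Domination by the previous integrand holds because (1+t^x)^2 e^(-t) is bounded; [K0], [K1] and
    [K2] bound e^(-t), t^x e^(-t) and t^(2x) e^(-t). *)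
Lemma is_RInt_gen_wgt (x : R) : 0 < x ->
  is_RInt_gen (wgt x) (at_right 0) (Rbar_locally p_infty) (GammaR x).
Proof.
  intros Hx; apply (RInt_gen_correct (V := R_CompleteNormedModule)).
  destruct (Rpower_exp_bound 0 (Rle_refl _)) as [K0 HK0].
  destruct (Rpower_exp_bound x (Rlt_le _ _ Hx)) as [K1 HK1].
  destruct (Rpower_exp_bound (x + x)) as [K2 HK2]; [lra|].
  apply (ex_RInt_gen_dominated R_CompleteNormedModule _ _ (fun t => 0 < t) (wgt x)
    (fun t => scal (K0 + 2 * K1 + K2) (Rpower t (x - 1) / (1 + Rpower t x) ^ 2))).
  - apply pos_convex.
  - apply at_0_pos.
  - apply at_oo_pos.
  - intros t Ht; apply continuous_wgt; auto.
  - intros t Ht; apply (ex_derive_continuous (V := R_NormedModule)).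
    assert (Hp : 0 < 1 + Rpower t x) by (pose proof (Rpower_pos t x); lra). unfold Rpower in Hp.
    unfold scal, Rpower; simpl; unfold mult; simpl; auto_derive; repeat split; auto; nra.
  - intros t Ht; change (Rabs (wgt x t) <= (K0 + 2 * K1 + K2) * (Rpower t (x - 1) / (1 + Rpower t x) ^ 2)).
    rewrite Rabs_pos_eq by (apply Rlt_le, wgt_pos).
    specialize (HK0 t Ht); specialize (HK1 t Ht); specialize (HK2 t Ht).
    rewrite Rpower_plus in HK2; rewrite Rpower_O in HK0 by auto.
    unfold wgt; pose proof (Rpower_pos t x) as Pu; pose proof (Rpower_pos t (x - 1)) as Pv.
    set (u := Rpower t x) in *; set (v := Rpower t (x - 1)) in *; set (e := exp (- t)) in *.
    assert (He : e <= (K0 + 2 * K1 + K2) / (1 + u) ^ 2).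
    { apply Rmult_le_reg_r with ((1 + u) ^ 2); [nra|].
      unfold Rdiv; rewrite Rmult_assoc, Rinv_l by nra. nra. }
    replace ((K0 + 2 * K1 + K2) * (v / (1 + u) ^ 2)) with (v * ((K0 + 2 * K1 + K2) / (1 + u) ^ 2)) by (field; lra).
    apply Rmult_le_compat_l; lra.
  - destruct (ex_RInt_gen_base x Hx) as [l Hl]; eexists.
    apply (is_RInt_gen_scal (V := R_NormedModule)), Hl.
Qed.

Lemma wgt_le (a b x t : R) : 0 < t -> a <= x <= b -> wgt x t <= wgt a t + wgt b t.
Proof.
  intros Ht Hx; unfold wgt; rewrite <- Rmult_plus_distr_r.
  apply Rmult_le_compat_r; [apply Rlt_le, exp_pos|].
  pose proof (Rpower_pos t (a - 1)); pose proof (Rpower_pos t (b - 1)).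
  destruct (Rle_dec 1 t) as [H1|H1].
  - assert (Rpower t (x - 1) <= Rpower t (b - 1)) by (apply Rle_Rpower; lra); lra.
  - assert (Rpower t (x - 1) <= Rpower t (a - 1)); [|lra].
    unfold Rpower; apply exp_le.
    assert (ln t < 0) by (rewrite <- ln_1; apply ln_increasing; lra). nra.
Qed.

Lemma wgt_shift (x y t : R) : Rpower t y * wgt x t = wgt (x + y) t.
Proof.
  unfold wgt; rewrite <- Rmult_assoc, <- Rpower_plus; do 2 f_equal; ring.
Qed.

(** The power of |ln t| costs at most a multiple of exp(a/4 |ln t|); with the factor already present
    this makes exp(a/2 |ln t|) <= t^(a/2) + t^(-a/2). The exponent thus moves by a/2 at most and
    stays positive. The exponential factor is there to absorb t^h for |h| <= a/4. *)
Lemma ln_wgt_le (a b : R) (n : nat) : 0 < a -> a <= b ->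
  exists K, 0 <= K /\ forall x t, a <= x <= b -> 0 < t ->
    Rabs (ln t) ^ n * exp (a / 4 * Rabs (ln t)) * wgt x t <= K * (wgt (a / 2) t + wgt (b + a / 2) t).
Proof.
  intros Ha Hab.
  assert (Hf : 0 < INR (fact n)) by (apply lt_0_INR, lt_O_fact).
  assert (H4 : 0 < (4 / a) ^ n) by (apply pow_lt, Rdiv_lt_0_compat; lra).
  (* n! (4/a)^n comes from one term of the exponential series at a/4 |ln t|; the 2 counts the two
     shifted weights. *)
  exists (INR (fact n) * (4 / a) ^ n * 2); split; [nra|].
  intros x t Hx Ht.
  set (L := Rabs (ln t)); assert (HL : 0 <= L) by apply Rabs_pos.
  assert (H1 : L ^ n <= INR (fact n) * (4 / a) ^ n * exp (a / 4 * L)).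
  { pose proof (pow_le_fact_exp n (a / 4 * L)) as H1.
    assert (0 <= a / 4 * L) by nra. specialize (H1 H). rewrite Rpow_mult_distr in H1.
    replace (L ^ n) with ((4 / a) ^ n * ((a / 4) ^ n * L ^ n)).
    - pose proof (Rmult_le_compat_l _ _ _ (Rlt_le _ _ H4) H1); lra.
    - rewrite <- !Rpow_mult_distr; f_equal; field; lra. }
  assert (H2 : exp (a / 4 * L) * exp (a / 4 * L) <= Rpower t (a / 2) + Rpower t (- (a / 2))).
  { rewrite <- exp_plus; unfold Rpower, L.
    pose proof (exp_pos (a / 2 * ln t)); pose proof (exp_pos (- (a / 2) * ln t)).
    unfold Rabs; destruct (Rcase_abs (ln t)).
    - replace (a / 4 * - ln t + a / 4 * - ln t) with (- (a / 2) * ln t) by field; lra.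
    - replace (a / 4 * ln t + a / 4 * ln t) with (a / 2 * ln t) by field; lra. }
  pose proof (exp_pos (a / 4 * L)) as He. pose proof (wgt_pos x t) as Hw.
  set (c := INR (fact n) * (4 / a) ^ n) in *.
  assert (Hc : 0 < c) by (unfold c; nra).
  apply Rle_trans with (c * (Rpower t (a / 2) + Rpower t (- (a / 2))) * wgt x t).
  { apply Rmult_le_compat_r; [lra|].
    apply Rle_trans with (c * exp (a / 4 * L) * exp (a / 4 * L)); [apply Rmult_le_compat_r; lra|].
    rewrite Rmult_assoc; apply Rmult_le_compat_l; lra. }
  rewrite Rmult_assoc, Rmult_plus_distr_r, !wgt_shift.
  pose proof (wgt_le (a / 2) (b + a / 2) (x + a / 2) t Ht ltac:(lra)).
  pose proof (wgt_le (a / 2) (b + a / 2) (x + - (a / 2)) t Ht ltac:(lra)).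
  rewrite Rmult_assoc; apply Rmult_le_compat_l; lra.
Qed.

Lemma scal_C (k : R) (z : C) : scal (V := C_R_NormedModule) k z = (RtoC k * z)%C.
Proof. apply C_eq; unfold scal; simpl; unfold scal, mult; simpl; unfold mult; simpl; ring. Qed.

(** The integral is linear over the real scalars of the module only; multiplication by a complex
    constant is checked on components. *)
Lemma is_RInt_Cscal (f : R -> C) (a b : R) (c l : C) :
  is_RInt (V := C_R_NormedModule) f a b l ->
  is_RInt (V := C_R_NormedModule) (fun t => (c * f t)%C) a b (c * l)%C.
Proof.
  intros H.
  pose proof (is_RInt_fct_extend_fst (U := R_NormedModule) (V := R_NormedModule) f a b l H) as H1.
  pose proof (is_RInt_fct_extend_snd (U := R_NormedModule) (V := R_NormedModule) f a b l H) as H2.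
  apply (is_RInt_fct_extend_pair (U := R_NormedModule) (V := R_NormedModule)
    (fun t => (c * f t)%C) a b).
  - exact (is_RInt_minus (V := R_NormedModule) _ _ a b _ _
      (is_RInt_scal (V := R_NormedModule) _ a b (fst c) _ H1)
      (is_RInt_scal (V := R_NormedModule) _ a b (snd c) _ H2)).
  - exact (is_RInt_plus (V := R_NormedModule) _ _ a b _ _
      (is_RInt_scal (V := R_NormedModule) _ a b (fst c) _ H2)
      (is_RInt_scal (V := R_NormedModule) _ a b (snd c) _ H1)).
Qed.

Lemma filterlim_Cmod (T : Type) (F : (T -> Prop) -> Prop) {FF : Filter F} (f : T -> C) (l : C) :
  filterlim (fun t => Cmod (f t - l)) F (locally 0) ->
  filterlim f F (locally (T := C_R_NormedModule) l).
Proof.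
  intros Hf P [e He].
  assert (Hx : locally 0 (fun x => Rabs x < e)).
  { exists e; intros y Hy; change (Rabs (y - 0) < e) in Hy; rewrite Rminus_0_r in Hy; exact Hy. }
  specialize (Hf _ Hx); unfold filtermap in *; revert Hf; apply filter_imp; intros t Ht.
  apply He, (norm_compat1 (V := C_R_NormedModule)).
  rewrite norm_Cmod; rewrite Rabs_pos_eq in Ht by apply Cmod_ge_0; exact Ht.
Qed.

Lemma is_RInt_gen_Cscal (Fa Fb : (R -> Prop) -> Prop) {FFa : Filter Fa} {FFb : Filter Fb}
  (f : R -> C) (c l : C) :
  is_RInt_gen (V := C_R_NormedModule) f Fa Fb l ->
  is_RInt_gen (V := C_R_NormedModule) (fun t => (c * f t)%C) Fa Fb (c * l)%C.
Proof.
  intros Hf P HP.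
  assert (Hc : filterlim (fun z : C => (c * z)%C) (locally (T := C_R_NormedModule) l)
     (locally (T := C_R_NormedModule) (c * l)%C)).
  { apply (continuous_Cmult C_R_NormedModule (fun _ => c) (fun z => z) l);
    [apply (continuous_const (U := C_R_NormedModule) (V := C_R_NormedModule))
    | apply (continuous_id (U := C_R_NormedModule))]. }
  specialize (Hf _ (Hc P HP)); revert Hf; unfold filtermapi, filtermap; apply filter_imp.
  intros [a b] [y [H1 H2]]; exists (c * y)%C; split; [apply is_RInt_Cscal, H1 | exact H2].
Qed.

Lemma is_RInt_gen_Re_Im (Fa Fb : (R -> Prop) -> Prop) {FFa : Filter Fa} {FFb : Filter Fb}
  (f : R -> C) (l : C) :
  is_RInt_gen (V := C_R_NormedModule) f Fa Fb l ->
  is_RInt_gen (fun t => fst (f t)) Fa Fb (fst l) /\ is_RInt_gen (fun t => snd (f t)) Fa Fb (snd l).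
Proof.
  intros Hf; split; intros P HP.
  - assert (HQ : locally (T := C_R_NormedModule) l (fun z : C => P (fst z))).
    { apply (continuous_Re C_R_NormedModule (fun z => z) l); [apply (continuous_id (U := C_R_NormedModule)) | exact HP]. }
    specialize (Hf _ HQ); revert Hf; unfold filtermapi; apply filter_imp.
    intros [a b] [y [H1 H2]]; exists (fst y); split; auto.
    apply (is_RInt_fct_extend_fst (U := R_NormedModule) (V := R_NormedModule)), H1.
  - assert (HQ : locally (T := C_R_NormedModule) l (fun z : C => P (snd z))).
    { apply (continuous_Im C_R_NormedModule (fun z => z) l); [apply (continuous_id (U := C_R_NormedModule)) | exact HP]. }
    specialize (Hf _ HQ); revert Hf; unfold filtermapi; apply filter_imp.
    intros [a b] [y [H1 H2]]; exists (snd y); split; auto.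
    apply (is_RInt_fct_extend_snd (U := R_NormedModule) (V := R_NormedModule)), H1.
Qed.

(** [ring] and [field] do not recognise an equation stated in the carrier of
    the module [C_R_NormedModule]. *)
Ltac ceq := match goal with |- @eq _ ?a ?b => change (@eq C a b) end.

Definition gint (l : nat) (w : C) (t : R) : C :=
  (RtoC (ln t ^ l) * (cpowR t (w - 1) * RtoC (exp (- t))))%C.

(** The [l]-th derivative of Gamma, differentiated under the integral sign. *)
Definition gam (l : nat) (w : C) : C :=
  RInt_gen (V := C_R_CompleteNormedModule) (gint l w) (at_right 0) (Rbar_locally p_infty).

Lemma GammaC_gam (w : C) : GammaC w = gam 0 w.
Proof.
  unfold GammaC, gam; f_equal; apply functional_extensionality; intros t; unfold gint; simpl; ring.
Qed.

Lemma Cmod_gint (l : nat) (w : C) (t : R) : Cmod (gint l w t) = Rabs (ln t) ^ l * wgt (fst w) t.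
Proof.
  unfold gint, wgt; rewrite !Cmod_mult, !Cmod_R, Cmod_cpowR, <- RPow_abs; f_equal.
  rewrite (Rabs_pos_eq (exp (- t))) by apply Rlt_le, exp_pos.
  do 2 f_equal; simpl; ring.
Qed.

Lemma continuous_gint (l : nat) (w : C) (t : R) : 0 < t ->
  continuous (U := C_R_NormedModule) (gint l w) t.
Proof.
  intros Ht; unfold gint; apply continuous_Cmult; [|apply continuous_Cmult].
  - apply continuous_RtoC, (ex_derive_continuous (V := R_NormedModule)); auto_derive; auto.
  - apply (ex_derive_continuous (V := C_R_NormedModule)); eexists; apply is_derive_cpowR; auto.
  - apply continuous_RtoC, (ex_derive_continuous (V := R_NormedModule)); auto_derive; auto.
Qed.

Lemma is_RInt_gen_wgt_dom (a b K : R) : 0 < a -> a <= b ->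
  is_RInt_gen (fun t => K * (wgt (a / 2) t + wgt (b + a / 2) t))
    (at_right 0) (Rbar_locally p_infty) (K * (GammaR (a / 2) + GammaR (b + a / 2))).
Proof.
  intros Ha Hb; apply (is_RInt_gen_scal (V := R_NormedModule) (fun t => wgt (a / 2) t + wgt (b + a / 2) t)).
  apply (is_RInt_gen_plus (V := R_NormedModule) (wgt (a / 2)) (wgt (b + a / 2)));
    apply is_RInt_gen_wgt; lra.
Qed.

Lemma ln_wgt_le0 (a b : R) (n : nat) : 0 < a -> a <= b ->
  exists K, 0 <= K /\ forall x t, a <= x <= b -> 0 < t ->
    Rabs (ln t) ^ n * wgt x t <= K * (wgt (a / 2) t + wgt (b + a / 2) t).
Proof.
  intros Ha Hb; destruct (ln_wgt_le a b n Ha Hb) as [K [HK HK2]]; exists K; split; auto.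
  intros x t Hx Ht; eapply Rle_trans; [|apply (HK2 x t Hx Ht)].
  apply Rmult_le_compat_r; [apply Rlt_le, wgt_pos|].
  rewrite <- (Rmult_1_r (Rabs (ln t) ^ n)) at 1.
  apply Rmult_le_compat_l; [apply pow_le, Rabs_pos|].
  rewrite <- exp_0; apply exp_le; pose proof (Rabs_pos (ln t)); nra.
Qed.

Lemma is_gam (l : nat) (w : C) : 0 < fst w ->
  is_RInt_gen (V := C_R_NormedModule) (gint l w) (at_right 0) (Rbar_locally p_infty) (gam l w).
Proof.
  intros Hw; apply (RInt_gen_correct (V := C_R_CompleteNormedModule)).
  destruct (ln_wgt_le0 (fst w) (fst w) l Hw (Rle_refl _)) as [K [HK HK2]].
  apply (ex_RInt_gen_dominated C_R_CompleteNormedModule _ _ (fun t => 0 < t) (gint l w)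
    (fun t => K * (wgt (fst w / 2) t + wgt (fst w + fst w / 2) t))).
  - apply pos_convex.
  - apply at_0_pos.
  - apply at_oo_pos.
  - intros t Ht; apply continuous_gint; auto.
  - intros t Ht; apply (continuous_mult (K := R_AbsRing)); [apply continuous_const|].
    apply (continuous_plus (V := R_NormedModule)); apply continuous_wgt; auto.
  - intros t Ht; rewrite norm_Cmod, Cmod_gint; apply HK2; [lra | auto].
  - eexists; apply is_RInt_gen_wgt_dom; lra.
Qed.

Fixpoint rgam (n l : nat) (w h : C) : C :=
  match n with
  | O => gam l (w + h)
  | S m => (rgam m l w h - h ^ m * RtoC (/ INR (fact m)) * gam (l + m) w)%C
  end.

(** Since t^(w+h-1) = t^(w-1) e^(h ln t), a Taylor remainder of [gam l] at w is the Euler integral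
    weighted by the same remainder of the exponential at h ln t. *)
Lemma is_rgam (n l : nat) (w h : C) : 0 < fst w -> 0 < fst (w + h)%C ->
  is_RInt_gen (V := C_R_NormedModule) (fun t => gint l w t * rexp n (h * RtoC (ln t)))%C
    (at_right 0) (Rbar_locally p_infty) (rgam n l w h).
Proof.
  intros Hw Hh; induction n as [|n IH].
  - simpl. apply (is_RInt_gen_ext (V := C_R_NormedModule) (gint l (w + h))); [|apply is_gam; auto].
    apply filter_forall; intros _ t _.
    ceq; unfold gint. replace (w + h - 1)%C with ((w - 1) + h)%C by ring.
    rewrite cpowR_plus; unfold cpowR at 2; ring.
  - apply (is_RInt_gen_ext (V := C_R_NormedModule)
      (fun t => minus (gint l w t * rexp n (h * RtoC (ln t)))%C
        (h ^ n * RtoC (/ INR (fact n)) * gint (l + n) w t)%C)).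
    + apply filter_forall; intros _ t _.
      change (minus (gint l w t * rexp n (h * RtoC (ln t)))%C
        (h ^ n * RtoC (/ INR (fact n)) * gint (l + n) w t)%C)
      with (gint l w t * rexp n (h * RtoC (ln t)) - h ^ n * RtoC (/ INR (fact n)) * gint (l + n) w t)%C.
      ceq; simpl rexp; unfold gint. rewrite pow_add, RtoC_mult, Cpow_mult_l, RtoC_pow, (RtoC_pow (ln t) n); ring.
    + exact (is_RInt_gen_minus (V := C_R_NormedModule) _ _ _ _ IH
        (is_RInt_gen_Cscal _ _ _ (h ^ n * RtoC (/ INR (fact n)))%C _ (is_gam (l + n) w Hw))).
Qed.

(** The analytic input on Gamma, uniform in a strip however large the imaginary part: order 0 gives
    boundedness, order 2 differentiability, and arbitrary order the expansions at real points. *)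
Lemma rgam_le (a b : R) (n l : nat) : 0 < a -> a <= b ->
  exists K, 0 <= K /\ forall w h, a <= fst w <= b -> Cmod h <= a / 4 ->
    Cmod (rgam n l w h) <= K * Cmod h ^ n.
Proof.
  intros Ha Hb; destruct (ln_wgt_le a b (l + n) Ha Hb) as [K [HK HK2]].
  pose proof (is_RInt_gen_wgt_dom a b K Ha Hb) as HI.
  set (G := K * (GammaR (a / 2) + GammaR (b + a / 2))) in *.
  exists (Rabs G); split; [apply Rabs_pos|].
  intros w h Hw Hh.
  pose proof (Re_le_Cmod h) as Hr; pose proof (Cmod_ge_0 h) as Hh0.
  assert (Hwh : 0 < fst (w + h)%C).
  { simpl; unfold Rabs in Hr; destruct (Rcase_abs (fst h)); lra. }
  apply Rle_trans with (Cmod h ^ n * G).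
  2: { rewrite Rmult_comm; apply Rmult_le_compat_r; [apply pow_le; auto | apply Rle_abs]. }
  rewrite <- norm_Cmod.
  apply (RInt_gen_norm (V := C_R_CompleteNormedModule) (Fa := at_right 0) (Fb := Rbar_locally p_infty)
    (fun t => gint l w t * rexp n (h * RtoC (ln t)))%C
    (fun t => Cmod h ^ n * (K * (wgt (a / 2) t + wgt (b + a / 2) t)))).
  - generalize at_0_oo_le; apply filter_imp; intros [u v]; simpl; lra.
  - generalize at_0_oo_le; apply filter_imp; intros [u v] [H1 H2]; simpl in *; intros t Ht.
    rewrite norm_Cmod, Cmod_mult, Cmod_gint.
    eapply Rle_trans.
    + apply Rmult_le_compat_l; [|apply Cmod_rexp_le].
      apply Rmult_le_pos; [apply pow_le, Rabs_pos | apply Rlt_le, wgt_pos].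
    + rewrite Cmod_mult, Cmod_R, Rpow_mult_distr.
      specialize (HK2 (fst w) t Hw ltac:(lra)).
      set (L := Rabs (ln t)) in *. assert (HL : 0 <= L) by apply Rabs_pos.
      replace (L ^ l * wgt (fst w) t * (Cmod h ^ n * L ^ n * exp (Cmod h * L)))
        with (Cmod h ^ n * (L ^ (l + n) * exp (Cmod h * L) * wgt (fst w) t)) by (rewrite pow_add; ring).
      apply Rmult_le_compat_l; [apply pow_le; auto|].
      eapply Rle_trans; [|apply HK2].
      apply Rmult_le_compat_r; [apply Rlt_le, wgt_pos|].
      apply Rmult_le_compat_l; [apply pow_le; auto|].
      apply exp_le; nra.
  - apply is_rgam; auto; lra.
  - apply (is_RInt_gen_scal (V := R_NormedModule)), HI.
Qed.

Lemma gam_bounded (a b : R) (l : nat) : 0 < a -> a <= b ->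
  exists K, 0 <= K /\ forall w, a <= fst w <= b -> Cmod (gam l w) <= K.
Proof.
  intros Ha Hb; destruct (rgam_le a b 0 l Ha Hb) as [K [HK HK2]]; exists K; split; auto.
  intros w Hw; specialize (HK2 w 0%C Hw). rewrite Cmod_0 in HK2; simpl in HK2.
  rewrite Cplus_0_r, Rmult_1_r in HK2; apply HK2; lra.
Qed.

Lemma gint_RtoC (l : nat) (x t : R) : gint l (RtoC x) t = RtoC (ln t ^ l * wgt x t).
Proof.
  unfold gint, wgt. rewrite <- RtoC_minus, cpowR_RtoC, !RtoC_mult; ring.
Qed.

Lemma gam_real (l : nat) (x : R) : 0 < x -> gam l (RtoC x) = RtoC (fst (gam l (RtoC x))).
Proof.
  intros Hx; apply C_eq; [reflexivity|]; change (snd (gam l (RtoC x)) = 0).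
  destruct (is_RInt_gen_Re_Im _ _ _ _ (is_gam l (RtoC x) Hx)) as [_ H].
  apply (is_RInt_gen_unique (V := R_CompleteNormedModule)) in H; rewrite <- H.
  apply (is_RInt_gen_unique (V := R_CompleteNormedModule)).
  (* The zero integrand is presented as the difference of two equal convergent integrals, so that
     its value follows from linearity. *)
  apply (is_RInt_gen_ext (V := R_NormedModule) (fun t => minus (wgt 1 t) (wgt 1 t))).
  - apply filter_forall; intros _ t _; rewrite gint_RtoC; apply (plus_opp_r (wgt 1 t)).
  - evar_last; [apply (is_RInt_gen_minus (V := R_NormedModule)); apply is_RInt_gen_wgt; lra|].
    apply (plus_opp_r (G := R_AbelianGroup)).
Qed.

Lemma gam0_GammaR (x : R) : 0 < x -> gam 0 (RtoC x) = RtoC (GammaR x).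
Proof.
  intros Hx; rewrite gam_real by auto; f_equal.
  destruct (is_RInt_gen_Re_Im _ _ _ _ (is_gam 0 (RtoC x) Hx)) as [H _].
  apply (is_RInt_gen_unique (V := R_CompleteNormedModule)) in H; rewrite <- H.
  apply (is_RInt_gen_unique (V := R_CompleteNormedModule)).
  apply (is_RInt_gen_ext (V := R_NormedModule) (wgt x)).
  - apply filter_forall; intros _ t _; rewrite gint_RtoC; simpl; ring.
  - apply is_RInt_gen_wgt; auto.
Qed.

Lemma is_derive_gam_real (l : nat) (x : R) : 0 < x ->
  is_derive (fun x => fst (gam l (RtoC x))) x (fst (gam (S l) (RtoC x))).
Proof.
  intros Hx; apply (is_derive_Re (fun x => gam l (RtoC x))).
  destruct (rgam_le x x 2 l Hx (Rle_refl _)) as [K [HK HK2]].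
  apply (is_derive_quad C_R_NormedModule _ x _ K (x / 4)); [lra|].
  intros h Hh; rewrite norm_Cmod.
  specialize (HK2 (RtoC x) (RtoC h) ltac:(simpl; lra)).
  rewrite Cmod_R, pow2_abs in HK2; specialize (HK2 Hh).
  eapply Rle_trans; [right | exact HK2]; f_equal.
  rewrite scal_C; simpl.
  change (minus (minus (gam l (RtoC (x + h))) (gam l (RtoC x))) (RtoC h * gam (S l) (RtoC x))%C)
    with ((gam l (RtoC (x + h)) - gam l (RtoC x)) - RtoC h * gam (S l) (RtoC x))%C.
  rewrite RtoC_plus, Rinv_1, Nat.add_0_r, Nat.add_1_r; ring.
Qed.

(** Connects the iterated derivative of the statement with the integral carrying ln(t)^l. The
    induction needs agreement on a neighbourhood, and the ball of radius x around x stays in the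
    positive reals. *)
Lemma Gamma_deriv_gam (l : nat) (x : R) : 0 < x -> Gamma_deriv l x = fst (gam l (RtoC x)).
Proof.
  unfold Gamma_deriv; revert x; induction l as [|l IH]; intros x Hx.
  - rewrite gam0_GammaR by auto; reflexivity.
  - simpl. rewrite (Derive_ext_loc _ (fun x => fst (gam l (RtoC x)))).
    + apply is_derive_unique, is_derive_gam_real; auto.
    + exists (mkposreal x Hx); intros y Hy; apply IH.
      change (Rabs (y - x) < x) in Hy; apply Rabs_def2 in Hy; lra.
Qed.

(** Integration by parts: t^w e^(-t) vanishes at both ends and its derivative is w t^(w-1) e^(-t) -
    t^w e^(-t). *)
Lemma gam_succ (w : C) : 0 < fst w -> gam 0 (w + 1) = (w * gam 0 w)%C.
Proof.
  intros Hw.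
  assert (Hl : forall F : (R -> Prop) -> Prop, Filter F -> F (fun t => 0 < t) ->
    filterlim (fun t => Rpower t (fst w) * exp (- t)) F (locally 0) ->
    filterlim (fun t => (cpowR t w * RtoC (exp (- t)))%C) F (locally (T := C_R_NormedModule) (RtoC 0))).
  { intros F HF Hp HF0; apply filterlim_Cmod; auto.
    apply (filterlim_ext (fun t => Rpower t (fst w) * exp (- t))); auto.
    intros t. unfold Cminus; rewrite Copp_0, Cplus_0_r, Cmod_mult, Cmod_cpowR, Cmod_R.
    rewrite Rabs_pos_eq by apply Rlt_le, exp_pos; reflexivity. }
  assert (HI : is_RInt_gen (V := C_R_NormedModule) (fun t => w * gint 0 w t - gint 0 (w + 1) t)%C
    (at_right 0) (Rbar_locally p_infty) (minus (RtoC 0 : C_R_NormedModule) (RtoC 0))).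
  { apply (is_RInt_gen_FTC C_R_CompleteNormedModule _ _ (fun t => 0 < t)
      (fun t => (cpowR t w * RtoC (exp (- t)))%C)).
    - apply pos_convex.
    - apply at_0_pos.
    - apply at_oo_pos.
    - intros t Ht.
      assert (He : is_derive (V := C_R_NormedModule) (fun t => RtoC (exp (- t))) t (RtoC (- exp (- t)))).
      { apply is_derive_pair; auto_derive; trivial; ring. }
      evar_last; [exact (is_derive_Cmult _ _ _ _ _ (is_derive_cpowR w t Ht) He)|].
      unfold gint; replace (w + 1 - 1)%C with w by ring. rewrite RtoC_opp; simpl; ring.
    - intros t Ht; apply (continuous_minus (V := C_R_NormedModule)
        (fun t => w * gint 0 w t)%C (gint 0 (w + 1))); [|apply continuous_gint; auto].
      apply continuous_Cmult; [apply (continuous_const (U := R_UniformSpace) (V := C_R_NormedModule))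
        | apply continuous_gint; auto].
    - apply Hl; [apply _ | apply at_0_pos|].
      replace (0 : R) with (0 * exp (- 0)) at 2 by ring.
      apply (filterlim_comp_2 (fun t => Rpower t (fst w)) (fun t => exp (- t)) Rmult (G := locally 0) (H := locally (exp (- 0)))).
      + apply Rpower_lim_0; auto.
      + assert (Hc : continuous (fun t => exp (- t)) 0).
        { apply (ex_derive_continuous (V := R_NormedModule)); auto_derive; auto. }
        intros P HP; destruct (Hc P HP) as [e He]; exists e; intros; apply He; auto.
      + apply (filterlim_mult (K := R_AbsRing)).
    - apply Hl; [apply _ | apply at_oo_pos|].
      (* Bounding one more power of t gives t^(Re w) e^(-t) <= K/t, hence the threshold K/e. *)
      destruct (Rpower_exp_bound (fst w + 1)) as [K HK]; [lra|].
      intros P [e He]. pose proof (cond_pos e) as Pe.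
      exists (Rmax 0 (K / e)); intros t Ht.
      assert (Ht0 : 0 < t) by (apply Rle_lt_trans with (2 := Ht), Rmax_l).
      assert (Ht1 : K / e < t) by (apply Rle_lt_trans with (2 := Ht), Rmax_r).
      apply He; change (Rabs (Rpower t (fst w) * exp (- t) - 0) < e).
      rewrite Rminus_0_r, Rabs_pos_eq by (apply Rmult_le_pos; apply Rlt_le, exp_pos).
      specialize (HK t Ht0); rewrite Rpower_plus, Rpower_1 in HK by auto.
      apply Rmult_lt_reg_r with t; auto.
      apply Rle_lt_trans with K; [lra|].
      apply Rmult_lt_compat_r with (r := pos e) in Ht1; auto.
      unfold Rdiv in Ht1; rewrite Rmult_assoc, Rinv_l in Ht1; lra. }
  pose proof (is_RInt_gen_minus (V := C_R_NormedModule) _ _ _ _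
    (is_RInt_gen_Cscal _ _ _ w _ (is_gam 0 w Hw)) (is_gam 0 (w + 1) ltac:(simpl; lra))) as HJ.
  apply (is_RInt_gen_unique (V := C_R_CompleteNormedModule)) in HI.
  apply (is_RInt_gen_unique (V := C_R_CompleteNormedModule)) in HJ.
  assert (E : (w * gam 0 w - gam 0 (w + 1) = 0)%C).
  { transitivity (minus (RtoC 0 : C_R_NormedModule) (RtoC 0)); [rewrite <- HI; symmetry; exact HJ|].
    apply (minus_eq_zero (G := C_R_NormedModule)). }
  transitivity (w * gam 0 w - (w * gam 0 w - gam 0 (w + 1)))%C; [ring | rewrite E; ring].
Qed.

(** * Gamma(1/2) and the absence of zeros *)

Definition gauss (x : R) : R := RInt (fun u => exp (- (u * u))) 0 x.

(** The companion of [gauss] in the one-variable computation of the Gaussian integral: its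
    derivative is opposite to that of [gauss]^2, it equals pi/4 at 0 and it tends to 0 at
    infinity. *)
Definition gauss_aux (x : R) : R := RInt (fun u => exp (- (x * x) * (1 + u * u)) / (1 + u * u)) 0 1.

Lemma continuous_gauss_integrand (u : R) : continuous (fun u => exp (- (u * u))) u.
Proof. apply (ex_derive_continuous (V := R_NormedModule)); auto_derive; auto. Qed.

Lemma is_derive_gauss (x : R) : is_derive gauss x (exp (- (x * x))).
Proof.
  apply (is_derive_RInt (V := R_NormedModule) (fun u => exp (- (u * u))) gauss 0).
  - apply filter_forall; intros y; apply (RInt_correct (V := R_CompleteNormedModule)).
    apply (ex_RInt_continuous (V := R_CompleteNormedModule)); intros; apply continuous_gauss_integrand.
  - apply continuous_gauss_integrand.
Qed.

Lemma is_derive_gauss_aux (x : R) : is_derive gauss_aux x (- 2 * exp (- (x * x)) * gauss x).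
Proof.
  set (f := fun z u : R => exp (- (z * z) * (1 + u * u)) / (1 + u * u)).
  assert (Hd : forall z u, is_derive (fun z => f z u) z (- 2 * z * exp (- (z * z) * (1 + u * u)))).
  { intros z u; unfold f; auto_derive; [nra | field; nra]. }
  assert (HD : forall z u, Derive (fun z => f z u) z = - 2 * z * exp (- (z * z) * (1 + u * u))).
  { intros z u; apply is_derive_unique, Hd. }
  evar_last.
  { apply (is_derive_RInt_param f 0 1 x).
    - apply filter_forall; intros z t _; eexists; apply Hd.
    - intros t _.
      apply (continuity_2d_pt_ext (fun z u => (- 2 * z) * exp (- (z * z) * (1 + u * u)))).
      { intros; symmetry; apply HD. }
      apply continuity_2d_pt_mult.
      + apply continuity_2d_pt_mult; [apply continuity_2d_pt_const | apply continuity_2d_pt_id1].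
      + apply (continuity_1d_2d_pt_comp exp (fun z u => - (z * z) * (1 + u * u))).
        * apply derivable_continuous_pt, derivable_pt_exp.
        * apply continuity_2d_pt_mult.
          -- apply continuity_2d_pt_opp, continuity_2d_pt_mult; apply continuity_2d_pt_id1.
          -- apply continuity_2d_pt_plus; [apply continuity_2d_pt_const|].
             apply continuity_2d_pt_mult; apply continuity_2d_pt_id2.
    - apply filter_forall; intros z; apply (ex_RInt_continuous (V := R_CompleteNormedModule)).
      intros u _; apply (ex_derive_continuous (V := R_NormedModule)); unfold f; auto_derive; nra. }
  (* The factor e^(-x^2) leaves the integral and the substitution v = x u turns the rest into
     [gauss x]; the form x u + 0 is that of an affine change of variable. *)
  rewrite (RInt_ext _ (fun u => scal (- 2 * exp (- (x * x))) (scal x (exp (- ((x * u + 0) * (x * u + 0))))))).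
  2: { intros u _; rewrite HD; unfold scal; simpl; unfold mult; simpl.
       replace (- (x * x) * (1 + u * u)) with (- (x * x) + - ((x * u + 0) * (x * u + 0))) by ring.
       rewrite exp_plus; ring. }
  rewrite (RInt_scal (V := R_CompleteNormedModule)).
  - assert (E : RInt (fun u => scal x (exp (- ((x * u + 0) * (x * u + 0))))) 0 1 = gauss x).
    { pose proof (RInt_comp_lin (V := R_CompleteNormedModule) (fun v => exp (- (v * v))) x 0 0 1) as E.
      replace (x * 0 + 0) with 0 in E by ring; replace (x * 1 + 0) with x in E by ring; apply E.
      apply (ex_RInt_continuous (V := R_CompleteNormedModule)); intros; apply continuous_gauss_integrand. }
    rewrite <- E; reflexivity.
  - apply (ex_RInt_continuous (V := R_CompleteNormedModule)); intros u _.
    apply (ex_derive_continuous (V := R_NormedModule)); unfold scal; simpl; unfold mult; simpl; auto_derive; auto.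
Qed.

Lemma gauss_sqr (x : R) : 0 < x -> gauss x ^ 2 + gauss_aux x = PI / 4.
Proof.
  intros Hx.
  replace (PI / 4) with (gauss 0 ^ 2 + gauss_aux 0).
  - symmetry; apply (eq_is_derive (fun x => gauss x ^ 2 + gauss_aux x)); auto.
    intros t _; evar_last.
    { apply (is_derive_plus (V := R_NormedModule) (fun x => gauss x ^ 2) gauss_aux);
      [apply (is_derive_pow gauss 2), is_derive_gauss | apply is_derive_gauss_aux]. }
    unfold plus, zero; simpl; ring.
  - assert (H0 : gauss 0 = 0) by apply (RInt_point (V := R_CompleteNormedModule)).
    rewrite H0; unfold gauss_aux.
    rewrite (RInt_ext _ (fun u => / (1 + u ^ 2))).
    2: { intros u _. replace (- (0 * 0) * (1 + u * u)) with 0 by ring; rewrite exp_0.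
         match goal with |- @eq _ ?a ?b => change (@eq R a b) end.
         replace (1 + u ^ 2) with (1 + u * u) by ring; field; nra. }
    rewrite (is_RInt_unique (V := R_CompleteNormedModule) _ 0 1 (minus (atan 1) (atan 0))).
    + unfold minus, plus, opp; simpl; rewrite atan_1, atan_0; field.
    + apply (is_RInt_derive (V := R_CompleteNormedModule) atan); intros u _.
      * auto_derive; auto. field; nra.
      * apply (ex_derive_continuous (V := R_NormedModule)); auto_derive; nra.
Qed.

Lemma gauss_aux_bound (x : R) : 0 <= gauss_aux x <= exp (- (x * x)).
Proof.
  assert (Hex : ex_RInt (fun u => exp (- (x * x) * (1 + u * u)) / (1 + u * u)) 0 1).
  { apply (ex_RInt_continuous (V := R_CompleteNormedModule)).
    intros u _; apply (ex_derive_continuous (V := R_NormedModule)); auto_derive; nra. }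
  split.
  - apply RInt_ge_0; [lra | exact Hex|]; intros u _.
    apply Rmult_le_pos; [apply Rlt_le, exp_pos | apply Rlt_le, Rinv_0_lt_compat; nra].
  - replace (exp (- (x * x))) with (RInt (fun _ => exp (- (x * x))) 0 1).
    2: { rewrite RInt_const; unfold scal; simpl; unfold mult; simpl; ring. }
    apply RInt_le; [lra | exact Hex | apply ex_RInt_const|]; intros u Hu.
    assert (exp (- (x * x) * (1 + u * u)) <= exp (- (x * x))) by (apply exp_le; nra).
    pose proof (exp_pos (- (x * x) * (1 + u * u))).
    apply Rle_trans with (exp (- (x * x) * (1 + u * u)) / 1); [|lra].
    apply Rmult_le_compat_l; [lra|]; apply Rinv_le_contravar; nra.
Qed.

Lemma gauss_nonneg (x : R) : 0 <= x -> 0 <= gauss x.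
Proof.
  intros Hx; apply RInt_ge_0; auto.
  - apply (ex_RInt_continuous (V := R_CompleteNormedModule)); intros; apply continuous_gauss_integrand.
  - intros; apply Rlt_le, exp_pos.
Qed.

(** The composition with the square root prepares the substitution t = u^2 in Gamma(1/2), for which
    2 [gauss] (sqrt t) is a primitive of t^(-1/2) e^(-t). *)
Lemma gauss_lim : filterlim (fun t => gauss (sqrt t)) (Rbar_locally p_infty) (locally (sqrt PI / 2)).
Proof.
  apply (filterlim_ext_loc (fun t => sqrt (PI / 4 - gauss_aux (sqrt t)))).
  - exists 0; intros t Ht.
    assert (Hs : 0 < sqrt t) by (apply sqrt_lt_R0; auto).
    rewrite <- (gauss_sqr (sqrt t) Hs).
    replace (gauss (sqrt t) ^ 2 + gauss_aux (sqrt t) - gauss_aux (sqrt t)) with (gauss (sqrt t) ^ 2) by ring.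
    apply sqrt_pow2, gauss_nonneg; lra.
  - replace (sqrt PI / 2) with (sqrt (PI / 4 - 0)).
    2: { rewrite Rminus_0_r, sqrt_div_alt by lra; f_equal.
         replace 4 with (2 ^ 2) by ring; apply sqrt_pow2; lra. }
    apply (filterlim_comp _ _ _ (fun t => gauss_aux (sqrt t)) (fun u => sqrt (PI / 4 - u)) _ (locally 0)).
    + intros P [e He]; exists (Rmax 0 (- ln e)); intros t Ht.
      assert (Ht0 : 0 < t) by (apply Rle_lt_trans with (2 := Ht), Rmax_l).
      assert (Ht1 : - ln e < t) by (apply Rle_lt_trans with (2 := Ht), Rmax_r).
      apply He; change (Rabs (gauss_aux (sqrt t) - 0) < e).
      pose proof (gauss_aux_bound (sqrt t)) as Hb; rewrite sqrt_sqrt in Hb by lra.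
      rewrite Rminus_0_r, Rabs_pos_eq by lra.
      apply Rle_lt_trans with (exp (- t)); [lra|].
      rewrite <- (exp_ln e) by apply cond_pos; apply exp_increasing; lra.
    + apply (continuous_comp (fun u => PI / 4 - u) sqrt 0).
      * apply (ex_derive_continuous (V := R_NormedModule)); auto_derive; auto.
      * apply continuous_sqrt.
Qed.

Lemma GammaR_half : GammaR (1 / 2) = sqrt PI.
Proof.
  assert (HI : is_RInt_gen (wgt (1 / 2)) (at_right 0) (Rbar_locally p_infty)
     (minus (scal 2 (sqrt PI / 2)) (scal 2 (gauss 0)))).
  { apply (is_RInt_gen_FTC R_CompleteNormedModule _ _ (fun t => 0 < t) (fun t => scal 2 (gauss (sqrt t)))).
    - apply pos_convex.
    - apply at_0_pos.
    - apply at_oo_pos.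
    - intros t Ht; unfold wgt.
      assert (Hs : 0 < sqrt t) by (apply sqrt_lt_R0; auto).
      evar_last.
      { apply (is_derive_scal (fun t => gauss (sqrt t)) t 2).
        apply (is_derive_comp (V := R_NormedModule) gauss sqrt); [apply is_derive_gauss|].
        apply is_derive_sqrt with (df := 1) (f := fun t => t); [apply (is_derive_id (K := R_AbsRing))| auto]. }
      unfold scal; simpl; unfold mult; simpl.
      rewrite sqrt_sqrt by lra.
      replace (1 / 2 - 1) with (- / 2) by field.
      rewrite Rpower_Ropp, Rpower_sqrt by auto; field; lra.
    - intros t Ht; apply continuous_wgt; auto.
    - apply (filterlim_comp _ _ _ (fun t => gauss (sqrt t)) (fun u => scal 2 u) _ (locally (gauss 0))).
      + assert (Hc : continuous (fun t => gauss (sqrt t)) 0).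
        { apply (continuous_comp sqrt gauss); [apply continuous_sqrt|].
          apply (ex_derive_continuous (V := R_NormedModule)); eexists; apply is_derive_gauss. }
        unfold continuous in Hc; rewrite sqrt_0 in Hc.
        intros P HP; destruct (Hc P HP) as [e He]; exists e; intros; apply He; auto.
      + apply (filterlim_scal_r (K := R_AbsRing) (V := R_NormedModule)).
    - apply (filterlim_comp _ _ _ (fun t => gauss (sqrt t)) (fun u => scal 2 u) _ (locally (sqrt PI / 2))).
      + apply gauss_lim.
      + apply (filterlim_scal_r (K := R_AbsRing) (V := R_NormedModule)). }
  unfold GammaR; apply (is_RInt_gen_unique (V := R_CompleteNormedModule)) in HI.
  unfold wgt in HI; rewrite HI.
  assert (H0 : gauss 0 = 0) by apply (RInt_point (V := R_CompleteNormedModule)).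
  rewrite H0; unfold minus, plus, opp, scal; simpl; unfold mult; simpl; field.
Qed.

(** Every truncated integral whose interval contains [1,2] is at least the integral m over [1,2],
    which is positive; if Gamma(x) <= 0, some of these would be within m of it, hence below m. *)
Lemma GammaR_pos (x : R) : 0 < x -> 0 < GammaR x.
Proof.
  intros Hx; destruct (Rlt_dec 0 (GammaR x)) as [|Hn]; [auto | exfalso].
  assert (Hex : forall a b, 0 < a -> 0 < b -> ex_RInt (wgt x) a b).
  { intros a b Ha Hb; apply (ex_RInt_continuous (V := R_CompleteNormedModule)).
    intros t Ht; apply continuous_wgt; apply Rlt_le_trans with (2 := proj1 Ht), Rmin_pos; auto. }
  assert (Hm : 0 < RInt (wgt x) 1 2).
  { apply RInt_gt_0; [lra | intros; apply wgt_pos | intros; apply continuous_wgt; lra]. }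
  pose proof (is_RInt_gen_wgt x Hx _ (locally_ball _ (mkposreal _ Hm))) as HP.
  unfold filtermapi in HP; destruct HP as [Qa Qb HQa HQb HQ].
  assert (Ha : at_right 0 (fun t => 0 < t < 1)).
  { exists (mkposreal 1 Rlt_0_1); intros y Hy H0.
    change (Rabs (y - 0) < 1) in Hy; rewrite Rminus_0_r in Hy; apply Rabs_def2 in Hy; lra. }
  assert (Hb : Rbar_locally p_infty (fun t => 2 < t)) by (exists 2; auto).
  destruct (filter_ex _ (filter_and _ _ HQa Ha)) as [a [Ha1 Ha2]].
  destruct (filter_ex _ (filter_and _ _ HQb Hb)) as [b [Hb1 Hb2]].
  destruct (HQ a b Ha1 Hb1) as [y [Hy1 Hy2]]; simpl in *.
  change (Rabs (y - GammaR x) < RInt (wgt x) 1 2) in Hy2; apply Rabs_def2 in Hy2.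
  apply (is_RInt_unique (V := R_CompleteNormedModule)) in Hy1.
  assert (E1 : RInt (wgt x) a b = RInt (wgt x) a 1 + RInt (wgt x) 1 b)
    by (symmetry; apply (RInt_Chasles (V := R_CompleteNormedModule)); apply Hex; lra).
  assert (E2 : RInt (wgt x) 1 b = RInt (wgt x) 1 2 + RInt (wgt x) 2 b)
    by (symmetry; apply (RInt_Chasles (V := R_CompleteNormedModule)); apply Hex; lra).
  assert (0 <= RInt (wgt x) a 1) by (apply RInt_ge_0; [lra | apply Hex; lra | intros; apply Rlt_le, wgt_pos]).
  assert (0 <= RInt (wgt x) 2 b) by (apply RInt_ge_0; [lra | apply Hex; lra | intros; apply Rlt_le, wgt_pos]).
  lra.
Qed.

Lemma GammaR_succ (x : R) : 0 < x -> GammaR (x + 1) = x * GammaR x.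
Proof.
  intros Hx; apply RtoC_inj.
  rewrite RtoC_mult, <- !gam0_GammaR, RtoC_plus by lra; apply gam_succ; auto.
Qed.

(** * Concentration of the Gamma weight and absence of zeros *)

Lemma Cmod_cexp_imag_le (y : R) : Cmod (cexp (0, y) - 1) <= 3 * Rabs y.
Proof.
  assert (Hm : Cmod (0, y) = Rabs y).
  { rewrite Cmod_pair; replace (0 ^ 2 + y ^ 2) with (Rsqr y) by (unfold Rsqr; ring); apply sqrt_Rsqr_abs. }
  destruct (Rle_dec (Rabs y) 1) as [H1|H1].
  - pose proof (Cmod_rexp_le 1 (0, y)) as H2; simpl rexp in H2.
    replace (cexp (0, y) - 1)%C with (cexp (0, y) - 1 * RtoC (/ 1))%C by (rewrite Rinv_1; ring).
    eapply Rle_trans; [exact H2|]; rewrite Hm, pow_1.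
    pose proof (exp_le _ _ H1); pose proof exp_le_3; pose proof (Rabs_pos y); nra.
  - eapply Rle_trans; [apply Cmod_minus_le|]; rewrite Cmod_cexp, Cmod_1; simpl; rewrite exp_0; lra.
Qed.

(** Linear in r-1 on the whole half-line: for r >= 1/2, |ln r| <= 2 |r-1| gives the term 6|y|; for r
    < 1/2 the trivial bound 2 is below 4 |r-1|. *)
Lemma Cmod_cexp_ln_le (y r : R) : 0 < r ->
  Cmod (cexp (0, y * ln r) - 1) <= (6 * Rabs y + 4) * Rabs (r - 1).
Proof.
  intros Hr; pose proof (Rabs_pos y) as Hy.
  destruct (Rle_dec (1 / 2) r) as [H2|H2].
  - eapply Rle_trans; [apply Cmod_cexp_imag_le|]; rewrite Rabs_mult.
    assert (H : Rabs (ln r) <= 2 * Rabs (r - 1)).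
    { assert (Hln : forall s, 0 < s -> ln s <= s - 1).
      { intros s Hs; rewrite <- (ln_exp (s - 1)); apply ln_le; auto.
        pose proof (exp_ineq1_le (s - 1)); lra. }
      destruct (Rle_dec 1 r) as [H1|H1].
      - rewrite !Rabs_pos_eq; [specialize (Hln r Hr); lra | lra |].
        rewrite <- ln_1; apply ln_le; lra.
      - assert (ln r < 0) by (rewrite <- ln_1; apply ln_increasing; lra).
        rewrite !Rabs_left by lra. rewrite <- ln_Rinv by auto.
        eapply Rle_trans; [apply Hln, Rinv_0_lt_compat; auto|].
        apply Rmult_le_reg_r with r; auto; rewrite Rmult_minus_distr_r, Rinv_l by lra; nra. }
    pose proof (Rabs_pos (r - 1)); nra.
  - eapply Rle_trans; [apply Cmod_minus_le|]; rewrite Cmod_cexp, Cmod_1; simpl; rewrite exp_0.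
    rewrite (Rabs_left (r - 1)) by lra; nra.
Qed.

(** Chebyshev's inequality for the Gamma distribution, whose variance is
    small compared with the square of its mean when [X] is large. *)
Lemma gam0_concentration (X y c : R) : 0 < X -> c = 6 * Rabs y + 4 ->
  Cmod (gam 0 (X, y) * cpowR X (0, - y) - RtoC (GammaR X)) <= (1 / 2 + c ^ 2 / (2 * X)) * GammaR X.
Proof.
  intros HX Hc; assert (Hc0 : 0 < c) by (pose proof (Rabs_pos y); lra).
  rewrite <- gam0_GammaR, <- norm_Cmod by auto.
  apply (RInt_gen_norm (V := C_R_CompleteNormedModule) (Fa := at_right 0) (Fb := Rbar_locally p_infty)
    (fun t => minus (cpowR X (0, - y)%R * gint 0 (X, y) t)%C (gint 0 (RtoC X) t))
    (fun t => plus (scal (1 / 2 + c ^ 2 / 2) (wgt X t))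
       (plus (scal (c ^ 2 / 2 / X ^ 2) (wgt (X + 1 + 1) t)) (scal (- c ^ 2 / X) (wgt (X + 1) t))))).
  - generalize at_0_oo_le; apply filter_imp; intros [u v]; simpl; lra.
  - generalize at_0_oo_le; apply filter_imp; intros [u v] [H1 H2]; simpl in *; intros t Ht.
    assert (Ht0 : 0 < t) by lra.
    rewrite norm_Cmod.
    assert (E : minus (cpowR X (0, - y)%R * gint 0 (X, y) t)%C (gint 0 (RtoC X) t) =
      (gint 0 (RtoC X) t * (cexp (0, (y * ln (t / X))%R) - 1))%C).
    { transitivity (cpowR X (0, - y)%R * gint 0 (X, y) t - gint 0 (RtoC X) t)%C; [reflexivity|].
      unfold gint; replace ((X, y) - 1)%C with ((RtoC X - 1) + (0, y))%C by (apply C_eq; simpl; ring).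
      rewrite cpowR_plus.
      replace (cexp (0, (y * ln (t / X))%R)) with (cpowR t (0, y) * cpowR X (0, - y)%R)%C; [ceq; ring|].
      unfold cpowR; rewrite <- cexp_plus; f_equal; unfold Rdiv.
      rewrite ln_mult, ln_Rinv by (auto; apply Rinv_0_lt_compat; auto).
      apply C_eq; simpl; ring. }
    rewrite E, Cmod_mult, Cmod_gint; simpl (Rabs (ln t) ^ 0); rewrite Rmult_1_l; simpl (fst (RtoC X)).
    eapply Rle_trans.
    { apply Rmult_le_compat_l; [apply Rlt_le, wgt_pos|].
      apply Cmod_cexp_ln_le, Rdiv_lt_0_compat; auto. }
    rewrite <- Hc. rewrite <- !(wgt_shift _ 1), Rpower_1 by auto.
    unfold plus, scal; simpl; unfold mult; simpl.
    set (r := t / X).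
    (* From (c|r-1| - 1)^2 >= 0. With r = t/X, the weighted integral of (r-1)^2 combines Gamma at X,
       X+1 and X+2 into Gamma(X)/X, whence the term c^2/(2X). *)
    apply Rle_trans with (wgt X t * (1 / 2 + c ^ 2 / 2 * (r - 1) ^ 2)).
    + apply Rmult_le_compat_l; [apply Rlt_le, wgt_pos|].
      rewrite <- (pow2_abs (r - 1)). pose proof (Rabs_pos (r - 1)).
      assert (0 <= (c * Rabs (r - 1) - 1) ^ 2) by apply pow2_ge_0. nra.
    + right; unfold r; simpl; field; lra.
  - rewrite Cmult_comm.
    exact (is_RInt_gen_minus (V := C_R_NormedModule) _ _ _ _
      (is_RInt_gen_Cscal _ _ _ (cpowR X (0, - y)) _ (is_gam 0 (X, y) HX)) (is_gam 0 (RtoC X) HX)).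
  - replace ((1 / 2 + c ^ 2 / (2 * X)) * GammaR X) with
      (plus (scal (1 / 2 + c ^ 2 / 2) (GammaR X))
       (plus (scal (c ^ 2 / 2 / X ^ 2) (GammaR (X + 1 + 1))) (scal (- c ^ 2 / X) (GammaR (X + 1))))).
    + pose proof (fun k x (Hx : 0 < x) => is_RInt_gen_scal (V := R_NormedModule) (wgt x) k _ (is_RInt_gen_wgt x Hx)) as HS.
      apply (is_RInt_gen_plus (V := R_NormedModule) (fun t => scal (1 / 2 + c ^ 2 / 2) (wgt X t))
        (fun t => plus (scal (c ^ 2 / 2 / X ^ 2) (wgt (X + 1 + 1) t)) (scal (- c ^ 2 / X) (wgt (X + 1) t))));
        [apply HS; lra|].
      apply (is_RInt_gen_plus (V := R_NormedModule) (fun t => scal (c ^ 2 / 2 / X ^ 2) (wgt (X + 1 + 1) t))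
        (fun t => scal (- c ^ 2 / X) (wgt (X + 1) t))); apply HS; lra.
    + rewrite !GammaR_succ by lra; unfold plus, scal; simpl; unfold mult; simpl; field; lra.
Qed.

(** A zero spreads to all w+n by the functional equation. Once X = Re w + n exceeds c^2, the
    concentration estimate reads Gamma(X) <= q Gamma(X) with q < 1, which contradicts positivity. *)
Lemma gam0_neq_0 (w : C) : 0 < fst w -> gam 0 w <> 0%C.
Proof.
  destruct w as [x y]; simpl; intros Hx H0.
  assert (Hn : forall n, gam 0 (x + INR n, y) = 0%C).
  { induction n as [|n IH].
    - simpl; rewrite Rplus_0_r; auto.
    - rewrite S_INR.
      replace ((x + (INR n + 1), y) : C) with (((x + INR n)%R, y) + 1)%C by (apply C_eq; simpl; ring).
      rewrite gam_succ, IH; [ring|]; simpl; pose proof (pos_INR n); lra. }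
  set (c := 6 * Rabs y + 4).
  assert (Hc0 : 0 < c) by (unfold c; pose proof (Rabs_pos y); lra).
  destruct (nfloor_ex (c ^ 2)) as [n [_ Hm]]; [apply pow2_ge_0|].
  set (X := x + INR (S n)).
  assert (HX : c ^ 2 < X) by (unfold X; rewrite S_INR; lra).
  assert (HX0 : 0 < X) by (pose proof (pow2_ge_0 c); lra).
  pose proof (gam0_concentration X y c HX0 eq_refl) as H.
  unfold X in H at 1; rewrite Hn in H.
  replace (0 * cpowR X (0, - y)%R - RtoC (GammaR X))%C with (- RtoC (GammaR X))%C in H by ring.
  pose proof (GammaR_pos X HX0) as HG.
  rewrite Cmod_opp, Cmod_R, Rabs_pos_eq in H by lra.
  assert (c ^ 2 / (2 * X) < 1 / 2).
  { apply Rmult_lt_reg_r with (2 * X); [lra|]. unfold Rdiv; rewrite Rmult_assoc, Rinv_l by lra; lra. }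
  nra.
Qed.

(** * Integrals over vertical lines and residues *)

(** Holomorphy with bounds that are uniform on the possibly unbounded set [D],
    so that integrals over vertical lines can be differentiated without any
    compactness argument. *)
Definition UQ (D : C -> Prop) (f f' : C -> C) : Prop :=
  exists r K, 0 < r /\ 0 <= K /\
    (forall s, D s -> Cmod (f s) <= K /\ Cmod (f' s) <= K) /\
    (forall s h, D s -> D (s + h)%C -> Cmod h <= r ->
       Cmod (f (s + h)%C - f s - h * f' s) <= K * Cmod h ^ 2).

Lemma UQ_sub (D E : C -> Prop) (f f' : C -> C) : (forall s, E s -> D s) -> UQ D f f' -> UQ E f f'.
Proof.
  intros HE [r [K [Hr [HK [Hb Hq]]]]]; exists r, K; repeat split; auto; apply Hb; auto.
Qed.

Lemma UQ_ext (D : C -> Prop) (f f' g g' : C -> C) :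
  (forall s, D s -> f s = g s) -> (forall s, D s -> f' s = g' s) -> UQ D f f' -> UQ D g g'.
Proof.
  intros H1 H2 [r [K [Hr [HK [Hb Hq]]]]]; exists r, K; repeat split; auto.
  - rewrite <- H1 by auto; apply Hb; auto.
  - rewrite <- H2 by auto; apply Hb; auto.
  - intros s h Hs Hsh Hh; rewrite <- !H1, <- H2 by auto; auto.
Qed.

Lemma UQ_const (D : C -> Prop) (c : C) : UQ D (fun _ => c) (fun _ => RtoC 0).
Proof.
  exists 1, (Cmod c); pose proof (Cmod_ge_0 c); repeat split; try lra.
  - rewrite Cmod_0; auto.
  - intros s h _ _ _; replace (c - c - h * 0)%C with (RtoC 0) by ring; rewrite Cmod_0.
    apply Rmult_le_pos; auto; apply pow2_ge_0.
Qed.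

Lemma UQ_plus (D : C -> Prop) (f f' g g' : C -> C) : UQ D f f' -> UQ D g g' ->
  UQ D (fun s => f s + g s)%C (fun s => f' s + g' s)%C.
Proof.
  intros [r [K [Hr [HK [Hb Hq]]]]] [r2 [K2 [Hr2 [HK2 [Hb2 Hq2]]]]].
  exists (Rmin r r2), (K + K2); split; [apply Rmin_pos; auto | split; [lra | split]].
  - intros s Hs; destruct (Hb s Hs), (Hb2 s Hs).
    split; (eapply Rle_trans; [apply Cmod_triangle | lra]).
  - intros s h Hs Hsh Hh.
    pose proof (Rmin_l r r2); pose proof (Rmin_r r r2).
    replace (f (s + h)%C + g (s + h)%C - (f s + g s) - h * (f' s + g' s))%C with
      ((f (s + h)%C - f s - h * f' s) + (g (s + h)%C - g s - h * g' s))%C by ring.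
    eapply Rle_trans; [apply Cmod_triangle|].
    specialize (Hq s h Hs Hsh ltac:(lra)); specialize (Hq2 s h Hs Hsh ltac:(lra)); lra.
Qed.

Lemma UQ_mult (D : C -> Prop) (f f' g g' : C -> C) : UQ D f f' -> UQ D g g' ->
  UQ D (fun s => f s * g s)%C (fun s => f' s * g s + f s * g' s)%C.
Proof.
  intros [r [K [Hr [HK [Hb Hq]]]]] [r2 [K2 [Hr2 [HK2 [Hb2 Hq2]]]]].
  (* The radius at most 1 turns |h|^2 into |h| in the increment of [g], which is then at most 2 K2
     |h|; the three error terms contribute 1 + 1 + 2 times K K2 |h|^2. *)
  exists (Rmin 1 (Rmin r r2)), (4 * (K * K2)); split; [|split; [|split]].
  - repeat apply Rmin_pos; auto; lra.
  - pose proof (Rmult_le_pos _ _ HK HK2); lra.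
  - intros s Hs; destruct (Hb s Hs) as [B1 B2], (Hb2 s Hs) as [B3 B4].
    pose proof (Rmult_le_pos _ _ HK HK2).
    split.
    + rewrite Cmod_mult. pose proof (Rmult_le_compat _ _ _ _ (Cmod_ge_0 _) (Cmod_ge_0 _) B1 B3); lra.
    + eapply Rle_trans; [apply Cmod_triangle|]; rewrite !Cmod_mult.
      pose proof (Rmult_le_compat _ _ _ _ (Cmod_ge_0 _) (Cmod_ge_0 _) B2 B3).
      pose proof (Rmult_le_compat _ _ _ _ (Cmod_ge_0 _) (Cmod_ge_0 _) B1 B4); lra.
  - intros s h Hs Hsh Hh.
    pose proof (Rmin_l r r2); pose proof (Rmin_r r r2).
    pose proof (Rmin_l 1 (Rmin r r2)); pose proof (Rmin_r 1 (Rmin r r2)).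
    replace (f (s + h)%C * g (s + h)%C - f s * g s - h * (f' s * g s + f s * g' s))%C with
      ((f (s + h)%C - f s - h * f' s) * g (s + h)%C + f s * (g (s + h)%C - g s - h * g' s)
       + h * f' s * ((g (s + h)%C - g s - h * g' s) + h * g' s))%C by ring.
    eapply Rle_trans; [apply Cmod_triangle|].
    eapply Rle_trans; [apply Rplus_le_compat; [apply Cmod_triangle | apply Rle_refl]|].
    specialize (Hq s h Hs Hsh ltac:(lra)); specialize (Hq2 s h Hs Hsh ltac:(lra)).
    destruct (Hb s Hs) as [B1 B2], (Hb2 s Hs) as [B3 B4], (Hb2 _ Hsh) as [B5 _].
    set (e1 := (f (s + h)%C - f s - h * f' s)%C) in *.
    set (e2 := (g (s + h)%C - g s - h * g' s)%C) in *.
    rewrite !Cmod_mult.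
    assert (H3 : Cmod (e2 + h * g' s) <= 2 * K2 * Cmod h).
    { eapply Rle_trans; [apply Cmod_triangle|]; rewrite Cmod_mult.
      pose proof (Cmod_ge_0 h). pose proof (Rmult_le_compat_l _ _ _ H3 B4).
      assert (K2 * Cmod h ^ 2 <= K2 * Cmod h) by (apply Rmult_le_compat_l; nra). lra. }
    pose proof (Rmult_le_compat _ _ _ _ (Cmod_ge_0 _) (Cmod_ge_0 _) Hq B5) as T1.
    pose proof (Rmult_le_compat _ _ _ _ (Cmod_ge_0 _) (Cmod_ge_0 _) B1 Hq2) as T2.
    assert (T3 : Cmod h * Cmod (f' s) * Cmod (e2 + h * g' s) <= Cmod h * K * (2 * K2 * Cmod h)).
    { pose proof (Cmod_ge_0 h); apply Rmult_le_compat; try apply Cmod_ge_0; auto.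
      - apply Rmult_le_pos; apply Cmod_ge_0.
      - apply Rmult_le_compat_l; auto. }
    nra.
Qed.

Lemma UQ_scal (D : C -> Prop) (c : C) (f f' : C -> C) : UQ D f f' ->
  UQ D (fun s => c * f s)%C (fun s => c * f' s)%C.
Proof.
  intros H; apply (UQ_ext D (fun s => c * f s)%C (fun s => 0 * f s + c * f' s)%C); auto.
  - intros; ring.
  - apply (UQ_mult D (fun _ => c)); auto; apply UQ_const.
Qed.

Lemma UQ_pow (D : C -> Prop) (f f' : C -> C) (n : nat) : UQ D f f' ->
  UQ D (fun s => f s ^ S n)%C (fun s => RtoC (INR (S n)) * f' s * f s ^ n)%C.
Proof.
  intros H; induction n as [|n IH].
  - apply (UQ_ext D f f'); auto; intros; simpl; ring.
  - apply (UQ_ext D (fun s => f s * f s ^ S n)%C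
      (fun s => f' s * f s ^ S n + f s * (RtoC (INR (S n)) * f' s * f s ^ n))%C).
    + intros; rewrite (Cpow_S _ (S n)); reflexivity.
    + intros; rewrite (S_INR (S n)), RtoC_plus, (Cpow_S _ n); ring.
    + apply UQ_mult; auto.
Qed.

(** The error is exactly h^2 (p-s)^(-2) (p-s-h)^(-1). The powers 1, 2 and 3 of 1/d bound the
    function, its derivative and this error. *)
Lemma UQ_inv (D : C -> Prop) (p : C) (d : R) : 0 < d -> (forall s, D s -> d <= Cmod (p - s)) ->
  UQ D (fun s => / (p - s))%C (fun s => (/ (p - s)) ^ 2)%C.
Proof.
  intros Hd HD.
  assert (Hnz : forall s, D s -> (p - s)%C <> 0%C).
  { intros s Hs H0; specialize (HD s Hs); rewrite H0, Cmod_0 in HD; lra. }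
  assert (Hi : forall s, D s -> 0 <= Cmod (/ (p - s)) <= / d).
  { intros s Hs; split; [apply Cmod_ge_0|].
    rewrite Cmod_inv by auto; apply Rinv_le_contravar; auto. }
  assert (Hd0 : 0 < / d) by (apply Rinv_0_lt_compat; auto).
  exists 1, (/ d + / d ^ 2 + / d ^ 3); rewrite <- !pow_inv; repeat split; try lra.
  - nra.
  - destruct (Hi s H); nra.
  - rewrite Cmod_pow; destruct (Hi s H); nra.
  - intros s h Hs Hsh _.
    assert (E : ((/ (p - (s + h)) - / (p - s) - h * (/ (p - s)) ^ 2) =
      h * h * ((/ (p - s)) ^ 2 * / (p - (s + h))))%C).
    { simpl; field; split; [apply (Hnz _ Hsh) | apply (Hnz _ Hs)]. }
    rewrite E, !Cmod_mult, Cmod_pow.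
    destruct (Hi s Hs) as [A1 A2], (Hi _ Hsh) as [A3 A4].
    set (u := Cmod (/ (p - s))) in *; set (w := Cmod (/ (p - (s + h)))) in *.
    assert (u ^ 2 * w <= (/ d) ^ 3).
    { replace ((/ d) ^ 3) with ((/ d) ^ 2 * / d) by ring.
      apply Rmult_le_compat; auto; [apply pow2_ge_0 | apply pow_incr; auto]. }
    pose proof (Cmod_ge_0 h).
    replace (Cmod h * Cmod h * (u ^ 2 * w)) with (u ^ 2 * w * Cmod h ^ 2) by ring.
    apply Rmult_le_compat_r; [apply pow2_ge_0 | nra].
Qed.

Lemma UQ_cpowR (D : C -> Prop) (z B : R) : (forall s, D s -> Rabs (fst s) <= B) ->
  UQ D (fun s => cpowR z (- s)) (fun s => - RtoC (ln z) * cpowR z (- s))%C.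
Proof.
  intros HD; set (L := Rabs (ln z)); assert (HL : 0 <= L) by apply Rabs_pos.
  set (E := exp (B * L)); assert (HE : 0 < E) by apply exp_pos.
  assert (Hb : forall s, D s -> Cmod (cpowR z (- s)) <= E).
  { intros s Hs; rewrite Cmod_cpowR; unfold Rpower; apply exp_le.
    apply Rle_trans with (Rabs (fst (- s)%C * ln z)); [apply Rle_abs|].
    rewrite Rabs_mult; apply Rmult_le_compat_r; auto.
    simpl; rewrite Rabs_Ropp; auto. }
  exists 1, (E * (1 + L + L ^ 2 * exp L)).
  assert (H0 : 0 <= L ^ 2 * exp L) by (apply Rmult_le_pos; [apply pow2_ge_0 | apply Rlt_le, exp_pos]).
  repeat split; try lra; try nra.
  - specialize (Hb s H); nra.
  - rewrite Cmod_mult, Cmod_opp, Cmod_R; fold L; specialize (Hb s H).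
    pose proof (Cmod_ge_0 (cpowR z (- s))); nra.
  - intros s h Hs Hsh Hh.
    replace (cpowR z (- (s + h)) - cpowR z (- s) - h * (- RtoC (ln z) * cpowR z (- s)))%C with
      (cpowR z (- s) * rexp 2 (- h * RtoC (ln z)))%C.
    2: { replace (- (s + h))%C with (- s + - h)%C by ring; rewrite cpowR_plus; simpl.
         unfold cpowR at 3. rewrite Rinv_1; ring. }
    rewrite Cmod_mult.
    eapply Rle_trans; [apply Rmult_le_compat; [apply Cmod_ge_0 | apply Cmod_ge_0 | apply Hb, Hs | apply Cmod_rexp_le]|].
    rewrite Cmod_mult, Cmod_opp, Cmod_R, Rpow_mult_distr; fold L.
    apply Rle_trans with (E * ((1 + L + L ^ 2 * exp L) * Cmod h ^ 2)); [|right; ring].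
    apply Rmult_le_compat_l; [lra|].
    assert (exp (Cmod h * L) <= exp L) by (apply exp_le; pose proof (Cmod_ge_0 h); nra).
    pose proof (pow2_ge_0 (Cmod h)) as P1; pose proof (pow2_ge_0 L) as P2.
    pose proof (Rmult_le_compat_l _ _ _ (Rmult_le_pos _ _ P1 P2) H).
    nra.
Qed.

Lemma UQ_gam0 (D : C -> Prop) (p a b : R) : 0 < a -> a <= b ->
  (forall s, D s -> a <= p - fst s <= b) ->
  UQ D (fun s => gam 0 (RtoC p - s)) (fun s => - gam 1 (RtoC p - s))%C.
Proof.
  intros Ha Hab HD.
  destruct (gam_bounded a b 0 Ha Hab) as [K0 [HK0 B0]].
  destruct (gam_bounded a b 1 Ha Hab) as [K1 [HK1 B1]].
  destruct (rgam_le a b 2 0 Ha Hab) as [K2 [HK2 B2]].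
  exists (a / 4), (K0 + K1 + K2); repeat split; try lra.
  - specialize (B0 (RtoC p - s)%C (HD s H)); lra.
  - rewrite Cmod_opp; specialize (B1 (RtoC p - s)%C (HD s H)); lra.
  - intros s h Hs Hsh Hh.
    specialize (B2 (RtoC p - s)%C (- h)%C (HD s Hs)); rewrite Cmod_opp in B2; specialize (B2 Hh).
    replace (gam 0 (RtoC p - (s + h)) - gam 0 (RtoC p - s) - h * - gam 1 (RtoC p - s))%C with
      (rgam 2 0 (RtoC p - s) (- h)).
    + eapply Rle_trans; [exact B2|]; apply Rmult_le_compat_r; [apply pow2_ge_0 | lra].
    + simpl; rewrite Rinv_1.
      replace (RtoC p - (s + h))%C with (RtoC p - s + - h)%C by ring; ring.
Qed.

(** The derivative is Lipschitz without a second derivative: the first-order expansions at s with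
    step h and at s+h with step -h are added, and the sum divided by |h|. *)
Lemma UQ_Lipschitz (D : C -> Prop) (f f' : C -> C) : UQ D f f' ->
  exists r K, 0 < r /\ 0 <= K /\ forall s h, D s -> D (s + h)%C -> Cmod h <= r ->
    Cmod (f (s + h)%C - f s) <= K * Cmod h /\ Cmod (f' (s + h)%C - f' s) <= K * Cmod h.
Proof.
  intros [r [K [Hr [HK [Hb Hq]]]]]; exists r, (K * r + 2 * K).
  assert (HKr : 0 <= K * r) by (apply Rmult_le_pos; lra).
  split; [auto | split; [lra|]]; intros s h Hs Hsh Hh.
  pose proof (Cmod_ge_0 h) as Hh0; pose proof (Hq s h Hs Hsh Hh) as Q1; split.
  - eapply Rle_trans; [apply (Cmod_triangle' _ (h * f' s))|]; rewrite Cmod_mult.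
    destruct (Hb s Hs) as [_ B]. pose proof (Rmult_le_compat_l _ _ _ Hh0 B).
    assert (K * Cmod h ^ 2 <= K * r * Cmod h) by (replace (K * Cmod h ^ 2) with (K * Cmod h * Cmod h) by ring;
      apply Rmult_le_compat_r; auto; apply Rmult_le_compat_l; auto).
    nra.
  - assert (Q2 : Cmod (f (s + h + - h)%C - f (s + h)%C - - h * f' (s + h)%C) <= K * Cmod h ^ 2).
    { rewrite <- (Cmod_opp h); apply Hq; auto; [|rewrite Cmod_opp; auto].
      replace (s + h + - h)%C with s by ring; auto. }
    replace (s + h + - h)%C with s in Q2 by ring.
    destruct (Req_dec (Cmod h) 0) as [H0|H0].
    { apply Cmod_eq_0 in H0; subst h; rewrite Cplus_0_r.
      replace (f' s - f' s)%C with (RtoC 0) by ring; rewrite Cmod_0; lra. }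
    apply Rmult_le_reg_l with (Cmod h); [lra|].
    rewrite <- Cmod_mult.
    replace (h * (f' (s + h)%C - f' s))%C with
      ((f (s + h)%C - f s - h * f' s) + (f s - f (s + h)%C - - h * f' (s + h)%C))%C by ring.
    eapply Rle_trans; [apply Cmod_triangle|]. nra.
Qed.

Lemma continuous_Lipschitz (g : R -> C) (x r K : R) : 0 < r -> 0 <= K ->
  (forall h, Rabs h <= r -> Cmod (g (x + h) - g x) <= K * Rabs h) ->
  continuous (U := C_R_NormedModule) g x.
Proof.
  intros Hr HK Hg; apply filterlim_Cmod; [apply _|].
  intros P [e He].
  assert (Hd : 0 < Rmin r (e / (K + 1))).
  { apply Rmin_pos; auto; apply Rdiv_lt_0_compat; [apply cond_pos | lra]. }
  exists (mkposreal _ Hd); intros y Hy; change (Rabs (y - x) < Rmin r (e / (K + 1))) in Hy.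
  apply He; change (Rabs (Cmod (g y - g x) - 0) < e).
  rewrite Rminus_0_r, Rabs_pos_eq by apply Cmod_ge_0.
  specialize (Hg (y - x)). assert (E : forall u v : R, u + (v - u) = v) by (intros; ring); rewrite E in Hg.
  pose proof (Rmin_l r (e / (K + 1))); pose proof (Rmin_r r (e / (K + 1))).
  eapply Rle_lt_trans; [apply Hg; lra|].
  assert (Rabs (y - x) * (K + 1) < e).
  { apply Rlt_le_trans with (e / (K + 1) * (K + 1)); [apply Rmult_lt_compat_r; lra|].
    right; field; lra. }
  pose proof (Rabs_pos (y - x)); nra.
Qed.

Lemma Cmod_vert (h : R) : Cmod (0, h) = Rabs h.
Proof. rewrite Cmod_pair; replace (0 ^ 2 + h ^ 2) with (Rsqr h) by (unfold Rsqr; ring); apply sqrt_Rsqr_abs. Qed.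

Lemma UQ_continuous_vert (D : C -> Prop) (f f' : C -> C) (x : R) : UQ D f f' -> (forall y, D (x, y)) ->
  (forall y, continuous (U := C_R_NormedModule) (fun y => f (x, y)) y) /\
  (forall y, continuous (U := C_R_NormedModule) (fun y => f' (x, y)) y).
Proof.
  intros H HD; destruct (UQ_Lipschitz D f f' H) as [r [K [Hr [HK HL]]]].
  assert (E : forall y h, ((x, y + h)%R : C) = ((x, y) + (0%R, h))%C) by (intros; apply C_eq; simpl; ring).
  split; intros y; apply (continuous_Lipschitz _ y r K); auto; intros h Hh;
    rewrite E, <- (Cmod_vert h); apply HL; rewrite <- ?E; auto; rewrite Cmod_vert; auto.
Qed.

(** Parametrised by the ordinate, without the factor i of ds; crossing a pole to the right therefore
    adds 2 pi times the residue. *)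
Definition vseg (f : C -> C) (x Y : R) : C :=
  RInt (V := C_R_CompleteNormedModule) (fun y => f (x, y)) (- Y) Y.

Lemma vseg_correct (D : C -> Prop) (f f' : C -> C) (x Y : R) : UQ D f f' -> (forall y, D (x, y)) ->
  is_RInt (V := C_R_NormedModule) (fun y => f (x, y)) (- Y) Y (vseg f x Y).
Proof.
  intros H HD; apply (RInt_correct (V := C_R_CompleteNormedModule)).
  apply (ex_RInt_continuous (V := C_R_CompleteNormedModule)); intros y _.
  apply (UQ_continuous_vert D f f' x H HD).
Qed.

(** Along a vertical line the derivative of f in y is i f', so -i f is a primitive of f'. *)
Lemma is_RInt_vert (D : C -> Prop) (f f' : C -> C) (x Y : R) : UQ D f f' -> (forall y, D (x, y)) ->
  is_RInt (V := C_R_NormedModule) (fun y => f' (x, y)) (- Y) Y (- Ci * (f (x, Y) - f (x, (- Y)%R)))%C.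
Proof.
  intros H HD.
  destruct (UQ_continuous_vert D f f' x H HD) as [_ Hc].
  apply (is_RInt_ext (V := C_R_NormedModule) (fun y => - Ci * (Ci * f' (x, y)))%C).
  { intros y _; ceq. replace (- Ci * (Ci * f' (x, y)))%C with (- (Ci * Ci) * f' (x, y))%C by ring.
    replace (Ci * Ci)%C with (- RtoC 1)%C by (apply C_eq; simpl; ring). ring. }
  apply is_RInt_Cscal.
  apply (is_RInt_derive (V := C_R_CompleteNormedModule) (fun y => f (x, y)) (fun y => Ci * f' (x, y))%C).
  - intros y _; destruct H as [r [K [Hr [HK [Hb Hq]]]]].
    apply (is_derive_quad C_R_NormedModule _ y _ K r); auto; intros h Hh.
    rewrite norm_Cmod, scal_C.
    assert (E : ((x, y + h)%R : C) = ((x, y) + (0%R, h))%C) by (apply C_eq; simpl; ring).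
    rewrite <- (Cmod_vert h) in Hh. specialize (Hq (x, y) (0%R, h) (HD y)); rewrite <- E in Hq.
    specialize (Hq (HD _) Hh). rewrite Cmod_vert, pow2_abs in Hq.
    eapply Rle_trans; [right | exact Hq]; f_equal.
    replace ((0%R, h) : C) with (RtoC h * Ci)%C by (apply C_eq; simpl; ring).
    transitivity (f (x, (y + h)%R) - f (x, y) - RtoC h * (Ci * f' (x, y)))%C; [reflexivity | ceq; ring].
  - intros y _; apply continuous_Cmult; [apply (continuous_const (U := R_UniformSpace) (V := C_R_NormedModule)) | apply Hc].
Qed.

Lemma is_derive_vseg (al be : R) (f f' : C -> C) (x Y : R) : 0 <= Y ->
  UQ (fun s => al < fst s < be) f f' -> al < x < be ->
  is_derive (V := C_R_NormedModule) (fun x => vseg f x Y) x (vseg f' x Y).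
Proof.
  intros HY H Hx.
  assert (I0 : forall x, al < x < be ->
    is_RInt (V := C_R_NormedModule) (fun y => f (x, y)) (- Y) Y (vseg f x Y)).
  { intros u Hu; apply (vseg_correct _ f f' u Y H); auto. }
  assert (I1 : is_RInt (V := C_R_NormedModule) (fun y => f' (x, y)) (- Y) Y (vseg f' x Y)).
  { apply (RInt_correct (V := C_R_CompleteNormedModule)).
    apply (ex_RInt_continuous (V := C_R_CompleteNormedModule)); intros y _.
    apply (UQ_continuous_vert _ f f' x H); auto. }
  destruct H as [r [K [Hr [HK [Hb Hq]]]]].
  apply (is_derive_quad C_R_NormedModule _ x _ (2 * Y * K) (Rmin r (Rmin ((x - al) / 2) ((be - x) / 2)))).
  { repeat apply Rmin_pos; auto; lra. }
  intros h Hh.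
  pose proof (Rmin_l r (Rmin ((x - al) / 2) ((be - x) / 2))).
  pose proof (Rmin_r r (Rmin ((x - al) / 2) ((be - x) / 2))).
  pose proof (Rmin_l ((x - al) / 2) ((be - x) / 2)).
  pose proof (Rmin_r ((x - al) / 2) ((be - x) / 2)).
  assert (Hxh : al < x + h < be).
  { assert (Rabs h <= (x - al) / 2) by lra. assert (Rabs h <= (be - x) / 2) by lra.
    apply Rabs_le_between in H3; apply Rabs_le_between in H4; lra. }
  replace (2 * Y * K * h ^ 2) with ((Y - - Y) * (K * h ^ 2)) by ring.
  apply (norm_RInt_le_const (V := C_R_NormedModule)
    (fun y => minus (minus (f ((x + h)%R, y)) (f (x, y))) (scal h (f' (x, y))))); [lra| |].
  - intros y _; rewrite norm_Cmod, scal_C.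
    assert (E : ((x + h, y)%R : C) = ((x, y) + RtoC h)%C) by (apply C_eq; simpl; ring).
    specialize (Hq (x, y) (RtoC h)); rewrite <- E, Cmod_R, pow2_abs in Hq.
    apply Hq; simpl; auto; lra.
  - apply (is_RInt_minus (V := C_R_NormedModule) (fun y => minus (f ((x + h)%R, y)) (f (x, y)))).
    + apply (is_RInt_minus (V := C_R_NormedModule) (fun y => f ((x + h)%R, y))); apply I0; auto.
    + apply (is_RInt_scal (V := C_R_NormedModule)), I1.
Qed.

(** The derivative of the segment integral in x is the segment integral of f', which reduces to -i
    times the difference of the endpoint values of f. Integrated over [a,b], this is Cauchy's
    theorem on a rectangle, with the horizontal sides estimated by [M]. *)
Lemma vseg_variation (al be a b Y M : R) (f f' : C -> C) : 0 <= Y ->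
  UQ (fun s => al < fst s < be) f f' -> al < a -> a <= b -> b < be ->
  (forall x, a <= x <= b -> Cmod (f (x, Y) - f (x, (- Y)%R)) <= M) ->
  Cmod (vseg f b Y - vseg f a Y) <= (b - a) * M.
Proof.
  intros HY H Ha Hab Hb HM.
  assert (E : forall x, al < x < be -> vseg f' x Y = (- Ci * (f (x, Y) - f (x, (- Y)%R)))%C).
  { intros x Hx; apply (is_RInt_unique (V := C_R_CompleteNormedModule)).
    apply (is_RInt_vert _ f f' x Y H); auto. }
  rewrite <- norm_Cmod.
  apply (norm_RInt_le_const (V := C_R_NormedModule) (fun x => vseg f' x Y) a b); auto.
  - intros x Hx; rewrite norm_Cmod, E, Cmod_mult, Cmod_opp, Cmod_Ci, Rmult_1_l by lra; auto.
  - apply (is_RInt_derive (V := C_R_CompleteNormedModule) (fun x => vseg f x Y));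
      rewrite Rmin_left, Rmax_right by auto; intros x Hx.
    + apply (is_derive_vseg al be f f' x Y); auto; lra.
    + destruct (UQ_Lipschitz _ f f' H) as [r [K [Hr [HK HL]]]].
      assert (Hc : forall y, continuous (U := C_R_NormedModule) (fun x => f (x, y)) x).
      { intros y; apply (continuous_Lipschitz _ x (Rmin r (Rmin ((x - al) / 2) ((be - x) / 2))) K); auto.
        { repeat apply Rmin_pos; auto; lra. }
        intros h Hh.
        pose proof (Rmin_l r (Rmin ((x - al) / 2) ((be - x) / 2))).
        pose proof (Rmin_r r (Rmin ((x - al) / 2) ((be - x) / 2))).
        pose proof (Rmin_l ((x - al) / 2) ((be - x) / 2)).
        pose proof (Rmin_r ((x - al) / 2) ((be - x) / 2)).
        assert (E1 : ((x + h, y)%R : C) = ((x, y) + RtoC h)%C) by (apply C_eq; simpl; ring).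
        change (Cmod (f ((x + h)%R, y) - f (x, y))%C <= K * Rabs h).
        rewrite E1, <- (Cmod_R h); apply HL; simpl; [lra | | rewrite Cmod_R; lra].
        assert (H4 : Rabs h <= (x - al) / 2) by lra. assert (H5 : Rabs h <= (be - x) / 2) by lra.
        apply Rabs_le_between in H4; apply Rabs_le_between in H5; lra. }
      (* The endpoint formula holds inside the strip only, hence a local replacement. *)
      apply (continuous_ext_loc (U := C_R_NormedModule) _ (fun x => - Ci * (f (x, Y) - f (x, (- Y)%R)))%C).
      * assert (Hd : 0 < Rmin (x - al) (be - x)) by (apply Rmin_pos; lra).
        exists (mkposreal _ Hd); intros t Ht; change (Rabs (t - x) < Rmin (x - al) (be - x)) in Ht.
        pose proof (Rmin_l (x - al) (be - x)); pose proof (Rmin_r (x - al) (be - x)).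
        apply Rabs_def2 in Ht; symmetry; apply E; lra.
      * apply continuous_Cmult; [apply (continuous_const (U := R_UniformSpace) (V := C_R_NormedModule))|].
        apply (continuous_minus (V := C_R_NormedModule) (fun x => f (x, Y)) (fun x => f (x, (- Y)%R))); apply Hc.
Qed.

(** * Punctured strips and the contribution of a pole *)

Definition punctured (al be x0 d : R) (s : C) : Prop :=
  al < fst s < be /\ d < Cmod (s - RtoC x0).

(** One derivative serves every radius [d], while the bounds inside [UQ] may blow up as [d] tends to
    0. *)
Definition holo_punctured (al be x0 : R) (F : C -> C) : Prop :=
  exists F', forall d, 0 < d -> UQ (punctured al be x0 d) F F'.

Lemma punctured_line (al be x0 x : R) : al < x < be -> x <> x0 ->
  exists d, 0 < d /\ forall y, punctured al be x0 d (x, y).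
Proof.
  intros Hx Hn; exists (Rabs (x - x0) / 2).
  assert (0 < Rabs (x - x0)) by (apply Rabs_pos_lt; lra).
  split; [lra | intros y; split; auto].
  apply Rlt_le_trans with (Rabs (x - x0)); [lra|].
  apply (Re_le_Cmod ((x, y) - RtoC x0)).
Qed.

Lemma vseg_holo (al be x0 x Y : R) (F : C -> C) : holo_punctured al be x0 F ->
  al < x < be -> x <> x0 ->
  is_RInt (V := C_R_NormedModule) (fun y => F (x, y)) (- Y) Y (vseg F x Y) /\
  (forall y, continuous (U := C_R_NormedModule) (fun y => F (x, y)) y).
Proof.
  intros [F' HF] Hx Hn; destruct (punctured_line al be x0 x Hx Hn) as [d [Hd HD]].
  split; [apply (vseg_correct _ F F' x Y (HF d Hd)); auto|].
  apply (UQ_continuous_vert _ F F' x (HF d Hd)); auto.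
Qed.

(** A bounded singularity does not contribute: the line [Re s = x0] is
    bypassed by two lines at distance [ep], close to each other away from the
    singularity. *)
Lemma vseg_variation_bounded (al be a b x0 Y M rho M0 : R) (F : C -> C) :
  al < a -> a < x0 -> x0 < b -> b < be -> 0 < Y -> holo_punctured al be x0 F ->
  0 < rho -> (forall v, 0 < Cmod v < rho -> Cmod (F (RtoC x0 - v)%C) <= M0) ->
  (forall x, a <= x <= b -> Cmod (F (x, Y) - F (x, (- Y)%R)) <= M) ->
  Cmod (vseg F b Y - vseg F a Y) <= (b - a) * M.
Proof.
  intros Ha Hax Hxb Hb HY HF Hrho HM0 HM.
  assert (HMpos : 0 <= M) by (eapply Rle_trans; [apply Cmod_ge_0 | apply (HM a); lra]).
  assert (HM0pos : 0 <= M0).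
  { eapply Rle_trans; [apply Cmod_ge_0 | apply (HM0 (RtoC (rho / 2)))].
    rewrite Cmod_R, Rabs_pos_eq; lra. }
  apply le_epsilon; intros eta Heta.
  (* [de] is the half-height of the part near the singularity, where the two lines differ by at most
     2 [M0]; that part contributes 4 [de] [M0] <= eta/4. *)
  set (de := Rmin (rho / 4) (Rmin (Y / 2) (eta / (16 * (M0 + 1))))).
  assert (Hde : 0 < de).
  { repeat apply Rmin_pos; try lra; apply Rdiv_lt_0_compat; lra. }
  assert (Hde1 : de <= rho / 4) by apply Rmin_l.
  assert (Hde2 : de <= Y / 2) by (eapply Rle_trans; [apply Rmin_r | apply Rmin_l]).
  assert (Hde3 : de * (16 * (M0 + 1)) <= eta).
  { apply Rle_trans with (eta / (16 * (M0 + 1)) * (16 * (M0 + 1))).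
    - apply Rmult_le_compat_r; [lra|]. eapply Rle_trans; [apply Rmin_r | apply Rmin_r].
    - right; field; lra. }
  pose proof HF as [F' HF'].
  destruct (UQ_Lipschitz _ F F' (HF' (de / 2) ltac:(lra))) as [r [L [Hr [HL HLip]]]].
  (* [ep] is chosen after [de] because the Lipschitz constant [L] is that of the region at distance
     more than [de]/2. The parts away from the singularity contribute at most 4 Y [ep] [L] <=
     eta/2. *)
  set (ep := Rmin de (Rmin (r / 2) (Rmin ((x0 - a) / 2) (Rmin ((b - x0) / 2) (eta / (8 * Y * (L + 1))))))).
  assert (HYL : 0 < 8 * Y * (L + 1)) by nra.
  assert (Hep : 0 < ep).
  { repeat apply Rmin_pos; try lra; apply Rdiv_lt_0_compat; lra. }
  assert (Hep1 : ep <= de) by apply Rmin_l.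
  assert (Hep2 : ep <= r / 2) by (eapply Rle_trans; [apply Rmin_r | apply Rmin_l]).
  assert (Hep3 : ep <= (x0 - a) / 2).
  { eapply Rle_trans; [apply Rmin_r|]. eapply Rle_trans; [apply Rmin_r | apply Rmin_l]. }
  assert (Hep4 : ep <= (b - x0) / 2).
  { eapply Rle_trans; [apply Rmin_r|]. eapply Rle_trans; [apply Rmin_r|].
    eapply Rle_trans; [apply Rmin_r | apply Rmin_l]. }
  assert (Hep5 : ep * (8 * Y * (L + 1)) <= eta).
  { apply Rle_trans with (eta / (8 * Y * (L + 1)) * (8 * Y * (L + 1))).
    - apply Rmult_le_compat_r; [lra|]. eapply Rle_trans; [apply Rmin_r|].
      eapply Rle_trans; [apply Rmin_r|]. eapply Rle_trans; [apply Rmin_r | apply Rmin_r].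
    - right; field; nra. }
  clearbody de ep.
  assert (V1 : Cmod (vseg F (x0 - ep) Y - vseg F a Y) <= (x0 - ep - a) * M).
  { apply (vseg_variation al (x0 - ep / 2) a (x0 - ep) Y M F F'); try lra.
    - apply UQ_sub with (2 := HF' (ep / 4) ltac:(lra)); intros s Hs; split; [lra|].
      apply Rlt_le_trans with (Rabs (fst s - x0)); [|apply (Re_le_Cmod (s - RtoC x0))].
      rewrite Rabs_left; lra.
    - intros x Hx; apply HM; lra. }
  assert (V2 : Cmod (vseg F b Y - vseg F (x0 + ep) Y) <= (b - (x0 + ep)) * M).
  { apply (vseg_variation (x0 + ep / 2) be (x0 + ep) b Y M F F'); try lra.
    - apply UQ_sub with (2 := HF' (ep / 4) ltac:(lra)); intros s Hs; split; [lra|].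
      apply Rlt_le_trans with (Rabs (fst s - x0)); [|apply (Re_le_Cmod (s - RtoC x0))].
      rewrite Rabs_pos_eq; lra.
    - intros x Hx; apply HM; lra. }
  assert (V3 : Cmod (vseg F (x0 + ep) Y - vseg F (x0 - ep) Y) <= eta).
  { destruct (vseg_holo al be x0 (x0 + ep) Y F HF ltac:(lra) ltac:(lra)) as [I1 C1].
    destruct (vseg_holo al be x0 (x0 - ep) Y F HF ltac:(lra) ltac:(lra)) as [I2 C2].
    pose proof (is_RInt_minus (V := C_R_NormedModule) _ _ _ _ _ _ I1 I2) as I3.
    set (g := fun y : R => (F ((x0 + ep)%R, y) - F ((x0 - ep)%R, y))%C).
    change (is_RInt (V := C_R_NormedModule) g (- Y) Y (vseg F (x0 + ep) Y - vseg F (x0 - ep) Y)%C) in I3.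
    assert (Cg : forall u v, ex_RInt (V := C_R_NormedModule) g u v).
    { intros u v; apply (ex_RInt_continuous (V := C_R_CompleteNormedModule)); intros y _.
      apply (continuous_minus (V := C_R_NormedModule) (fun y => F ((x0 + ep)%R, y)) (fun y => F ((x0 - ep)%R, y))); auto. }
    assert (Far : forall y, de <= Rabs y -> Cmod (g y) <= 2 * ep * L).
    { intros y Hy; unfold g.
      assert (E : (((x0 + ep)%R, y) : C) = (((x0 - ep)%R, y) + RtoC (2 * ep))%C) by (apply C_eq; simpl; ring).
      assert (P : forall u, al < u < be -> punctured al be x0 (de / 2) (u, y)).
      { intros u Hu; split; auto. apply Rlt_le_trans with (Rabs y); [lra|].
        pose proof (Im_le_Cmod ((u, y) - RtoC x0)%C) as Hi; simpl in Hi.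
        replace (y + - 0) with y in Hi by ring; exact Hi. }
      destruct (HLip ((x0 - ep)%R, y) (RtoC (2 * ep))) as [HL1 _].
      - apply P; lra.
      - rewrite <- E; apply P; lra.
      - rewrite Cmod_R, Rabs_pos_eq; lra.
      - rewrite <- E, Cmod_R, Rabs_pos_eq in HL1 by lra; lra. }
    assert (Near : forall y, Rabs y <= de -> Cmod (g y) <= 2 * M0).
    { intros y Hy; unfold g; eapply Rle_trans; [apply Cmod_minus_le|].
      assert (P : forall u, Rabs u = ep -> Cmod (F ((x0 + u)%R, y)) <= M0).
      { intros u Hu.
        replace (((x0 + u)%R, y) : C) with (RtoC x0 - ((- u)%R, (- y)%R))%C by (apply C_eq; simpl; ring).
        apply HM0; split.
        - apply Rlt_le_trans with (Rabs (- u)); [rewrite Rabs_Ropp; lra | apply (Re_le_Cmod ((- u)%R, (- y)%R))].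
        - eapply Rle_lt_trans; [apply Cmod_le_abs|]; rewrite !Rabs_Ropp; lra. }
      pose proof (P ep (Rabs_pos_eq ep ltac:(lra))) as P1.
      pose proof (P (- ep) ltac:(rewrite Rabs_left; lra)) as P2.
      change ((x0 + - ep)%R) with ((x0 - ep)%R) in P2; lra. }
    assert (N1 : Cmod (RInt (V := C_R_CompleteNormedModule) g (- Y) (- de)) <= (- de - - Y) * (2 * ep * L)).
    { rewrite <- norm_Cmod; apply (norm_RInt_le_const (V := C_R_NormedModule) g); [lra| |apply (RInt_correct (V := C_R_CompleteNormedModule)); auto].
      intros y Hy; rewrite norm_Cmod; apply Far; rewrite Rabs_left; lra. }
    assert (N2 : Cmod (RInt (V := C_R_CompleteNormedModule) g (- de) de) <= (de - - de) * (2 * M0)).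
    { rewrite <- norm_Cmod; apply (norm_RInt_le_const (V := C_R_NormedModule) g); [lra| |apply (RInt_correct (V := C_R_CompleteNormedModule)); auto].
      intros y Hy; rewrite norm_Cmod; apply Near, Rabs_le; lra. }
    assert (N3 : Cmod (RInt (V := C_R_CompleteNormedModule) g de Y) <= (Y - de) * (2 * ep * L)).
    { rewrite <- norm_Cmod; apply (norm_RInt_le_const (V := C_R_NormedModule) g); [lra| |apply (RInt_correct (V := C_R_CompleteNormedModule)); auto].
      intros y Hy; rewrite norm_Cmod; apply Far; rewrite Rabs_pos_eq; lra. }
    apply (is_RInt_unique (V := C_R_CompleteNormedModule)) in I3; rewrite <- I3.
    rewrite <- (RInt_Chasles (V := C_R_CompleteNormedModule) g (- Y) (- de) Y) by auto.
    rewrite <- (RInt_Chasles (V := C_R_CompleteNormedModule) g (- de) de Y) by auto.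
    eapply Rle_trans; [apply Cmod_triangle|].
    eapply Rle_trans; [apply Rplus_le_compat_l, Cmod_triangle|].
    pose proof (Rmult_le_pos _ _ (Rlt_le _ _ Hep) HL).
    nra. }
  replace (vseg F b Y - vseg F a Y)%C with ((vseg F b Y - vseg F (x0 + ep) Y) +
    ((vseg F (x0 + ep) Y - vseg F (x0 - ep) Y) + (vseg F (x0 - ep) Y - vseg F a Y)))%C by ring.
  eapply Rle_trans; [apply Cmod_triangle|].
  eapply Rle_trans; [apply Rplus_le_compat_l, Cmod_triangle|]. nra.
Qed.

(** [vshift F a b r] : moving the line of integration from [Re s = a] to
    [Re s = b] increases the principal value of the integral by [r]. *)
Definition vshift (F : C -> C) (a b : R) (r : C) : Prop :=
  forall e, 0 < e -> exists Y0, 0 < Y0 /\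
    forall Y, Y0 <= Y -> Cmod (vseg F b Y - vseg F a Y - r) <= e.

Definition vanishing (F : C -> C) (a b : R) : Prop :=
  forall e, 0 < e -> exists Y0, 0 < Y0 /\ forall Y, Y0 <= Y -> forall x, a <= x <= b ->
    Cmod (F (x, Y)) <= e /\ Cmod (F (x, (- Y)%R)) <= e.

Lemma vshift_bounded (al be a b x0 rho M0 : R) (F : C -> C) :
  al < a -> a < x0 -> x0 < b -> b < be -> holo_punctured al be x0 F -> vanishing F a b ->
  0 < rho -> (forall v, 0 < Cmod v < rho -> Cmod (F (RtoC x0 - v)%C) <= M0) ->
  vshift F a b 0.
Proof.
  intros Ha Hax Hxb Hb HF HV Hrho HM0 e He.
  destruct (HV (e / (2 * (b - a)))) as [Y0 [HY0 HV0]]; [apply Rdiv_lt_0_compat; lra|].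
  exists Y0; split; auto; intros Y HY.
  replace (vseg F b Y - vseg F a Y - 0)%C with (vseg F b Y - vseg F a Y)%C by ring.
  replace e with ((b - a) * (e / (b - a))) by (field; lra).
  apply (vseg_variation_bounded al be a b x0 Y _ rho M0); auto; try lra.
  intros x Hx; destruct (HV0 Y HY x Hx).
  eapply Rle_trans; [apply Cmod_minus_le|].
  replace (e / (b - a)) with (e / (2 * (b - a)) + e / (2 * (b - a))) by (field; lra); lra.
Qed.

Lemma vshift_plus (al be a b x0 : R) (F G : C -> C) (r q : C) :
  al < a -> a < x0 -> x0 < b -> b < be -> holo_punctured al be x0 F -> holo_punctured al be x0 G ->
  vshift F a b r -> vshift G a b q -> vshift (fun s => F s + G s)%C a b (r + q)%C.
Proof.
  intros Ha Hax Hxb Hb HF HG SF SG e He.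
  destruct (SF (e / 2)) as [Y1 [HY1 H1]]; [lra|]. destruct (SG (e / 2)) as [Y2 [HY2 H2]]; [lra|].
  exists (Rmax Y1 Y2); split; [apply Rlt_le_trans with (1 := HY1), Rmax_l|]; intros Y HY.
  assert (E : forall x, al < x < be -> x <> x0 ->
    vseg (fun s => F s + G s)%C x Y = (vseg F x Y + vseg G x Y)%C).
  { intros x Hx Hn; apply (is_RInt_unique (V := C_R_CompleteNormedModule)).
    exact (is_RInt_plus (V := C_R_NormedModule) _ _ _ _ _ _
      (proj1 (vseg_holo al be x0 x Y F HF Hx Hn)) (proj1 (vseg_holo al be x0 x Y G HG Hx Hn))). }
  rewrite !E by lra.
  pose proof (Rmax_l Y1 Y2); pose proof (Rmax_r Y1 Y2).
  specialize (H1 Y ltac:(lra)); specialize (H2 Y ltac:(lra)).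
  replace (vseg F b Y + vseg G b Y - (vseg F a Y + vseg G a Y) - (r + q))%C with
    ((vseg F b Y - vseg F a Y - r) + (vseg G b Y - vseg G a Y - q))%C by ring.
  eapply Rle_trans; [apply Cmod_triangle | lra].
Qed.

(** The variable x0 - s is the v of the expansions; for m = 1 the residue in s is -c. *)
Definition pole (c : C) (x0 : R) (m : nat) (s : C) : C := (c * (/ (RtoC x0 - s)) ^ m)%C.

Lemma holo_pole (al be x0 : R) (c : C) (m : nat) : holo_punctured al be x0 (pole c x0 (S m)).
Proof.
  exists (fun s => c * (RtoC (INR (S m)) * (/ (RtoC x0 - s)) ^ 2 * (/ (RtoC x0 - s)) ^ m))%C.
  intros d Hd; apply UQ_scal, UQ_pow, (UQ_inv _ _ d Hd).
  intros s [_ Hs]; rewrite Cmod_minus_sym; lra.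
Qed.

Lemma Cmod_inv_vert (x0 x y Y : R) : 0 < Y -> Rabs y = Y -> Cmod (/ (RtoC x0 - (x, y))) <= / Y.
Proof.
  intros HY Hy.
  assert (H : Y <= Cmod (RtoC x0 - (x, y))).
  { pose proof (Im_le_Cmod (RtoC x0 - (x, y))) as H; simpl in H.
    replace (0 + - y) with (- y) in H by ring; rewrite Rabs_Ropp in H; lra. }
  rewrite Cmod_inv; [apply Rinv_le_contravar; auto|].
  intros H0; rewrite H0, Cmod_0 in H; lra.
Qed.

Lemma Cmod_pole_vert (x0 x y Y : R) (c : C) (m : nat) : 1 <= Y -> Rabs y = Y ->
  Cmod (pole c x0 (S m) (x, y)) <= Cmod c * / Y.
Proof.
  intros HY Hy; unfold pole; rewrite Cmod_mult, Cmod_pow.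
  apply Rmult_le_compat_l; [apply Cmod_ge_0|].
  pose proof (Cmod_inv_vert x0 x y Y ltac:(lra) Hy) as H.
  pose proof (Cmod_ge_0 (/ (RtoC x0 - (x, y)))).
  assert (/ Y <= 1) by (rewrite <- Rinv_1; apply Rinv_le_contravar; lra).
  simpl; rewrite <- (Rmult_1_r (/ Y)); apply Rmult_le_compat; auto.
  - apply pow_le; auto.
  - rewrite <- (pow1 m); apply pow_incr; lra.
Qed.

Lemma vanishing_pole (a b x0 : R) (c : C) (m : nat) : vanishing (pole c x0 (S m)) a b.
Proof.
  intros e He; pose proof (Cmod_ge_0 c) as Hc.
  exists (Rmax 1 (Cmod c / e)); split; [apply Rlt_le_trans with (1 := Rlt_0_1), Rmax_l|].
  intros Y HY x _.
  pose proof (Rmax_l 1 (Cmod c / e)); pose proof (Rmax_r 1 (Cmod c / e)).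
  assert (Cmod c * / Y <= e).
  { apply Rmult_le_reg_r with Y; [lra|]; rewrite Rmult_assoc, Rinv_l, Rmult_1_r by lra.
    apply Rle_trans with (e * (Cmod c / e)); [right; field; lra | apply Rmult_le_compat_l; lra]. }
  split; (eapply Rle_trans; [apply (Cmod_pole_vert _ _ _ Y)|]); auto; try lra.
  - apply Rabs_pos_eq; lra.
  - rewrite Rabs_Ropp; apply Rabs_pos_eq; lra.
Qed.

(** A pole of order at least 2 has the pole of the previous order, up to the factor 1/(m+1), as
    primitive. The integral over each line reduces to endpoint values, which are O(1/Y). *)
Lemma vshift_higher_pole (a b x0 : R) (c : C) (m : nat) : a < x0 -> x0 < b ->
  vshift (pole c x0 (S (S m))) a b 0.
Proof.
  intros Ha Hb e He; pose proof (Cmod_ge_0 c) as Hc.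
  exists (Rmax 1 (4 * Cmod c / e)); split; [apply Rlt_le_trans with (1 := Rlt_0_1), Rmax_l|].
  intros Y HY.
  pose proof (Rmax_l 1 (4 * Cmod c / e)); pose proof (Rmax_r 1 (4 * Cmod c / e)).
  assert (HcY : 4 * (Cmod c * / Y) <= e).
  { apply Rmult_le_reg_r with Y; [lra|].
    replace (4 * (Cmod c * / Y) * Y) with (4 * Cmod c) by (field; lra).
    apply Rle_trans with (e * (4 * Cmod c / e)); [right; field; lra | apply Rmult_le_compat_l; lra]. }
  set (k := RtoC (/ INR (S m))).
  assert (Hk : Cmod k <= 1).
  { unfold k; rewrite Cmod_R, Rabs_pos_eq.
    - rewrite <- Rinv_1; apply Rinv_le_contravar; [lra|]. rewrite S_INR; pose proof (pos_INR m); lra.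
    - apply Rlt_le, Rinv_0_lt_compat, lt_0_INR; lia. }
  assert (E : forall x, x <> x0 -> vseg (pole c x0 (S (S m))) x Y =
    (k * (- Ci * (pole c x0 (S m) (x, Y) - pole c x0 (S m) (x, (- Y)%R))))%C).
  { intros x Hx; apply (is_RInt_unique (V := C_R_CompleteNormedModule)).
    apply (is_RInt_ext (V := C_R_NormedModule) (fun y => k * (c * (RtoC (INR (S m)) * (/ (RtoC x0 - (x, y))) ^ 2 * (/ (RtoC x0 - (x, y))) ^ m)))%C).
    { intros y _; ceq. unfold pole.
      replace ((/ (RtoC x0 - (x, y))) ^ S (S m))%C with ((/ (RtoC x0 - (x, y))) ^ 2 * (/ (RtoC x0 - (x, y))) ^ m)%C
        by (rewrite <- Cpow_add_r; reflexivity).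
      assert (Ek : (k * RtoC (INR (S m)) = 1)%C).
      { unfold k; rewrite <- RtoC_mult; f_equal; apply Rinv_l, not_0_INR; lia. }
      transitivity ((k * RtoC (INR (S m))) * (c * ((/ (RtoC x0 - (x, y))) ^ 2 * (/ (RtoC x0 - (x, y))) ^ m)))%C; [ring|].
      rewrite Ek; ring. }
    apply is_RInt_Cscal.
    destruct (punctured_line (x - 1) (x + 1) x0 x ltac:(lra) Hx) as [d [Hd HD]].
    apply (is_RInt_vert (punctured (x - 1) (x + 1) x0 d) (pole c x0 (S m))
      (fun s => c * (RtoC (INR (S m)) * (/ (RtoC x0 - s)) ^ 2 * (/ (RtoC x0 - s)) ^ m))%C x Y); auto.
    apply UQ_scal, UQ_pow, (UQ_inv _ _ d Hd).
    intros s [_ Hs]; rewrite Cmod_minus_sym; lra. }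
  assert (B : forall x, x <> x0 -> Cmod (vseg (pole c x0 (S (S m))) x Y) <= 2 * (Cmod c * / Y)).
  { intros x Hx; rewrite E by auto; rewrite !Cmod_mult, Cmod_opp, Cmod_Ci, Rmult_1_l.
    rewrite <- (Rmult_1_l (2 * (Cmod c * / Y))).
    apply Rmult_le_compat; auto; try apply Cmod_ge_0.
    eapply Rle_trans; [apply Cmod_minus_le|].
    assert (HY1 : 1 <= Y) by lra.
    pose proof (Cmod_pole_vert x0 x Y Y c m HY1 (Rabs_pos_eq Y ltac:(lra))).
    assert (Hm : Rabs (- Y) = Y) by (rewrite Rabs_Ropp; apply Rabs_pos_eq; lra).
    pose proof (Cmod_pole_vert x0 x (- Y) Y c m HY1 Hm). lra. }
  replace (vseg (pole c x0 (S (S m))) b Y - vseg (pole c x0 (S (S m))) a Y - 0)%C with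
    (vseg (pole c x0 (S (S m))) b Y - vseg (pole c x0 (S (S m))) a Y)%C by ring.
  eapply Rle_trans; [apply Cmod_minus_le|].
  pose proof (B a ltac:(lra)); pose proof (B b ltac:(lra)); lra.
Qed.

(** The real part integrates to an arctangent. The imaginary part is odd, and its logarithms cancel
    because the segment is symmetric: this is where the principal value is needed. *)
Lemma vseg_inv (x0 x Y : R) : x <> x0 ->
  vseg (fun s => / (RtoC x0 - s))%C x Y = RtoC (2 * atan (Y / (x0 - x))).
Proof.
  intros Hx; set (d := x0 - x); assert (Hd : d <> 0) by (unfold d; lra).
  assert (Hd2 : forall y, 0 < d * d + y * y) by (intros y; nra).
  apply (is_RInt_unique (V := C_R_CompleteNormedModule)).
  apply (is_RInt_ext (V := C_R_NormedModule) (fun y => (d / (d * d + y * y), y / (d * d + y * y)))).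
  { intros y _; ceq. specialize (Hd2 y).
    assert (Hnz : (RtoC x0 - (x, y))%C <> 0%C).
    { intros H0; apply (f_equal fst) in H0; simpl in H0; unfold d in Hd; lra. }
    assert (E : (RtoC x0 - (x, y) = (d, (- y)%R))%C) by (apply C_eq; unfold d; simpl; ring).
    rewrite E in *. apply C_eq; simpl; field; nra. }
  evar_last.
  { apply (is_RInt_derive (V := C_R_CompleteNormedModule)
      (fun y => (atan (y / d), / 2 * ln (d * d + y * y)))).
    - intros y _; specialize (Hd2 y); apply is_derive_pair; auto_derive; auto; field; repeat split; nra.
    - intros y _; specialize (Hd2 y); apply continuous_pair;
        apply (ex_derive_continuous (V := R_NormedModule)); auto_derive; nra. }
  apply C_eq; unfold minus, plus, opp; simpl; unfold plus, opp; simpl.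
  - unfold Rdiv; rewrite Ropp_mult_distr_l_reverse, atan_opp; ring.
  - replace (- Y * - Y) with (Y * Y) by ring; ring.
Qed.

Lemma atan_lim (d e : R) : 0 < d -> 0 < e ->
  exists Y0, 0 < Y0 /\ forall Y, Y0 <= Y -> Rabs (2 * atan (Y / d) - PI) <= e.
Proof.
  intros Hd He.
  assert (Hc : continuous atan 0).
  { apply (ex_derive_continuous (V := R_NormedModule)); eexists; apply is_derive_atan. }
  assert (He2 : 0 < e / 2) by lra.
  unfold continuous in Hc; rewrite atan_0 in Hc.
  destruct (Hc _ (locally_ball 0 (mkposreal _ He2))) as [[r Hr] Hr2]; simpl in Hr2.
  exists (2 * d / r); split; [apply Rdiv_lt_0_compat; lra|]; intros Y HY.
  assert (HY0 : 0 < Y) by (apply Rlt_le_trans with (2 := HY), Rdiv_lt_0_compat; lra).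
  specialize (Hr2 (d / Y)).
  assert (Hb : d / Y < r).
  { apply Rmult_lt_reg_r with Y; auto; unfold Rdiv; rewrite Rmult_assoc, Rinv_l by lra.
    assert (r * (2 * d / r) <= r * Y) by (apply Rmult_le_compat_l; lra).
    replace (r * (2 * d / r)) with (2 * d) in H by (field; lra); lra. }
  assert (Hp : 0 < d / Y) by (apply Rdiv_lt_0_compat; auto).
  assert (Hball : Rabs (atan (d / Y) - 0) < e / 2).
  { apply Hr2; change (Rabs (d / Y - 0) < r); rewrite Rminus_0_r, Rabs_pos_eq; lra. }
  replace (Y / d) with (/ (d / Y)) by (field; lra).
  rewrite atan_inv by auto.
  apply Rabs_def2 in Hball; apply Rabs_le; lra.
Qed.

(** The arctangent tends to pi/2 on the left of the pole and to -pi/2 on the right, so the two lines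
    together account for -2 pi c. *)
Lemma vshift_simple_pole (a b x0 : R) (c : C) : a < x0 -> x0 < b ->
  vshift (pole c x0 1) a b (- RtoC (2 * PI) * c)%C.
Proof.
  intros Ha Hb e He; pose proof (Cmod_ge_0 c) as Hc.
  assert (He2 : 0 < e / (2 * (Cmod c + 1))) by (apply Rdiv_lt_0_compat; lra).
  destruct (atan_lim (x0 - a) _ ltac:(lra) He2) as [Y1 [HY1 H1]].
  destruct (atan_lim (b - x0) _ ltac:(lra) He2) as [Y2 [HY2 H2]].
  exists (Rmax Y1 Y2); split; [apply Rlt_le_trans with (1 := HY1), Rmax_l|]; intros Y HY.
  pose proof (Rmax_l Y1 Y2); pose proof (Rmax_r Y1 Y2).
  specialize (H1 Y ltac:(lra)); specialize (H2 Y ltac:(lra)).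
  assert (E : forall x, x <> x0 -> vseg (pole c x0 1) x Y = (c * RtoC (2 * atan (Y / (x0 - x))))%C).
  { intros x Hx; rewrite <- vseg_inv by auto.
    apply (is_RInt_unique (V := C_R_CompleteNormedModule)).
    apply (is_RInt_ext (V := C_R_NormedModule) (fun y => c * / (RtoC x0 - (x, y)))%C).
    { intros y _; ceq; unfold pole; simpl; ring. }
    apply is_RInt_Cscal.
    destruct (holo_pole (x - 1) (x + 1) x0 1 0) as [F' HF'].
    destruct (punctured_line (x - 1) (x + 1) x0 x ltac:(lra) Hx) as [d [Hd HD]].
    apply (vseg_correct (punctured (x - 1) (x + 1) x0 d) (fun s => / (RtoC x0 - s))%C
      (fun s => (/ (RtoC x0 - s)) ^ 2)%C x Y); auto.
    apply (UQ_inv _ _ d Hd); intros s [_ Hs]; rewrite Cmod_minus_sym; lra. }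
  rewrite !E by lra.
  replace (Y / (x0 - b)) with (- (Y / (b - x0))) by (field; lra). rewrite atan_opp.
  set (t1 := atan (Y / (b - x0))) in *; set (t2 := atan (Y / (x0 - a))) in *.
  replace (c * RtoC (2 * - t1) - c * RtoC (2 * t2) - - RtoC (2 * PI) * c)%C with
    (- (c * RtoC ((2 * t1 - PI) + (2 * t2 - PI))))%C.
  2: { apply C_eq; simpl; ring. }
  rewrite Cmod_opp, Cmod_mult, Cmod_R.
  pose proof (Rabs_triang (2 * t1 - PI) (2 * t2 - PI)).
  apply Rle_trans with ((Cmod c + 1) * (e / (2 * (Cmod c + 1)) + e / (2 * (Cmod c + 1)))).
  - apply Rmult_le_compat; try lra; apply Rabs_pos.
  - right; field; lra.
Qed.

(** Expansion [f v = a 0 + a 1 v + ... + a (n-1) v^(n-1) + O(v^n)] at [0],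
    with the successive remainders made explicit. *)
Fixpoint expansion (n : nat) (f : C -> C) (a : nat -> R) : Prop :=
  match n with
  | O => exists rho M, 0 < rho /\ forall v, 0 < Cmod v < rho -> Cmod (f v) <= M
  | S m => exists f1 rho, 0 < rho /\
      (forall v, 0 < Cmod v < rho -> f v = (RtoC (a O) + v * f1 v)%C) /\
      expansion m f1 (fun j => a (S j))
  end.

Lemma subtract_pole (n : nat) (al be a b x0 rho rho1 c0 : R) (F f f1 : C -> C) :
  holo_punctured al be x0 F -> vanishing F a b ->
  (forall v, 0 < Cmod v < rho -> F (RtoC x0 - v)%C = (f v * (/ v) ^ S n)%C) ->
  (forall v, 0 < Cmod v < rho1 -> f v = (RtoC c0 + v * f1 v)%C) ->
  let F1 := fun s => (F s + pole (- RtoC c0) x0 (S n) s)%C in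
  holo_punctured al be x0 F1 /\ vanishing F1 a b /\
  (forall v, 0 < Cmod v < Rmin rho rho1 -> F1 (RtoC x0 - v)%C = (f1 v * (/ v) ^ n)%C).
Proof.
  intros HF HV HFf Hf1 F1; split; [|split].
  - destruct HF as [F' HF]; destruct (holo_pole al be x0 (- RtoC c0) n) as [G' HG].
    eexists; intros d Hd; apply UQ_plus; [apply HF, Hd | apply HG, Hd].
  - intros e He; destruct (HV (e / 2)) as [Y1 [HY1 H1]]; [lra|].
    destruct (vanishing_pole a b x0 (- RtoC c0) n (e / 2)) as [Y2 [HY2 H2]]; [lra|].
    exists (Rmax Y1 Y2); split; [apply Rlt_le_trans with (1 := HY1), Rmax_l|]; intros Y HY x Hx.
    pose proof (Rmax_l Y1 Y2); pose proof (Rmax_r Y1 Y2).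
    destruct (H1 Y ltac:(lra) x Hx); destruct (H2 Y ltac:(lra) x Hx).
    split; (eapply Rle_trans; [apply Cmod_triangle|]); lra.
  - intros v Hv; pose proof (Rmin_l rho rho1); pose proof (Rmin_r rho rho1).
    unfold F1, pole; rewrite HFf, Hf1 by lra.
    replace (RtoC x0 - (RtoC x0 - v))%C with v by ring.
    rewrite Cpow_S; field. apply Cmod_gt_0; lra.
Qed.

(** Each step moves the leading term a_0/v^(n+1) into a pole that contributes 0 and lowers the order
    by one. After n steps the coefficient c n stands over a simple pole, and the rest is bounded. *)
Lemma residue_shift (n : nat) (al be a b x0 rho : R) (F f : C -> C) (c : nat -> R) :
  al < a -> a < x0 -> x0 < b -> b < be -> holo_punctured al be x0 F -> vanishing F a b ->
  0 < rho -> (forall v, 0 < Cmod v < rho -> F (RtoC x0 - v)%C = (f v * (/ v) ^ S n)%C) ->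
  expansion (S n) f c ->
  vshift F a b (- RtoC (2 * PI) * RtoC (c n))%C.
Proof.
  intros Ha Hax Hxb Hb; revert rho F f c.
  induction n as [|n IH]; intros rho F f c HF HV Hrho HFf [f1 [rho1 [Hrho1 [Hf1 Hexp]]]].
  - destruct (subtract_pole 0 al be a b x0 rho rho1 (c O) F f f1 HF HV HFf Hf1) as [HF1 [HV1 HFf1]].
    destruct Hexp as [rho2 [M [Hrho2 HM]]].
    replace F with (fun s => ((F s + pole (- RtoC (c O)) x0 1 s) + pole (RtoC (c O)) x0 1 s)%C).
    2: { apply functional_extensionality; intros s; unfold pole; ring. }
    replace (- RtoC (2 * PI) * RtoC (c O))%C with (0 + - RtoC (2 * PI) * RtoC (c O))%C by ring.
    apply (vshift_plus al be a b x0); auto.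
    + apply holo_pole.
    + apply (vshift_bounded al be a b x0 (Rmin rho2 (Rmin rho rho1)) M); auto.
      * repeat apply Rmin_pos; auto.
      * intros v Hv; pose proof (Rmin_l rho2 (Rmin rho rho1)); pose proof (Rmin_r rho2 (Rmin rho rho1)).
        rewrite HFf1 by lra; simpl; rewrite Cmult_1_r; apply HM; lra.
    + apply vshift_simple_pole; auto.
  - destruct (subtract_pole (S n) al be a b x0 rho rho1 (c O) F f f1 HF HV HFf Hf1) as [HF1 [HV1 HFf1]].
    replace F with (fun s => ((F s + pole (- RtoC (c O)) x0 (S (S n)) s) + pole (RtoC (c O)) x0 (S (S n)) s)%C).
    2: { apply functional_extensionality; intros s; unfold pole; ring. }
    replace (- RtoC (2 * PI) * RtoC (c (S n)))%C with (- RtoC (2 * PI) * RtoC (c (S n)) + 0)%C by ring.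
    apply (vshift_plus al be a b x0); auto.
    + apply holo_pole.
    + apply (IH (Rmin rho rho1) _ f1 (fun j => c (S j))); auto.
      apply Rmin_pos; auto.
    + apply vshift_higher_pole; auto.
Qed.

(** * Integrals over entire vertical lines *)

Lemma atan_at_oo : filterlim atan (Rbar_locally p_infty) (locally (PI / 2)).
Proof.
  apply filterlim_locally; intros e.
  destruct (atan_lim 1 e Rlt_0_1 (cond_pos e)) as [Y0 [HY0 H]].
  exists Y0; intros y Hy; specialize (H y ltac:(lra)); rewrite Rdiv_1_r in H.
  change (Rabs (atan y - PI / 2) < e).
  replace (2 * atan y - PI) with (2 * (atan y - PI / 2)) in H by field.
  rewrite Rabs_mult, (Rabs_pos_eq 2) in H by lra; pose proof (cond_pos e).
  pose proof (Rabs_pos (atan y - PI / 2)); lra.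
Qed.

Lemma is_RInt_gen_cauchy (K : R) :
  is_RInt_gen (fun y => K * / (1 + y ^ 2)) (Rbar_locally m_infty) (Rbar_locally p_infty) (K * PI).
Proof.
  replace (K * PI) with (minus (K * (PI / 2)) (K * - (PI / 2))) by (unfold minus, plus, opp; simpl; field).
  assert (HP : forall y, 0 < 1 + y ^ 2) by (intros y; nra).
  apply (is_RInt_gen_FTC R_CompleteNormedModule (Rbar_locally m_infty) (Rbar_locally p_infty)
    (fun _ => True) (fun y => K * atan y)); auto.
  - exists 0; auto.
  - exists 0; auto.
  - intros y _; specialize (HP y); auto_derive; auto; unfold Rsqr; field; nra.
  - intros y _; specialize (HP y); apply (ex_derive_continuous (V := R_NormedModule)); auto_derive; nra.
  - apply (filterlim_comp _ _ _ atan (fun u => K * u) _ (locally (- (PI / 2)))).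
    + apply filterlim_locally; intros e.
      destruct (proj1 (filterlim_locally _ _) atan_at_oo e) as [M HM].
      exists (- M); intros y Hy; specialize (HM (- y) ltac:(lra)).
      change (Rabs (atan (- y) - PI / 2) < e) in HM; change (Rabs (atan y - - (PI / 2)) < e).
      rewrite atan_opp in HM; rewrite <- Rabs_Ropp.
      replace (- (atan y - - (PI / 2))) with (- atan y - PI / 2) by ring; auto.
    + apply (filterlim_scal_r (K := R_AbsRing) (V := R_NormedModule) K).
  - apply (filterlim_comp _ _ _ atan (fun u => K * u) _ (locally (PI / 2))).
    + apply atan_at_oo.
    + apply (filterlim_scal_r (K := R_AbsRing) (V := R_NormedModule) K).
Qed.

Lemma m_oo_p_oo_le : filter_prod (Rbar_locally m_infty) (Rbar_locally p_infty)
  (fun ab : R * R => fst ab <= snd ab).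
Proof.
  apply (Filter_prod _ _ _ (fun t => t < 0) (fun t => 0 < t)).
  - exists 0; auto.
  - exists 0; auto.
  - simpl; intros; lra.
Qed.

Definition vline (F : C -> C) (x : R) : C :=
  RInt_gen (V := C_R_CompleteNormedModule) (fun y => F (x, y)) (Rbar_locally m_infty) (Rbar_locally p_infty).

(** Domination by K/(1+y^2), of integral K pi. Convergence is for independent endpoints; the choice
    -Y, Y identifies the integral with the principal value to which [vshift] refers. *)
Lemma vline_correct (F : C -> C) (x K : R) :
  (forall y, continuous (U := C_R_NormedModule) (fun y => F (x, y)) y) ->
  (forall y, Cmod (F (x, y)) <= K * / (1 + y ^ 2)) ->
  is_RInt_gen (V := C_R_NormedModule) (fun y => F (x, y)) (Rbar_locally m_infty) (Rbar_locally p_infty) (vline F x) /\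
  Cmod (vline F x) <= K * PI /\
  (forall e, 0 < e -> exists Y0, forall Y, Y0 <= Y -> Cmod (vseg F x Y - vline F x) <= e).
Proof.
  intros Hc HK.
  assert (HI : is_RInt_gen (V := C_R_NormedModule) (fun y => F (x, y)) (Rbar_locally m_infty) (Rbar_locally p_infty) (vline F x)).
  { apply (RInt_gen_correct (V := C_R_CompleteNormedModule)).
    apply (ex_RInt_gen_dominated C_R_CompleteNormedModule _ _ (fun _ => True) (fun y => F (x, y))
      (fun y => K * / (1 + y ^ 2))); auto.
    - exists 0; auto.
    - exists 0; auto.
    - intros y _; apply (ex_derive_continuous (V := R_NormedModule)); auto_derive; nra.
    - intros y _; rewrite norm_Cmod; apply HK.
    - eexists; apply is_RInt_gen_cauchy. }
  split; [exact HI | split].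
  - rewrite <- norm_Cmod.
    apply (RInt_gen_norm (V := C_R_CompleteNormedModule) (Fa := Rbar_locally m_infty) (Fb := Rbar_locally p_infty)
      (fun y => F (x, y)) (fun y => K * / (1 + y ^ 2))); auto.
    + apply m_oo_p_oo_le.
    + apply filter_forall; intros ab y _; rewrite norm_Cmod; apply HK.
    + apply is_RInt_gen_cauchy.
  - intros e He.
    specialize (HI _ (locally_ball_norm (V := C_R_NormedModule) _ (mkposreal _ He))).
    unfold filtermapi in HI; destruct HI as [Qa Qb [Ma HQa] [Mb HQb] HQ].
    exists (Rmax (- Ma + 1) (Mb + 1)); intros Y HY.
    pose proof (Rmax_l (- Ma + 1) (Mb + 1)); pose proof (Rmax_r (- Ma + 1) (Mb + 1)).
    destruct (HQ (- Y) Y) as [l [Hl1 Hl2]]; [apply HQa; lra | apply HQb; lra|]; simpl in Hl1.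
    apply (is_RInt_unique (V := C_R_CompleteNormedModule)) in Hl1.
    unfold vseg; rewrite Hl1; unfold ball_norm in Hl2; rewrite norm_Cmod in Hl2; simpl in Hl2.
    apply Rlt_le, Hl2.
Qed.

Lemma vline_shift (F : C -> C) (a b Ka Kb : R) (r : C) :
  (forall y, continuous (U := C_R_NormedModule) (fun y => F (a, y)) y) ->
  (forall y, Cmod (F (a, y)) <= Ka * / (1 + y ^ 2)) ->
  (forall y, continuous (U := C_R_NormedModule) (fun y => F (b, y)) y) ->
  (forall y, Cmod (F (b, y)) <= Kb * / (1 + y ^ 2)) ->
  vshift F a b r -> vline F b = (vline F a + r)%C.
Proof.
  intros Hca HKa Hcb HKb Hs.
  destruct (vline_correct F a Ka Hca HKa) as [_ [_ La]].
  destruct (vline_correct F b Kb Hcb HKb) as [_ [_ Lb]].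
  assert (E : (vline F b - vline F a - r)%C = 0%C).
  { apply Cmod_eq_0, Rle_antisym; [|apply Cmod_ge_0].
    apply le_epsilon; intros e He; rewrite Rplus_0_l.
    destruct (La (e / 3)) as [Y1 H1]; [lra|]; destruct (Lb (e / 3)) as [Y2 H2]; [lra|].
    destruct (Hs (e / 3)) as [Y3 [_ H3]]; [lra|].
    set (Y := Rmax Y1 (Rmax Y2 Y3)).
    pose proof (Rmax_l Y1 (Rmax Y2 Y3)); pose proof (Rmax_r Y1 (Rmax Y2 Y3)).
    pose proof (Rmax_l Y2 Y3); pose proof (Rmax_r Y2 Y3); fold Y in H, H0.
    specialize (H1 Y ltac:(lra)); specialize (H2 Y ltac:(lra)); specialize (H3 Y ltac:(lra)).
    replace (vline F b - vline F a - r)%C with ((vseg F b Y - vseg F a Y - r) +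
      ((vseg F a Y - vline F a) - (vseg F b Y - vline F b)))%C by ring.
    eapply Rle_trans; [apply Cmod_triangle|].
    eapply Rle_trans; [apply Rplus_le_compat_l, Cmod_minus_le|]. lra. }
  transitivity (vline F a + r + (vline F b - vline F a - r))%C; [ring | rewrite E; ring].
Qed.

(** * Expansions and Cauchy products *)

Lemma expansion_ext (n : nat) (f g : C -> C) (a b : nat -> R) (rho : R) : 0 < rho ->
  (forall v, 0 < Cmod v < rho -> f v = g v) -> (forall j, a j = b j) ->
  expansion n f a -> expansion n g b.
Proof.
  intros Hrho Hfg Hab; replace b with a by (apply functional_extensionality; auto).
  destruct n as [|n]; simpl.
  - intros [r [M [Hr HM]]]; exists (Rmin rho r), M; split; [apply Rmin_pos; auto|].
    intros v Hv; pose proof (Rmin_l rho r); pose proof (Rmin_r rho r).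
    rewrite <- Hfg by lra; apply HM; lra.
  - intros [f1 [r [Hr [H1 H2]]]]; exists f1, (Rmin rho r); split; [apply Rmin_pos; auto | split; auto].
    intros v Hv; pose proof (Rmin_l rho r); pose proof (Rmin_r rho r).
    rewrite <- Hfg by lra; apply H1; lra.
Qed.

Lemma expansion_weaken (n : nat) (f : C -> C) (a : nat -> R) : expansion (S n) f a -> expansion n f a.
Proof.
  revert f a; induction n as [|n IH]; intros f a [f1 [r [Hr [H1 H2]]]].
  - destruct H2 as [r2 [M [Hr2 HM]]].
    exists (Rmin r r2), (Rabs (a O) + r * M); split; [apply Rmin_pos; auto|].
    intros v Hv; pose proof (Rmin_l r r2); pose proof (Rmin_r r r2).
    rewrite H1 by lra; eapply Rle_trans; [apply Cmod_triangle|]; rewrite Cmod_R, Cmod_mult.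
    apply Rplus_le_compat_l, Rmult_le_compat; try apply Cmod_ge_0; try lra; apply HM; lra.
  - exists f1, r; split; [auto | split; [auto | apply IH; auto]].
Qed.

Lemma expansion_plus (n : nat) (f g : C -> C) (a b : nat -> R) :
  expansion n f a -> expansion n g b -> expansion n (fun v => f v + g v)%C (fun j => a j + b j).
Proof.
  revert f g a b; induction n as [|n IH]; intros f g a b.
  - intros [r [M [Hr HM]]] [r2 [M2 [Hr2 HM2]]].
    exists (Rmin r r2), (M + M2); split; [apply Rmin_pos; auto|].
    intros v Hv; pose proof (Rmin_l r r2); pose proof (Rmin_r r r2).
    eapply Rle_trans; [apply Cmod_triangle|]; apply Rplus_le_compat; [apply HM | apply HM2]; lra.
  - intros [f1 [r [Hr [H1 H2]]]] [g1 [r2 [Hr2 [H3 H4]]]].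
    exists (fun v => f1 v + g1 v)%C, (Rmin r r2); split; [apply Rmin_pos; auto | split].
    + intros v Hv; pose proof (Rmin_l r r2); pose proof (Rmin_r r r2).
      rewrite H1, H3, RtoC_plus by lra; ring.
    + apply (IH f1 g1 (fun j => a (S j)) (fun j => b (S j))); auto.
Qed.

Lemma expansion_scal (n : nat) (f : C -> C) (a : nat -> R) (c : R) :
  expansion n f a -> expansion n (fun v => RtoC c * f v)%C (fun j => c * a j).
Proof.
  revert f a; induction n as [|n IH]; intros f a.
  - intros [r [M [Hr HM]]]; exists r, (Rabs c * M); split; auto; intros v Hv.
    rewrite Cmod_mult, Cmod_R; apply Rmult_le_compat_l; [apply Rabs_pos | auto].
  - intros [f1 [r [Hr [H1 H2]]]]; exists (fun v => RtoC c * f1 v)%C, r; split; [auto | split].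
    + intros v Hv; rewrite H1, RtoC_mult by lra; ring.
    + apply (IH f1 (fun j => a (S j))); auto.
Qed.

(** The Cauchy product, with a recursion that shifts the first sequence as [expansion] does. *)
Fixpoint conv (a b : nat -> R) (n : nat) : R :=
  match n with
  | O => a O * b O
  | S m => a O * b (S m) + conv (fun j => a (S j)) b m
  end.

(** With f = a_0 + v f1 and g = b_0 + v g1, the product is a_0 b_0 + v (a_0 g1 + f1 g). Here f1 has
    order n only, so [g] is weakened to the same order. *)
Lemma expansion_mult (n : nat) (f g : C -> C) (a b : nat -> R) :
  expansion n f a -> expansion n g b -> expansion n (fun v => f v * g v)%C (conv a b).
Proof.
  revert f g a b; induction n as [|n IH]; intros f g a b.
  - intros [r [M [Hr HM]]] [r2 [M2 [Hr2 HM2]]].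
    exists (Rmin r r2), (M * M2); split; [apply Rmin_pos; auto|].
    intros v Hv; pose proof (Rmin_l r r2); pose proof (Rmin_r r r2).
    rewrite Cmod_mult; apply Rmult_le_compat; try apply Cmod_ge_0; [apply HM | apply HM2]; lra.
  - intros Hf Hg; pose proof (expansion_weaken n g b Hg) as Hg'.
    destruct Hf as [f1 [r [Hr [H1 H2]]]], Hg as [g1 [r2 [Hr2 [H3 H4]]]].
    exists (fun v => RtoC (a O) * g1 v + f1 v * g v)%C, (Rmin r r2); split; [apply Rmin_pos; auto | split].
    + intros v Hv; pose proof (Rmin_l r r2); pose proof (Rmin_r r r2).
      rewrite H1 by lra; simpl conv; rewrite RtoC_mult, (H3 v) by lra; ring.
    + apply (expansion_plus n (fun v => RtoC (a O) * g1 v)%C (fun v => f1 v * g v)%C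
        (fun j => a O * b (S j)) (conv (fun j => a (S j)) b)).
      * apply (expansion_scal n g1 (fun j => b (S j))); auto.
      * apply IH; auto.
Qed.

Lemma expansion_zero (n : nat) : expansion n (fun _ => RtoC 0) (fun _ => 0).
Proof.
  induction n as [|n IH].
  - exists 1, 0; split; [lra | intros; rewrite Cmod_0; lra].
  - exists (fun _ => RtoC 0), 1; split; [lra | split; [intros; ring | exact IH]].
Qed.

Definition delta (n : nat) : R := match n with O => 1 | S _ => 0 end.

Lemma expansion_one (n : nat) : expansion n (fun _ => RtoC 1) delta.
Proof.
  destruct n as [|n].
  - exists 1, 1; split; [lra | intros; rewrite Cmod_1; lra].
  - exists (fun _ => RtoC 0), 1; split; [lra | split; [intros; simpl; ring | apply expansion_zero]].
Qed.

Definition convs (l : list (nat -> R)) : nat -> R := fold_right conv delta l.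

Lemma expansion_Cprod (n : nat) (f : nat -> C -> C) (a : nat -> nat -> R) (l : list nat) :
  (forall t, In t l -> expansion n (f t) (a t)) ->
  expansion n (fun v => Cprod (map (fun t => f t v) l)) (convs (map a l)).
Proof.
  induction l as [|t l IH]; intros H; simpl.
  - apply expansion_one.
  - apply (expansion_mult n (f t) (fun v => Cprod (map (fun t => f t v) l))).
    + apply H; left; auto.
    + apply IH; intros u Hu; apply H; right; auto.
Qed.

(** [rem m] is the remainder of order [m] of [f]; the [m]-th step of the
    expansion is [rem m v / v^m]. *)
Lemma expansion_of_remainder (k m : nat) (rem : nat -> C -> C) (a : nat -> R) (rho M : R) :
  0 < rho -> (forall j v, rem (S j) v = (rem j v - RtoC (a j) * v ^ j)%C) ->
  (forall v, 0 < Cmod v < rho -> Cmod (rem (m + k)%nat v) <= M * Cmod v ^ (m + k)) ->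
  expansion k (fun v => rem m v * (/ v) ^ m)%C (fun j => a (m + j)%nat).
Proof.
  intros Hrho Hrem; revert m; induction k as [|k IH]; intros m HM.
  - exists rho, M; split; auto; intros v Hv; rewrite Nat.add_0_r in HM.
    assert (Hv0 : v <> 0%C) by (apply Cmod_gt_0; lra).
    rewrite Cmod_mult, Cmod_pow, Cmod_inv by auto.
    apply Rle_trans with (M * Cmod v ^ m * (/ Cmod v) ^ m).
    + apply Rmult_le_compat_r; [apply pow_le, Rlt_le, Rinv_0_lt_compat; lra | apply HM; auto].
    + right; rewrite Rmult_assoc, <- Rpow_mult_distr, Rinv_r, pow1 by lra; ring.
  - exists (fun v => rem (S m) v * (/ v) ^ S m)%C, rho; split; [auto | split].
    + intros v Hv; assert (Hv0 : v <> 0%C) by (apply Cmod_gt_0; lra).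
      rewrite Nat.add_0_r, Hrem, Cpow_S.
      assert (E : (v ^ m * (/ v) ^ m = 1)%C).
      { rewrite <- Cpow_mult_l, Cinv_r, Cpow_1_l; auto. }
      transitivity (rem m v * (/ v) ^ m + RtoC (a m) * (1 - v * / v * (v ^ m * (/ v) ^ m)) +
        rem m v * (/ v) ^ m * (v * / v - 1))%C; [rewrite E, Cinv_r by auto; ring | ring].
    + apply (expansion_ext k (fun v => rem (S m) v * (/ v) ^ S m)%C _ (fun j => a (S m + j)%nat) _ 1); auto.
      * lra.
      * intros j; f_equal; lia.
      * apply IH; intros v Hv; specialize (HM v Hv); rewrite Nat.add_succ_r in HM; exact HM.
Qed.

Lemma expansion_gam (n : nat) (x : R) : 0 < x ->
  expansion n (fun v => gam 0 (RtoC x + v)) (fun l => Gamma_deriv l x / INR (fact l)).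
Proof.
  intros Hx; destruct (rgam_le x x n 0 Hx (Rle_refl _)) as [K [HK HK2]].
  apply (expansion_ext n (fun v => rgam 0 0 (RtoC x) v * (/ v) ^ 0)%C _
    (fun j => (fun l => Gamma_deriv l x / INR (fact l)) (0 + j)%nat) _ 1).
  - lra.
  - intros v _; simpl; ring.
  - reflexivity.
  - apply (expansion_of_remainder n 0 (fun m v => rgam m 0 (RtoC x) v)
      (fun l => Gamma_deriv l x / INR (fact l)) (x / 4) K); [lra| |].
    + intros j v; simpl; rewrite Gamma_deriv_gam by auto; unfold Rdiv.
      rewrite RtoC_mult, <- (gam_real j x Hx); ring.
    + intros v Hv; apply HK2; simpl; lra.
Qed.

Lemma expansion_cpowR (n : nat) (z : R) :
  expansion n (cpowR z) (fun l => ln z ^ l / INR (fact l)).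
Proof.
  apply (expansion_ext n (fun v => rexp 0 (v * RtoC (ln z)) * (/ v) ^ 0)%C _
    (fun j => (fun l => ln z ^ l / INR (fact l)) (0 + j)%nat) _ 1).
  - lra.
  - intros v _; simpl; unfold cpowR; ring.
  - reflexivity.
  - set (L := Rabs (ln z)); assert (HL : 0 <= L) by apply Rabs_pos.
    apply (expansion_of_remainder n 0 (fun m v => rexp m (v * RtoC (ln z)))
      (fun l => ln z ^ l / INR (fact l)) 1 (L ^ n * exp L)); [lra| |].
    + intros j v; simpl; unfold Rdiv; rewrite RtoC_mult, RtoC_pow, Cpow_mult_l; ring.
    + intros v Hv; simpl; eapply Rle_trans; [apply Cmod_rexp_le|].
      rewrite Cmod_mult, Cmod_R, Rpow_mult_distr; fold L.
      rewrite (Rmult_comm (Cmod v ^ n)), Rmult_assoc, Rmult_assoc.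
      apply Rmult_le_compat_l; [apply pow_le; auto|].
      rewrite (Rmult_comm (exp L)); apply Rmult_le_compat_l; [apply pow_le; lra|].
      apply exp_le; nra.
Qed.

(** 1/(p-v) = 1/p + v (1/p) 1/(p-v): the remainder is a multiple of the function itself, so the
    induction closes. *)
Lemma expansion_geometric (n : nat) (p : R) : 0 < p ->
  expansion n (fun v => / (RtoC p - v))%C (fun l => / p ^ (l + 1)).
Proof.
  intros Hp.
  assert (Hge : forall v, 0 < Cmod v < p / 2 -> p / 2 <= Cmod (RtoC p - v)).
  { intros v Hv; pose proof (Cmod_triangle' (RtoC p) v) as H; rewrite Cmod_R, Rabs_pos_eq in H; lra. }
  assert (Hnz : forall v, 0 < Cmod v < p / 2 -> (RtoC p - v)%C <> 0%C).
  { intros v Hv; apply Cmod_gt_0; specialize (Hge v Hv); lra. }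
  induction n as [|n IH].
  - exists (p / 2), (/ (p / 2)); split; [lra | intros v Hv].
    rewrite Cmod_inv by auto; apply Rinv_le_contravar; [lra | auto].
  - exists (fun v => RtoC (/ p) * / (RtoC p - v))%C, (p / 2); split; [lra | split].
    + intros v Hv; simpl (/ p ^ (0 + 1)); rewrite Rmult_1_r, RtoC_inv by lra.
      field; split; [apply (Hnz v Hv)|]. intros H; apply RtoC_inj in H; lra.
    + apply (expansion_ext n (fun v => RtoC (/ p) * / (RtoC p - v))%C _ (fun j => / p * / p ^ (j + 1)) _ 1); auto.
      * lra.
      * intros j; simpl; rewrite Rinv_mult; reflexivity.
      * apply expansion_scal, IH.
Qed.

(** * Sums over compositions and the coefficients H_kj *)

Lemma sumR_app (l1 l2 : list R) : sumR (l1 ++ l2) = sumR l1 + sumR l2.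
Proof. induction l1 as [|x l1 IH]; simpl; [ring | rewrite IH; ring]. Qed.

Lemma sumR_scal (T : Type) (c : R) (f : T -> R) (l : list T) :
  sumR (map (fun x => c * f x) l) = c * sumR (map f l).
Proof. induction l as [|x l IH]; simpl; [ring | rewrite IH; ring]. Qed.

Lemma prodR_app (l1 l2 : list R) : prodR (l1 ++ l2) = prodR l1 * prodR l2.
Proof. induction l1 as [|x l1 IH]; simpl; [ring | rewrite IH; ring]. Qed.

Lemma sumR_flat_map (S T : Type) (F : T -> R) (g : S -> list T) (l : list S) :
  sumR (map F (flat_map g l)) = sumR (map (fun a => sumR (map F (g a))) l).
Proof.
  induction l as [|a l IH]; simpl; auto. rewrite map_app, sumR_app, IH; reflexivity.
Qed.

Lemma conv_sum (a b : nat -> R) (m : nat) :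
  conv a b m = sumR (map (fun i => a i * b (m - i)%nat) (seq 0 (S m))).
Proof.
  revert a; induction m as [|m IH]; intros a.
  - simpl; ring.
  - change (conv a b (S m)) with (a O * b (S m) + conv (fun j => a (S j)) b m).
    rewrite IH. change (seq 0 (S (S m))) with (0%nat :: seq 1 (S m)).
    rewrite <- seq_shift; simpl map; rewrite map_map. reflexivity.
Qed.

(** A composition splits into its first entry and a composition of the rest, exactly as an iterated
    Cauchy product splits off its first sequence. *)
Lemma sum_compositions (r m : nat) (A : nat -> nat -> R) :
  sumR (map (fun ls => prodR (map (fun t => A t (nth (t - 1) ls O)) (seq 1 r))) (compositions r m))
  = convs (map A (seq 1 r)) m.
Proof.
  revert m A; induction r as [|r IH]; intros m A.
  - destruct m; simpl; ring.
  - change (compositions (S r) m) with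
      (flat_map (fun a => map (cons a) (compositions r (m - a))) (seq 0 (S m))).
    rewrite sumR_flat_map.
    change (convs (map A (seq 1 (S r))) m) with (conv (A 1%nat) (convs (map A (seq 2 r))) m).
    rewrite conv_sum; f_equal; apply map_ext; intros a.
    replace (map A (seq 2 r)) with (map (fun t => A (S t)) (seq 1 r)) by (rewrite <- (seq_shift r 1), map_map; reflexivity).
    rewrite <- (IH (m - a)%nat (fun t => A (S t))), <- sumR_scal.
    rewrite map_map; f_equal; apply map_ext; intros ls.
    change (seq 1 (S r)) with (1%nat :: seq 2 r); rewrite <- (seq_shift r 1).
    simpl map; rewrite map_map; simpl prodR; f_equal.
    f_equal; apply map_ext_in; intros t Ht; apply in_seq in Ht.
    destruct t as [|t]; [lia|]; simpl; rewrite Nat.sub_0_r; reflexivity.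
Qed.

(** Slot t <= k holds the coefficients of 1/(k-t+1-v), slot k+1 those of Gamma(1+v). *)
Definition inner_coef (k t l : nat) : R :=
  if (t <=? k)%nat then / INR (k - t + 1) ^ (l + 1) else Gamma_deriv l 1 / INR (fact l).

Lemma inner_factor_convs (k jt : nat) :
  inner_factor k jt = convs (map (inner_coef k) (seq 1 (S k))) jt.
Proof.
  rewrite <- sum_compositions; unfold inner_factor; f_equal; apply map_ext; intros ls.
  rewrite seq_S, map_app, prodR_app; simpl (map _ [(1 + k)%nat]); simpl (prodR [_]).
  unfold inner_coef at 2; replace (S k <=? k)%nat with false by (symmetry; apply Nat.leb_gt; lia).
  rewrite Nat.sub_0_r, Rmult_1_r, Rmult_comm; f_equal.
  (* For k = 0 truncated subtraction makes both index lists empty, leaving the Gamma slot alone. *)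
  destruct k as [|k]; [reflexivity|].
  replace (S k - 1)%nat with k by lia.
  rewrite (seq_S k 1), map_app, prodR_app; simpl (map _ [(1 + k)%nat]); simpl (prodR [_]).
  (* The slot t = k has base k-t+1 = 1, so all its coefficients are 1 and the product up to k equals
     the one up to k-1. *)
  unfold inner_coef at 2; rewrite Nat.leb_refl, Nat.sub_diag; simpl INR; rewrite pow1, Rinv_1, !Rmult_1_r.
  f_equal; apply map_ext_in; intros t Ht; apply in_seq in Ht.
  unfold inner_coef; replace (t <=? S k)%nat with true by (symmetry; apply Nat.leb_le; lia).
  reflexivity.
Qed.

(** Coefficients in v of z^v times 1/(1/2+k-v) times the N-th power of Gamma(1+v) prod 1/(i-v). *)
Definition residue_coef (N k : nat) (z : R) : nat -> R :=
  conv (fun l => ln z ^ l / INR (fact l))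
    (conv (fun l => / (1 / 2 + INR k) ^ (l + 1)) (convs (map (fun _ => inner_factor k) (seq 1 N)))).

(** The coefficient of v^(N-1): degree j is taken from z^v, which produces the power of log z,
    degree n-j from the geometric factor, and N-1-n from the N-th power. *)
Lemma series_term_coef (N k : nat) (z : R) : (1 <= N)%nat ->
  series_term N z k = Rpower z (- (1 / 2) - INR k) * ((-1) ^ (N * k) * residue_coef N k z (N - 1)).
Proof.
  intros HN; unfold series_term, residue_coef; f_equal.
  rewrite conv_sum, <- sumR_scal. replace (S (N - 1)) with N by lia.
  f_equal; apply map_ext_in; intros j Hj; apply in_seq in Hj.
  unfold H; rewrite conv_sum. replace (S (N - 1 - j)) with (N - j)%nat by lia.
  transitivity ((-1) ^ (N * k) * (ln z ^ j / INR (fact j) * sumR (map (fun n =>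
     / (1/2 + INR k) ^ (n - j + 1) *
     sumR (map (fun js => prodR (map (fun t => inner_factor k (nth (t - 1) js O)) (seq 1 N)))
               (compositions N (N - 1 - n)))) (seq j (N - j))))); [unfold Rdiv; ring|].
  do 2 f_equal.
  replace (seq j (N - j)) with (map (fun i => (j + i)%nat) (seq 0 (N - j))).
  2: { assert (E : forall n m, map (fun i => (j + i)%nat) (seq m n) = seq (j + m) n).
       { induction n as [|n IH]; intros m; simpl; auto. rewrite IH, Nat.add_succ_r; reflexivity. }
       rewrite E, Nat.add_0_r; reflexivity. }
  rewrite map_map; apply (f_equal sumR), map_ext_in; intros i Hi; apply in_seq in Hi.
  rewrite (sum_compositions N _ (fun _ => inner_factor k)).
  f_equal; [do 3 f_equal; lia | f_equal; lia].
Qed.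

(** * The integrand *)

Lemma holo_mult (al be x0 : R) (f g : C -> C) : holo_punctured al be x0 f -> holo_punctured al be x0 g ->
  holo_punctured al be x0 (fun s => f s * g s)%C.
Proof.
  intros [f' Hf] [g' Hg]; eexists; intros d Hd; apply UQ_mult; [apply Hf, Hd | apply Hg, Hd].
Qed.

Lemma holo_const (al be x0 : R) (c : C) : holo_punctured al be x0 (fun _ => c).
Proof. exists (fun _ => RtoC 0); intros d Hd; apply UQ_const. Qed.

Lemma holo_pow (al be x0 : R) (f : C -> C) (n : nat) : holo_punctured al be x0 f ->
  holo_punctured al be x0 (fun s => f s ^ n)%C.
Proof.
  intros Hf; induction n as [|n IH]; [apply (holo_const al be x0 1)|].
  replace (fun s => f s ^ S n)%C with (fun s => f s * f s ^ n)%C.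
  - apply holo_mult; auto.
  - apply functional_extensionality; intros s; rewrite Cpow_S; reflexivity.
Qed.

Lemma holo_inv (al be x0 p : R) : p = x0 \/ p < al \/ be < p ->
  holo_punctured al be x0 (fun s => / (RtoC p - s))%C.
Proof.
  intros Hp; exists (fun s => (/ (RtoC p - s)) ^ 2)%C; intros d Hd.
  destruct Hp as [->|Hp].
  - apply (UQ_inv _ _ d Hd); intros s [_ Hs]; rewrite Cmod_minus_sym; lra.
  - destruct Hp as [Hp|Hp];
      [apply (UQ_inv _ _ (al - p)) | apply (UQ_inv _ _ (p - be))]; try lra;
      intros s [Hs _]; (eapply Rle_trans; [|apply (Re_le_Cmod (RtoC p - s)%C)]); simpl;
      unfold Rabs; destruct (Rcase_abs (p + - fst s)); lra.
Qed.

Lemma holo_cpowR (al be x0 z : R) : holo_punctured al be x0 (fun s => cpowR z (- s)).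
Proof.
  exists (fun s => - RtoC (ln z) * cpowR z (- s))%C; intros d Hd.
  apply (UQ_cpowR _ z (Rabs al + Rabs be)); intros s [Hs _].
  unfold Rabs; destruct (Rcase_abs (fst s)), (Rcase_abs al), (Rcase_abs be); lra.
Qed.

Lemma holo_gam (al be x0 p : R) : al < be -> be < p ->
  holo_punctured al be x0 (fun s => gam 0 (RtoC p - s)).
Proof.
  intros Hab Hp; exists (fun s => - gam 1 (RtoC p - s))%C; intros d Hd.
  apply (UQ_gam0 _ p (p - be) (p - al)); try lra; intros s [Hs _]; lra.
Qed.

Lemma holo_Cprod (al be x0 : R) (f : nat -> C -> C) (l : list nat) :
  (forall i, In i l -> holo_punctured al be x0 (f i)) ->
  holo_punctured al be x0 (fun s => Cprod (map (fun i => f i s) l)).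
Proof.
  induction l as [|i l IH]; intros H; simpl.
  - apply (holo_const al be x0 1).
  - apply (holo_mult al be x0 (f i) (fun s => Cprod (map (fun i => f i s) l))).
    + apply H; left; auto.
    + apply IH; intros j Hj; apply H; right; auto.
Qed.

Definition inv_factors (m : nat) (s : C) : C :=
  Cprod (map (fun i => / (RtoC (1 / 2 + INR i) - s))%C (seq 0 m)).

(** The integrand [- (1/s) Gamma(1/2 - s)^N z^(-s)], continued to
    [Re s < k + 3/2] by the functional equation. *)
Definition integrand (N k : nat) (z : R) (s : C) : C :=
  (/ (RtoC 0 - s) * cpowR z (- s) *
   (gam 0 (RtoC (INR k + 3 / 2) - s) * inv_factors (S k) s) ^ N)%C.

Lemma holo_integrand (N k : nat) (z al be x0 : R) : al < be -> be < INR k + 3 / 2 ->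
  (0 = x0 \/ 0 < al \/ be < 0) ->
  (forall i, (i <= k)%nat -> 1 / 2 + INR i = x0 \/ 1 / 2 + INR i < al \/ be < 1 / 2 + INR i) ->
  holo_punctured al be x0 (integrand N k z).
Proof.
  intros Hab Hbe H0 Hi; apply holo_mult; [apply holo_mult|apply holo_pow, holo_mult].
  - apply holo_inv; auto.
  - apply holo_cpowR.
  - apply holo_gam; auto.
  - apply holo_Cprod; intros i Hin; apply in_seq in Hin; apply holo_inv, Hi; lia.
Qed.

Lemma Cmod_inv_le_im (p x y : R) : 1 <= Rabs y -> Cmod (/ (RtoC p - (x, y))) <= / Rabs y.
Proof. intros Hy; apply Cmod_inv_vert; lra. Qed.

Lemma integrand_decay (N k : nat) (z al be : R) : (1 <= N)%nat -> al < be -> be < INR k + 3 / 2 ->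
  exists K, 0 <= K /\ forall x y, al <= x <= be -> 1 <= Rabs y ->
    Cmod (integrand N k z (x, y)) <= K / y ^ 2.
Proof.
  intros HN Hab Hbe.
  destruct (gam_bounded (INR k + 3 / 2 - be) (INR k + 3 / 2 - al) 0) as [G [HG HG2]]; try lra.
  set (E := exp ((Rabs al + Rabs be) * Rabs (ln z))); assert (HE : 0 < E) by apply exp_pos.
  exists (E * (G + 1) ^ N); split; [apply Rmult_le_pos; [lra | apply pow_le; lra]|].
  intros x y Hx Hy; unfold integrand; rewrite !Cmod_mult, Cmod_pow, Cmod_mult, Cmod_cpowR.
  assert (H1 : Rpower z (fst (- (x, y))%C) <= E).
  { unfold Rpower; apply exp_le; simpl.
    eapply Rle_trans; [apply Rle_abs|]; rewrite Rabs_mult, Rabs_Ropp.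
    apply Rmult_le_compat_r; [apply Rabs_pos|].
    unfold Rabs; destruct (Rcase_abs x), (Rcase_abs al), (Rcase_abs be); lra. }
  assert (Hiy : 0 < / Rabs y <= 1).
  { split; [apply Rinv_0_lt_compat; lra | rewrite <- Rinv_1; apply Rinv_le_contravar; lra]. }
  assert (H2 : Cmod (inv_factors (S k) (x, y)) <= / Rabs y).
  (* The factor i = 0 alone supplies the decay; the others are at most 1 because |y| >= 1. *)
  { unfold inv_factors; simpl; rewrite Cmod_mult, <- (Rmult_1_r (/ Rabs y)).
    apply Rmult_le_compat; try apply Cmod_ge_0; [apply Cmod_inv_le_im, Hy|].
    induction (seq 1 k) as [|i l IH]; simpl.
    - rewrite Cmod_1; lra.
    - rewrite Cmod_mult; apply Rle_trans with (1 * 1); [|lra].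
      apply Rmult_le_compat; try apply Cmod_ge_0; auto.
      eapply Rle_trans; [apply Cmod_inv_le_im, Hy|]; lra. }
  assert (H3 : Cmod (gam 0 (RtoC (INR k + 3 / 2) - (x, y))) <= G + 1).
  { eapply Rle_trans; [apply HG2; simpl; lra | lra]. }
  assert (H4 : (Cmod (gam 0 (RtoC (INR k + 3 / 2) - (x, y))) * Cmod (inv_factors (S k) (x, y))) ^ N <= (G + 1) ^ N * / Rabs y).
  { apply Rle_trans with (((G + 1) * / Rabs y) ^ N).
    - apply pow_incr; split; [apply Rmult_le_pos; apply Cmod_ge_0|].
      apply Rmult_le_compat; try apply Cmod_ge_0; auto.
    - rewrite Rpow_mult_distr; apply Rmult_le_compat_l; [apply pow_le; lra|].
      destruct N as [|N]; [lia|]. simpl; apply Rle_trans with (/ Rabs y * 1); [|lra].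
      apply Rmult_le_compat_l; [lra|]. rewrite <- (pow1 N); apply pow_incr; lra. }
  apply Rle_trans with (/ Rabs y * E * ((G + 1) ^ N * / Rabs y)).
  - apply Rmult_le_compat; auto.
    + apply Rmult_le_pos; [apply Cmod_ge_0 | apply Rlt_le, exp_pos].
    + apply pow_le, Rmult_le_pos; apply Cmod_ge_0.
    + apply Rmult_le_compat; [apply Cmod_ge_0 | apply Rlt_le, exp_pos | apply Cmod_inv_le_im, Hy | auto].
  - right; rewrite <- (pow2_abs y); field; lra.
Qed.

Lemma integrand_line (N k : nat) (z al be x0 x : R) : (1 <= N)%nat -> al < be -> be < INR k + 3 / 2 ->
  holo_punctured al be x0 (integrand N k z) -> al < x < be -> x <> x0 ->
  (forall y, continuous (U := C_R_NormedModule) (fun y => integrand N k z (x, y)) y) /\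
  exists K, forall y, Cmod (integrand N k z (x, y)) <= K * / (1 + y ^ 2).
Proof.
  intros HN Hab Hbe HF Hx Hn; split; [apply (vseg_holo al be x0 x 0 _ HF Hx Hn)|].
  destruct (integrand_decay N k z al be HN Hab Hbe) as [K1 [HK1 D1]].
  destruct HF as [F' HF], (punctured_line al be x0 x Hx Hn) as [d [Hd HD]].
  destruct (HF d Hd) as [r [K2 [_ [HK2 [B _]]]]].
  (* The factor 2 bounds 1+y^2 by 2 y^2 when |y| >= 1, where [K1] applies, and by 2 otherwise, where
     the uniform bound [K2] off the pole applies. *)
  exists (2 * (K1 + K2)); intros y.
  assert (Hp : 0 < 1 + y ^ 2) by nra.
  apply Rmult_le_reg_r with (1 + y ^ 2); auto; rewrite Rmult_assoc, Rinv_l, Rmult_1_r by lra.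
  pose proof (Cmod_ge_0 (integrand N k z (x, y))) as H0.
  destruct (Rle_dec 1 (Rabs y)) as [Hy|Hy].
  - specialize (D1 x y ltac:(lra) Hy).
    assert (Hy2 : 1 <= y ^ 2) by (rewrite <- pow2_abs; nra).
    apply Rle_trans with (K1 / y ^ 2 * (2 * y ^ 2)); [apply Rmult_le_compat; lra|].
    replace (K1 / y ^ 2 * (2 * y ^ 2)) with (2 * K1) by (field; nra); lra.
  - destruct (B (x, y) (HD y)) as [B1 _].
    assert (Hy2 : y ^ 2 <= 1) by (rewrite <- pow2_abs; pose proof (Rabs_pos y); nra).
    nra.
Qed.

Lemma vanishing_integrand (N k : nat) (z a b : R) : (1 <= N)%nat -> a < b -> b < INR k + 3 / 2 ->
  vanishing (integrand N k z) a b.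
Proof.
  intros HN Hab Hb e He; destruct (integrand_decay N k z a b HN Hab Hb) as [K [HK D]].
  exists (Rmax 1 (K / e)); split; [apply Rlt_le_trans with (1 := Rlt_0_1), Rmax_l|].
  intros Y HY x Hx; pose proof (Rmax_l 1 (K / e)); pose proof (Rmax_r 1 (K / e)).
  assert (HKY : K / Y ^ 2 <= e).
  { apply Rmult_le_reg_r with (Y ^ 2); [nra|].
    unfold Rdiv; rewrite Rmult_assoc, Rinv_l, Rmult_1_r by nra.
    apply Rle_trans with (e * (K / e)); [right; field; lra|].
    apply Rmult_le_compat_l; [lra|]; nra. }
  split; (eapply Rle_trans; [apply D; auto|]).
  - rewrite Rabs_pos_eq; lra.
  - exact HKY.
  - rewrite Rabs_Ropp, Rabs_pos_eq; lra.
  - replace ((- Y) ^ 2) with (Y ^ 2) by ring; exact HKY.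
Qed.

(** * Crossing the poles of the integrand *)

Lemma integrand_shift (N k n : nat) (z al be a b x0 rho : R) (f : C -> C) (c : nat -> R) :
  (1 <= N)%nat -> al < a -> a < x0 -> x0 < b -> b < be -> be < INR k + 3 / 2 ->
  holo_punctured al be x0 (integrand N k z) -> 0 < rho ->
  (forall v, 0 < Cmod v < rho -> integrand N k z (RtoC x0 - v)%C = (f v * (/ v) ^ S n)%C) ->
  expansion (S n) f c ->
  vline (integrand N k z) b = (vline (integrand N k z) a - RtoC (2 * PI) * RtoC (c n))%C.
Proof.
  intros HN Ha Hax Hxb Hb Hbe HF Hrho Hf Hc.
  destruct (integrand_line N k z al be x0 a HN) as [Ca [Ka Da]]; auto; try lra.
  destruct (integrand_line N k z al be x0 b HN) as [Cb [Kb Db]]; auto; try lra.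
  rewrite (vline_shift _ a b Ka Kb (- RtoC (2 * PI) * RtoC (c n))%C); auto; [ring|].
  apply (residue_shift n al be a b x0 rho _ f c); auto.
  apply vanishing_integrand; auto; lra.
Qed.

Lemma Cprod_app (l1 l2 : list C) : Cprod (l1 ++ l2) = (Cprod l1 * Cprod l2)%C.
Proof. induction l1 as [|x l IH]; simpl; [ring | rewrite IH; ring]. Qed.

Lemma Cprod_const (T : Type) (c : C) (l : list T) : Cprod (map (fun _ => c) l) = (c ^ length l)%C.
Proof. induction l as [|x l IH]; simpl; [reflexivity | rewrite IH; reflexivity]. Qed.

Lemma Cprod_scal (T : Type) (c : C) (f : T -> C) (l : list T) :
  Cprod (map (fun i => c * f i)%C l) = (c ^ length l * Cprod (map f l))%C.
Proof. induction l as [|x l IH]; simpl; [ring | rewrite IH; ring]. Qed.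

Lemma RtoC_minus_neq_0 (p : R) (v : C) : Cmod v < Rabs p -> (RtoC p - v)%C <> 0%C.
Proof.
  intros Hv; apply Cmod_gt_0; pose proof (Cmod_triangle' (RtoC p) v) as H; rewrite Cmod_R in H; lra.
Qed.

(** The index i = k-t+1 decreases from k to 1 and Gamma(1+v) comes last, the order in which the l_i
    are numbered. *)
Definition half_factor (k t : nat) (v : C) : C :=
  if (t <=? k)%nat then (/ (RtoC (INR (k - t + 1)) - v))%C else gam 0 (RtoC 1 + v).

Lemma inv_factors_S (m : nat) (s : C) :
  inv_factors (S m) s = (inv_factors m s * / (RtoC (1 / 2 + INR m) - s))%C.
Proof.
  unfold inv_factors; rewrite (seq_S m 0), map_app, Cprod_app; cbn [map Cprod fold_right Nat.add]; ring.
Qed.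

(** At s = 1/2+k-v the Gamma factor is Gamma(1+v), the factor of index k is 1/v, and each i < k
    gives -1/(k-i-v), whence the sign (-1)^k. The bound on |v| keeps k-i-v away from 0. *)
Lemma gam_inv_factors (k : nat) (v : C) : 0 < Cmod v < 1 / 2 ->
  (gam 0 (RtoC (INR k + 3 / 2) - (RtoC (1 / 2 + INR k) - v)) *
   inv_factors (S k) (RtoC (1 / 2 + INR k) - v))%C =
  (RtoC (-1) ^ k * / v * Cprod (map (fun t => half_factor k t v) (seq 1 (S k))))%C.
Proof.
  intros Hv; assert (Hv0 : v <> 0%C) by (apply Cmod_gt_0; lra).
  replace (RtoC (INR k + 3 / 2) - (RtoC (1 / 2 + INR k) - v))%C with (RtoC 1 + v)%C
    by (apply C_eq; simpl; field).
  rewrite (seq_S k 1), map_app, Cprod_app; simpl (Cprod (map _ [(1 + k)%nat])).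
  unfold half_factor at 2; replace (S k <=? k)%nat with false by (symmetry; apply Nat.leb_gt; lia).
  unfold inv_factors; rewrite (seq_S k 0), map_app, Cprod_app; simpl (Cprod (map _ [(0 + k)%nat])).
  replace (RtoC (1 / 2 + INR k) - (RtoC (1 / 2 + INR k) - v))%C with v by ring.
  replace (map (fun i => (/ (RtoC (1 / 2 + INR i) - (RtoC (1 / 2 + INR k) - v)))%C) (seq 0 k))
    with (map (fun i => (RtoC (-1) * half_factor k (S i) v)%C) (seq 0 k)).
  - rewrite Cprod_scal, length_seq, <- (seq_shift k 0), map_map; ring.
  - apply map_ext_in; intros i Hi; apply in_seq in Hi; unfold half_factor.
    replace (S i <=? k)%nat with true by (symmetry; apply Nat.leb_le; lia).
    replace (k - S i + 1)%nat with (k - i)%nat by lia; rewrite minus_INR by lia.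
    assert (Hki : 1 <= INR k - INR i) by (rewrite <- minus_INR by lia; apply (le_INR 1); lia).
    assert (Hnz : (RtoC (INR k - INR i) - v)%C <> 0%C).
    { apply RtoC_minus_neq_0; rewrite Rabs_pos_eq; lra. }
    replace (RtoC (1 / 2 + INR i) - (RtoC (1 / 2 + INR k) - v))%C with (RtoC (-1) * (RtoC (INR k - INR i) - v))%C
      by (apply C_eq; simpl; ring).
    assert (Hm : RtoC (-1) <> 0%C) by (intros H; apply RtoC_inj in H; lra).
    assert (E : (/ RtoC (-1))%C = RtoC (-1)) by (rewrite <- RtoC_inv by lra; f_equal; field).
    rewrite <- E at 1; field; auto.
Qed.

Lemma expansion_half_factors (n k : nat) :
  expansion n (fun v => Cprod (map (fun t => half_factor k t v) (seq 1 (S k)))) (inner_factor k).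
Proof.
  apply (expansion_ext n (fun v => Cprod (map (fun t => half_factor k t v) (seq 1 (S k)))) _
    (convs (map (inner_coef k) (seq 1 (S k)))) _ 1); auto; [lra | | ].
  - intros j; symmetry; apply inner_factor_convs.
  - apply (expansion_Cprod n (half_factor k) (inner_coef k)); intros t _.
    unfold half_factor, inner_coef; destruct (t <=? k)%nat.
    + apply expansion_geometric; apply lt_0_INR; lia.
    + apply expansion_gam; lra.
Qed.

Lemma Cpow_RtoC_m1 (m : nat) : (RtoC (-1) ^ m)%C = RtoC ((-1) ^ m).
Proof. rewrite RtoC_pow; reflexivity. Qed.

Lemma shift_half (N k : nat) (z al be a b : R) : (1 <= N)%nat -> 0 < z ->
  0 < al -> INR k - 1 / 2 < al -> al < a -> a < 1 / 2 + INR k -> 1 / 2 + INR k < b -> b < be -> be < INR k + 3 / 2 ->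
  vline (integrand N k z) b = (vline (integrand N k z) a + RtoC (2 * PI) * RtoC (series_term N z k))%C.
Proof.
  intros HN Hz Hal Hal2 Ha Hax Hxb Hb Hbe.
  set (x0 := 1 / 2 + INR k) in *; pose proof (pos_INR k) as Hk.
  (* The minus sign is that of 1/(0-s) = -1/(x0-v); z^(-s) = z^(-x0) z^v gives the power of z, and
     (-1)^k to the power N the sign. *)
  set (cst := - ((-1) ^ (N * k) * Rpower z (- (1 / 2) - INR k))).
  rewrite (integrand_shift N k (N - 1) z al be a b x0 (1 / 2)
    (fun v => RtoC cst * (cpowR z v * (/ (RtoC x0 - v) *
       Cprod (map (fun _ => Cprod (map (fun t => half_factor k t v) (seq 1 (S k)))) (seq 1 N)))))%C
    (fun j => cst * residue_coef N k z j)); auto; try lra.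
  - rewrite series_term_coef by auto; unfold cst.
    apply C_eq; simpl; ring.
  - apply holo_integrand; try lra.
    intros i Hi; destruct (Nat.eq_dec i k) as [->|Hn]; [left; reflexivity|].
    right; left. assert (INR (S i) <= INR k) by (apply le_INR; lia). rewrite S_INR in H; lra.
  - intros v Hv; assert (Hv0 : v <> 0%C) by (apply Cmod_gt_0; lra).
    unfold integrand, x0; rewrite gam_inv_factors by auto; fold x0.
    replace (S (N - 1)) with N by lia.
    rewrite Cprod_const, length_seq, !Cpow_mult_l.
    replace (- (RtoC x0 - v))%C with (RtoC (- x0) + v)%C by (apply C_eq; simpl; ring).
    rewrite cpowR_plus, cpowR_RtoC.
    rewrite <- Cpow_mult_r, Cpow_RtoC_m1.
    unfold cst; replace (- (1 / 2) - INR k) with (- x0) by (unfold x0; ring).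
    rewrite RtoC_opp, RtoC_mult, (Nat.mul_comm k N).
    assert (Hnz : (RtoC x0 - v)%C <> 0%C).
    { apply RtoC_minus_neq_0; unfold x0; rewrite Rabs_pos_eq; lra. }
    replace (RtoC 0 - (RtoC x0 - v))%C with (- (RtoC x0 - v))%C by ring.
    assert (E : (/ - (RtoC x0 - v) = - / (RtoC x0 - v))%C).
    { clear - Hnz; revert Hnz; generalize (RtoC x0 - v)%C; intros X HX; field; auto. }
    rewrite E; ring.
  - replace (S (N - 1)) with N by lia.
    apply (expansion_scal N (fun v => cpowR z v * (/ (RtoC x0 - v) *
       Cprod (map (fun _ => Cprod (map (fun t => half_factor k t v) (seq 1 (S k)))) (seq 1 N))))%C).
    apply expansion_mult; [apply expansion_cpowR|].
    apply (expansion_mult N (fun v => / (RtoC x0 - v))%C); [apply expansion_geometric; unfold x0; lra|].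
    apply (expansion_Cprod N (fun _ v => Cprod (map (fun t => half_factor k t v) (seq 1 (S k)))) (fun _ => inner_factor k)).
    intros; apply expansion_half_factors.
Qed.

Lemma convs_const_0 (T : Type) (a : nat -> R) (l : list T) : convs (map (fun _ => a) l) 0 = a O ^ length l.
Proof. induction l as [|x l IH]; simpl; [reflexivity | rewrite IH; reflexivity]. Qed.

Lemma sqrt_PI_pow (N : nat) : sqrt PI ^ N = Rpower PI (INR N / 2).
Proof.
  rewrite <- Rpower_sqrt by apply PI_RGT_0.
  rewrite <- Rpower_pow, Rpower_mult by apply Rpower_pos; f_equal; field.
Qed.

Lemma shift_zero (N : nat) (z c : R) : (1 <= N)%nat -> c < 0 ->
  vline (integrand N 0 z) (1 / 4) =
  (vline (integrand N 0 z) c - RtoC (2 * PI) * RtoC (Rpower PI (INR N / 2)))%C.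
Proof.
  intros HN Hc; pose (cg := fun l => Gamma_deriv l (1 / 2) / INR (fact l)).
  (* The right edge 3/8 leaves the pole 1/2 outside the strip. The pole at 0 is simple, so the
     constant coefficient Gamma(1/2)^N is the one that counts. *)
  rewrite (integrand_shift N 0 0 z (c - 1) (3 / 8) c (1 / 4) 0 (1 / 2)
    (fun v => cpowR z v * Cprod (map (fun _ => gam 0 (RtoC (1 / 2) + v)) (seq 1 N)))%C
    (conv (fun l => ln z ^ l / INR (fact l)) (convs (map (fun _ => cg) (seq 1 N))))); auto; try (simpl; lra).
  - assert (E : cg O = sqrt PI).
    { unfold cg; change (Gamma_deriv 0 (1 / 2)) with (GammaR (1 / 2)); rewrite GammaR_half; simpl; field. }
    unfold conv; rewrite convs_const_0, length_seq, E, sqrt_PI_pow; simpl (ln z ^ 0 / INR (fact 0)).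
    rewrite Rdiv_1_r, Rmult_1_l; reflexivity.
  - apply holo_integrand; try (simpl; lra).
    intros i Hi; replace i with O by lia; simpl; lra.
  - intros v Hv; assert (Hv0 : v <> 0%C) by (apply Cmod_gt_0; lra).
    unfold integrand, inv_factors; rewrite Cprod_const, length_seq; simpl.
    replace (- (RtoC 0 - v))%C with v by ring.
    replace (RtoC 0 - (RtoC 0 - v))%C with v by ring.
    assert (Hre : 0 < fst (RtoC (1 / 2) + v)%C).
    { simpl; pose proof (Re_le_Cmod v) as Hr; apply Rabs_le_between in Hr; lra. }
    replace (RtoC (0 + 3 / 2) - (RtoC 0 - v))%C with ((RtoC (1 / 2) + v) + 1)%C by (apply C_eq; simpl; field).
    rewrite gam_succ by auto.
    replace (RtoC (1 / 2 + 0) - (RtoC 0 - v))%C with (RtoC (1 / 2) + v)%C by (apply C_eq; simpl; ring).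
    assert (Hnz : (RtoC (1 / 2) + v)%C <> 0%C).
    { intros H; rewrite H in Hre; simpl in Hre; lra. }
    replace ((RtoC (1 / 2) + v) * gam 0 (RtoC (1 / 2) + v) * (/ (RtoC (1 / 2) + v) * 1))%C
      with (gam 0 (RtoC (1 / 2) + v)) by (field; auto).
    ring.
  - apply expansion_mult; [apply expansion_cpowR|].
    apply (expansion_Cprod 1 (fun _ v => gam 0 (RtoC (1 / 2) + v)) (fun _ => cg)).
    intros; apply expansion_gam; lra.
Qed.

(** On Re s = k+1 both continuations are available: Gamma(k+5/2-s) = (k+3/2-s) Gamma(k+3/2-s), and
    the new rational factor cancels k+3/2-s. *)
Lemma integrand_succ (N k : nat) (z y : R) :
  integrand N (S k) z (INR k + 1, y) = integrand N k z (INR k + 1, y).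
Proof.
  unfold integrand; do 2 f_equal.
  set (s := ((INR k + 1)%R, y) : C); set (w := (RtoC (INR k + 3 / 2) - s)%C).
  assert (Hw : 0 < fst w) by (unfold w, s; simpl; lra).
  assert (Hw0 : w <> 0%C) by (intros H; rewrite H in Hw; simpl in Hw; lra).
  replace (RtoC (INR (S k) + 3 / 2) - s)%C with (w + 1)%C
    by (unfold w; rewrite S_INR; apply C_eq; simpl; ring).
  rewrite gam_succ by auto.
  rewrite (inv_factors_S (S k)).
  replace (RtoC (1 / 2 + INR (S k)) - s)%C with w by (unfold w; rewrite S_INR; apply C_eq; simpl; field).
  field; auto.
Qed.

(** The line Re s = K+1 lies between the poles K+1/2 and K+3/2: it is the right end of one crossing
    and, after the change of continuation, the left end of the next. *)
Lemma vline_partial_sum (N K : nat) (z c : R) : (1 <= N)%nat -> 0 < z -> c < 0 ->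
  vline (integrand N K z) (INR K + 1) =
  (vline (integrand N 0 z) c - RtoC (2 * PI) * RtoC (Rpower PI (INR N / 2))
   + RtoC (2 * PI) * RtoC (sum_n (series_term N z) K))%C.
Proof.
  intros HN Hz Hc; induction K as [|K IH].
  - rewrite (shift_half N 0 z (1 / 8) (5 / 4) (1 / 4)) by (auto; simpl; lra).
    rewrite (shift_zero N z c), sum_O by auto; reflexivity.
  - pose proof (pos_INR K) as HK.
    rewrite (shift_half N (S K) z (INR K + 3 / 4) (INR K + 9 / 4) (INR K + 1)) by (auto; rewrite ?S_INR; lra).
    replace (vline (integrand N (S K) z) (INR K + 1)) with (vline (integrand N K z) (INR K + 1)).
    2: { unfold vline; f_equal; apply functional_extensionality; intros y; symmetry; apply integrand_succ. }
    rewrite IH, sum_Sn. change (plus (sum_n (series_term N z) K) (series_term N z (S K)))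
      with (sum_n (series_term N z) K + series_term N z (S K)). rewrite RtoC_plus; ring.
Qed.

(** * Decay on the lines Re s = K+1 *)

Lemma Cmod_sqr_ge (x y d : R) : 0 <= d -> d ^ 2 <= x ^ 2 + y ^ 2 -> d <= Cmod (x, y).
Proof.
  intros Hd H; rewrite Cmod_pair, <- (sqrt_pow2 d Hd); apply sqrt_le_1_alt, H.
Qed.

(** For i < k the pole 1/2+i is at horizontal distance k-i+1/2 >= k-i, and these distances multiply
    to at least k!. The pole 1/2+k, at horizontal distance 1/2, provides the decay in y. *)
Lemma inv_factors_bound (k : nat) (y : R) :
  Cmod (inv_factors (S k) (INR k + 1, y)) <= 2 / sqrt (1 + y ^ 2) / INR (fact k).
Proof.
  set (s := ((INR k + 1)%R, y) : C).
  assert (Hs : 0 < sqrt (1 + y ^ 2)) by (apply sqrt_lt_R0; nra).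
  assert (Hf : forall m, 0 < INR (fact m)) by (intros; apply lt_0_INR, lt_O_fact).
  assert (HP : forall m, (m <= k)%nat -> Cmod (inv_factors m s) <= INR (fact (k - m)) / INR (fact k)).
  { induction m as [|m IH]; intros Hm.
    - unfold inv_factors; simpl; rewrite Cmod_1, Nat.sub_0_r; right; field; apply Rgt_not_eq, Hf.
    - rewrite inv_factors_S, Cmod_mult; specialize (IH ltac:(lia)).
      assert (Hd : 0 < INR (k - m)) by (apply lt_0_INR; lia).
      assert (Hi : Cmod (/ (RtoC (1 / 2 + INR m) - s)) <= / INR (k - m)).
      { assert (Hle : INR (k - m) <= Cmod (RtoC (1 / 2 + INR m) - s)).
        { eapply Rle_trans; [|apply Re_le_Cmod]; unfold s; simpl.
          rewrite minus_INR in * by lia. rewrite Rabs_left; lra. }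
        rewrite Cmod_inv; [apply Rinv_le_contravar; auto|].
        apply Cmod_gt_0; lra. }
      apply Rle_trans with (INR (fact (k - m)) / INR (fact k) * / INR (k - m)).
      + apply Rmult_le_compat; try apply Cmod_ge_0; auto.
      + right; assert (E : INR (fact (k - m)) = INR (k - m) * INR (fact (k - S m))).
        { replace (k - m)%nat with (S (k - S m)) by lia; rewrite fact_simpl, mult_INR; reflexivity. }
        rewrite E; field; split; apply Rgt_not_eq; first [exact Hd | apply Hf]. }
  rewrite inv_factors_S, Cmod_mult; specialize (HP k (Nat.le_refl k)); rewrite Nat.sub_diag in HP; simpl (INR (fact 0)) in HP.
  assert (Hle : sqrt (1 + y ^ 2) / 2 <= Cmod (RtoC (1 / 2 + INR k) - s)).
  { replace (RtoC (1 / 2 + INR k) - s)%C with (((- (1 / 2))%R, (- y)%R) : C) by (unfold s; apply C_eq; simpl; field).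
    apply Cmod_sqr_ge; [lra|].
    replace ((sqrt (1 + y ^ 2) / 2) ^ 2) with (sqrt (1 + y ^ 2) ^ 2 / 4) by field.
    rewrite pow2_sqrt by nra; nra. }
  assert (Hi : Cmod (/ (RtoC (1 / 2 + INR k) - s)) <= 2 / sqrt (1 + y ^ 2)).
  { rewrite Cmod_inv by (apply Cmod_gt_0; lra).
    replace (2 / sqrt (1 + y ^ 2)) with (/ (sqrt (1 + y ^ 2) / 2)) by (field; lra).
    apply Rinv_le_contravar; lra. }
  apply Rle_trans with (1 / INR (fact k) * (2 / sqrt (1 + y ^ 2))).
  - apply Rmult_le_compat; try apply Cmod_ge_0; auto.
  - right; field; split; apply Rgt_not_eq; first [exact Hs | apply Hf].
Qed.

Lemma vline_bound (N : nat) (z : R) : (1 <= N)%nat -> 0 < z ->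
  exists M, 0 <= M /\ forall K, Cmod (vline (integrand N K z) (INR K + 1)) <= M * ((/ z) ^ K / INR (fact K)).
Proof.
  intros HN Hz.
  (* K+3/2 - (K+1) = 1/2 for every K, so [G] is fixed before K. *)
  destruct (gam_bounded (1 / 2) (1 / 2) 0) as [G [HG HG2]]; try lra.
  exists (/ z * (2 * (G + 1)) ^ N * PI); split.
  { pose proof PI_RGT_0; pose proof (Rinv_0_lt_compat z Hz).
    apply Rmult_le_pos; [apply Rmult_le_pos; [lra | apply pow_le; lra] | lra]. }
  intros K; pose proof (pos_INR K) as HK.
  assert (Hf : 1 <= INR (fact K)) by (apply (le_INR 1), lt_O_fact).
  assert (HF : holo_punctured (INR K + 3 / 4) (INR K + 5 / 4) (INR K + 1 / 2) (integrand N K z)).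
  { apply holo_integrand; try lra. intros i Hi; apply le_INR in Hi; right; left; lra. }
  destruct (integrand_line N K z (INR K + 3 / 4) (INR K + 5 / 4) (INR K + 1 / 2) (INR K + 1) HN ltac:(lra) ltac:(lra) HF ltac:(lra) ltac:(lra)) as [Hc _].
  replace (/ z * (2 * (G + 1)) ^ N * PI * ((/ z) ^ K / INR (fact K))) with
    ((/ z) ^ S K * ((2 * (G + 1)) ^ N * / INR (fact K)) * PI) by (simpl; unfold Rdiv; ring).
  apply (vline_correct _ _ _ Hc); intros y.
  set (q := sqrt (1 + y ^ 2)).
  assert (Hq : 1 <= q).
  { unfold q; rewrite <- sqrt_1 at 1; apply sqrt_le_1_alt; nra. }
  assert (Hq2 : q * q = 1 + y ^ 2) by (apply sqrt_sqrt; nra).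
  assert (Hiq : 0 < / q <= 1).
  { split; [apply Rinv_0_lt_compat; lra | rewrite <- Rinv_1; apply Rinv_le_contravar; lra]. }
  assert (Hif : 0 < / INR (fact K) <= 1).
  { split; [apply Rinv_0_lt_compat; lra | rewrite <- Rinv_1; apply Rinv_le_contravar; lra]. }
  unfold integrand; rewrite !Cmod_mult, Cmod_pow, Cmod_mult, Cmod_cpowR.
  set (s := ((INR K + 1)%R, y) : C).
  assert (H1 : Cmod (/ (RtoC 0 - s)) <= / q).
  { assert (Hle : q <= Cmod (RtoC 0 - s)).
    { replace (RtoC 0 - s)%C with (((- (INR K + 1))%R, (- y)%R) : C) by (unfold s; apply C_eq; simpl; ring).
      apply Cmod_sqr_ge; [lra|]. replace (q ^ 2) with (q * q) by ring; rewrite Hq2; nra. }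
    rewrite Cmod_inv by (apply Cmod_gt_0; lra); apply Rinv_le_contravar; lra. }
  assert (H2 : Rpower z (fst (- s)%C) = (/ z) ^ S K).
  { unfold s; simpl fst; rewrite Rpower_Ropp, <- S_INR, Rpower_pow, pow_inv; auto. }
  assert (H3 : Cmod (gam 0 (RtoC (INR K + 3 / 2) - s)) <= G + 1).
  { eapply Rle_trans; [apply HG2; unfold s; simpl; lra | lra]. }
  pose proof (inv_factors_bound K y) as H4; fold q in H4; fold s in H4.
  assert (H5 : (Cmod (gam 0 (RtoC (INR K + 3 / 2) - s)) * Cmod (inv_factors (S K) s)) ^ N <=
    (2 * (G + 1)) ^ N * (/ q * / INR (fact K))).
  { apply Rle_trans with ((2 * (G + 1) * (/ q * / INR (fact K))) ^ N).
    - apply pow_incr; split; [apply Rmult_le_pos; apply Cmod_ge_0|].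
      apply Rle_trans with ((G + 1) * (2 / q / INR (fact K))).
      + apply Rmult_le_compat; try apply Cmod_ge_0; auto.
      + right; unfold Rdiv; ring.
    (* The quantity 1/(q K!) is at most 1, so one of its N powers can be kept and the others bounded
       by 1. *)
    - rewrite Rpow_mult_distr; apply Rmult_le_compat_l; [apply pow_le; lra|].
      destruct N as [|n]; [lia|]; simpl.
      assert (Hp : 0 <= / q * / INR (fact K) <= 1) by nra.
      apply Rle_trans with (/ q * / INR (fact K) * 1); [|lra].
      apply Rmult_le_compat_l; [lra|]; rewrite <- (pow1 n); apply pow_incr; lra. }
  rewrite H2.
  assert (Hz1 : 0 < (/ z) ^ S K) by (apply pow_lt, Rinv_0_lt_compat, Hz).
  apply Rle_trans with (/ q * (/ z) ^ S K * ((2 * (G + 1)) ^ N * (/ q * / INR (fact K)))).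
  - apply Rmult_le_compat; auto.
    + apply Rmult_le_pos; [apply Cmod_ge_0 | lra].
    + apply pow_le, Rmult_le_pos; apply Cmod_ge_0.
    + apply Rmult_le_compat_r; lra.
  - right; rewrite <- Hq2; field; split; lra.
Qed.

(** * Reduction of the G-function to the line integral *)

Lemma map_repeat_Cprod (f : R -> C) (x : R) (N : nat) : Cprod (map f (repeat x N)) = (f x ^ N)%C.
Proof. induction N as [|N IH]; simpl; [reflexivity | rewrite IH; reflexivity]. Qed.

Lemma MeijerG_vline (N : nat) (c z : R) : (1 <= N)%nat -> c < 0 ->
  MeijerG_line 0 (S N) (1 :: repeat (1/2) N) [0] c z = (/ RtoC (2 * PI) * vline (integrand N 0 z) c)%C.
Proof.
  intros HN Hc.
  assert (HF : holo_punctured (c - 1) (c / 2) 0 (integrand N 0 z)).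
  { apply holo_integrand; try (simpl; lra). intros i _; pose proof (pos_INR i); right; right; lra. }
  destruct (integrand_line N 0 z (c - 1) (c / 2) 0 c HN ltac:(lra) ltac:(simpl; lra) HF ltac:(lra) ltac:(lra)) as [Cc [K HK]].
  destruct (vline_correct _ c K Cc HK) as [HI _].
  unfold MeijerG_line, vline_integral.
  rewrite (firstn_all2 (1 :: repeat (1/2) N)), (skipn_all2 (1 :: repeat (1/2) N))
    by (simpl; rewrite repeat_length; lia).
  match goal with |- (_ * RInt_gen ?g _ _)%C = _ =>
    replace g with (fun y => Ci * integrand N 0 z (c, y))%C end.
  - rewrite (is_RInt_gen_unique (V := C_R_CompleteNormedModule) _ _ (is_RInt_gen_Cscal _ _ _ Ci _ HI)).
    pose proof PI_RGT_0.
    assert (Hci : Ci <> 0%C) by (intros H0; apply (f_equal snd) in H0; simpl in H0; lra).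
    assert (H2pi : RtoC (2 * PI) <> 0%C) by (intros H0; apply RtoC_inj in H0; lra).
    field; auto.
  - apply functional_extensionality; intros y; set (s := (c, y) : C).
    simpl firstn; simpl skipn; simpl map; simpl Cprod.
    rewrite map_repeat_Cprod, !GammaC_gam.
    replace (RtoC 1 - RtoC 1 - s)%C with (- s)%C by ring.
    replace (RtoC 1 - RtoC 0 - s)%C with (- s + 1)%C by ring.
    replace (RtoC 1 - RtoC (1 / 2) - s)%C with (RtoC (1 / 2) - s)%C by (apply C_eq; simpl; field).
    assert (Hs : 0 < fst (- s)%C) by (unfold s; simpl; lra).
    assert (Hs0 : (- s)%C <> 0%C) by (intros H; rewrite H in Hs; simpl in Hs; lra).
    (* The denominator Gamma(1-s) becomes -s Gamma(-s), and the nonvanishing of Gamma(-s) permits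
       the cancellation with the numerator. *)
    rewrite gam_succ by auto; pose proof (gam0_neq_0 _ Hs) as Hg.
    unfold integrand, inv_factors; simpl.
    assert (Hh : 0 < fst (RtoC (1 / 2) - s)%C) by (unfold s; simpl; lra).
    assert (Hh0 : (RtoC (1 / 2) - s)%C <> 0%C) by (intros H; rewrite H in Hh; simpl in Hh; lra).
    replace (RtoC (0 + 3 / 2) - s)%C with ((RtoC (1 / 2) - s) + 1)%C by (apply C_eq; simpl; field).
    rewrite gam_succ by auto.
    replace (RtoC (1 / 2 + 0) - s)%C with (RtoC (1 / 2) - s)%C by (apply C_eq; simpl; ring).
    replace ((RtoC (1 / 2) - s) * gam 0 (RtoC (1 / 2) - s) * (/ (RtoC (1 / 2) - s) * 1))%C
      with (gam 0 (RtoC (1 / 2) - s)) by (field; auto).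
    replace (RtoC 0 - s)%C with (- s)%C by ring.
    set (gs := gam 0 (- s)) in *; set (ms := (- s)%C) in *.
    field; auto.
Qed.

(* N >= 1; the contour is any vertical line Re s = c with c < 0, which
   separates the poles 0,1,2,... and 1/2,3/2,... of Gamma(-s) Gamma(1/2-s)^N
   (there are no poles of the other family since m = 0). *)
Theorem theorem2 (N : nat) (HN : (1 <= N)%nat) (c : R) (Hc : c < 0)
  (z : R) (Hz : 0 < z) :
  ex_series (series_term N z) /\
  MeijerG_line 0 (S N) (1 :: repeat (1/2) N) [0] c z
  = RtoC (Rpower PI (INR N / 2) - Series (series_term N z)).
Proof.
  rewrite MeijerG_vline by auto.
  set (V := vline (integrand N 0 z) c); set (P := Rpower PI (INR N / 2)).
  pose proof PI_RGT_0 as Hpi.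
  destruct (vline_bound N z HN Hz) as [M [HM HB]].
  pose proof (fun K => vline_partial_sum N K z c HN Hz Hc) as HS; fold V P in HS.
  (* The sum forced by the shifting identity, in which V - 2 pi P + 2 pi times the partial sum tends
     to 0. *)
  set (l := P - fst V / (2 * PI)).
  assert (Hlim : forall e, 0 < e -> exists K0, forall K, (K0 <= K)%nat ->
    Cmod (vline (integrand N K z) (INR K + 1)) < e).
  { intros e He.
    destruct (cv_speed_pow_fact (/ z) (e / (M + 1))) as [K0 HK0]; [apply Rdiv_lt_0_compat; lra|].
    exists K0; intros K HK; specialize (HK0 K HK); unfold Rdist in HK0; rewrite Rminus_0_r in HK0.
    eapply Rle_lt_trans; [apply HB|].
    assert (Hp : 0 <= (/ z) ^ K / INR (fact K)).
    { apply Rmult_le_pos; [apply pow_le, Rlt_le, Rinv_0_lt_compat, Hz|].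
      apply Rlt_le, Rinv_0_lt_compat, lt_0_INR, lt_O_fact. }
    rewrite Rabs_pos_eq in HK0 by auto.
    apply Rmult_lt_compat_l with (r := M + 1) in HK0; [|lra].
    replace ((M + 1) * (e / (M + 1))) with e in HK0 by (field; lra). nra. }
  (* All other terms of the identity are real, so every far line integral has the imaginary part of
     [V], while these integrals tend to 0. *)
  assert (Him : snd V = 0).
  { assert (H0 : Rabs (snd V) <= 0); [|apply Rabs_eq_0, Rle_antisym; [exact H0 | apply Rabs_pos]].
    apply le_epsilon; intros e He; destruct (Hlim e He) as [K HK]; specialize (HK K (Nat.le_refl K)).
    rewrite HS in HK.
    match type of HK with Cmod ?w < _ => pose proof (Im_le_Cmod w) as Hi;
      replace (snd w) with (snd V) in Hi by (simpl; ring) end.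
    lra. }
  assert (Hser : is_series (series_term N z) l).
  { apply filterlim_locally; intros e; pose proof (cond_pos e) as He.
    destruct (Hlim e He) as [K0 HK0]; exists K0; intros K HK; specialize (HK0 K HK).
    change (Rabs (sum_n (series_term N z) K - l) < e).
    rewrite HS in HK0.
    match type of HK0 with Cmod ?w < _ => pose proof (Re_le_Cmod w) as Hr;
      replace (fst w) with (2 * PI * (sum_n (series_term N z) K - l)) in Hr by (unfold l; simpl; field; lra) end.
    rewrite Rabs_mult, (Rabs_pos_eq (2 * PI)) in Hr by lra.
    pose proof (Rabs_pos (sum_n (series_term N z) K - l)); pose proof PI2_1.
    assert (1 <= 2 * PI) by lra. nra. }
  split; [exists l; exact Hser|].
  rewrite (is_series_unique _ _ Hser); unfold l.
  assert (HV : V = RtoC (fst V)) by (apply C_eq; [reflexivity | exact Him]).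
  rewrite HV at 1; rewrite <- RtoC_inv, <- RtoC_mult by lra; f_equal; field; lra.
Qed.
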